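(* Let $\sharp\in\{cy,ra\}$ and assume (ER$\sharp$) and (NE). 1) The maps $\boldsymbol\zeta\mapsto\rho^\sharp_{+,\boldsymbol\zeta}$, $\boldsymbol\zeta\mapsto\Phi_{j,\boldsymbol\zeta}$ and $\boldsymbol\zeta\mapsto\Phi^{cy}_{j,\boldsymbol\zeta}$ are infinitely differentiable on $\mathbb R^M$; define the kinetic coefficients $L^\sharp_{jk}:=\partial_{\zeta_k}\,\mathrm{Tr}\big(\rho^\sharp_{+,\boldsymbol\zeta}\,\Phi^\sharp_{j,\boldsymbol\zeta}\big)\big|_{\boldsymbol\zeta=0}$, where $\Phi^{ra}_j:=\Phi_j$. 2) With all quantities on the right-hand sides evaluated at $\boldsymbol\zeta=0$ and $\rho_+:=\rho_{+,0}$, $$L^{cy}_{jk}=T\sum_{n=0}^{\infty}\rho_+\Big(\mathcal L_{k+1}^*\circ\cdots\circ\mathcal L_M^*\circ(\mathcal L_{cy}^* )^{n}\circ\mathcal L_1^*\circ\cdots\circ\mathcal L_{j-1}^*(\Phi_j)\,\Phi_{k,\mathrm{rev}}\Big)+\delta_{j>k}\,T\,\rho_+\Big(\mathcal L_{k+1}^*\circ\cdots\circ\mathcal L_{j-1}^*(\Phi_j)\,\Phi_{k,\mathrm{rev}}\Big)+\tfrac12\delta_{jk}\,\rho_+\big(\mathcal D_j(H'_{\mathcal S},H'_{\mathcal S})\big),$$ $$L^{ra}_{jk}=\frac TM\sum_{n=0}^{\infty}\rho_+\big((\mathcal L_{ra}^* )^{n}(\Phi_j)\,\Phi_{k,\mathrm{rev}}\big)+\tfrac12\delta_{jk}\,\rho_+\big(\mathcal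 D_j(H'_{\mathcal S},H'_{\mathcal S})\big),$$ where $\rho_+(X):=\mathrm{Tr}(\rho_+X)$ (the case $\sharp=cy$ under (ER cy), the case $\sharp=ra$ under (ER ra)). 3) If moreover (TRI) holds, then $L^{cy}_{jk}=L^{rcy}_{kj}$ and $L^{ra}_{jk}=L^{ra}_{kj}$ for all $j,k$. In the specific case $M=2$ one has $L^{cy}_{jk}=L^{cy}_{kj}$.
   Context: Setting: $\mathcal H_{\mathcal S}$ and $\mathcal H_{\mathcal E_j}$, $j=1,\dots,M$ ($M\ge2$), are finite-dimensional Hilbert spaces with self-adjoint Hamiltonians $H_{\mathcal S}$, $H_{\mathcal E_j}$; $V_j$ is a self-adjoint operator on $\mathcal H_{\mathcal S}\otimes\mathcal H_{\mathcal E_j}$, $\tau_j>0$, $T=\tau_1+\dots+\tau_M$, $H_j=H_{\mathcal S}\otimes\mathrm{Id}+\mathrm{Id}\otimes H_{\mathcal E_j}+V_j$, $U_j=e^{-i\tau_jH_j}$. Fix $\beta_{\rm ref}>0$. For thermal forces $\boldsymbol\zeta\in\mathbb R^M$ set $\beta_j=\beta_{\rm ref}-\zeta_j$ and $\rho_{\mathcal E_j}=e^{-\beta_jH_{\mathcal E_j}}/\mathrm{Tr}(e^{-\beta_jH_{\mathcal E_j}})$. Reduced dynamics on operators of $\mathcal H_{\mathcal S}$: $\mathcal L_j(\rho)=\mathrm{Tr}_{\mathcal H_{\mathcal E_j}}(U_j(\rho\otimes\rho_{\mathcal E_j})U_j^* )$, dual $\mathcal L_j^*(X)=\mathrm{Tr}_{\mathcal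 H_{\mathcal E_j}}((\mathrm{Id}\otimes\rho_{\mathcal E_j})U_j^*(X\otimes\mathrm{Id})U_j)$; $\mathcal L_{cy}=\mathcal L_M\circ\cdots\circ\mathcal L_1$, $\mathcal L_{ra}=\frac1M\sum_j\mathcal L_j$; the reversed-order cyclic map is $\mathcal L_{rcy}=\mathcal L_1\circ\cdots\circ\mathcal L_M$. Dependence on $\boldsymbol\zeta$ is indicated by a subscript ($\mathcal L_j$ depends only on $\zeta_j$); a scalar subscript $\zeta$ means all $\zeta_j=\zeta$. A completely positive map with Kraus form $\sum_iV_i\cdot V_i^*$ is primitive if for some $n$ the products $V_{i_1}\cdots V_{i_n}$ span all operators on the space. (ER$\sharp$): there exists $\boldsymbol\zeta$ such that $\mathcal L_{\sharp,\boldsymbol\zeta}$ is primitive; then $\rho^\sharp_{+,\boldsymbol\zeta}$ denotes the unique invariant state of $\mathcal L_{\sharp,\boldsymbol\zeta}$ (and $\rho^{rcy}_{+,\boldsymbol\zeta}$ that of $\mathcal L_{rcy,\boldsymbol\zeta}$). (NE): there is a map $\zeta\mapsto\rho_{+,\zeta}$ into states on $\mathcal H_{\mathcal S}$ such that for every $j$ and $\zeta\in\mathbb R$, $U_j(\rho_{+,\zeta}\otimes\rho_{\mathcal E_j,\zeta})U_j^*=\rho_{+,\zeta}\otimes\rho_{\mathcal E_j,\zeta}$, where $\rho_{\mathcal E_j,\zeta}$ is the Gibbs state of $H_{\mathcal E_j}$ at inverse temperature $\beta_{\rm ref}-\zeta$. Effective Hamiltonian: $H'_{\mathcal S}=-\beta_{\rm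 ref}^{-1}\log\rho_{+,0}$. (TRI): there exist antiunitary involutions $\theta$ on $\mathcal H_{\mathcal S}$ and $\theta_{\mathcal E_j}$ on $\mathcal H_{\mathcal E_j}$ with $\theta H_{\mathcal S}=H_{\mathcal S}\theta$, $\theta_{\mathcal E_j}H_{\mathcal E_j}=H_{\mathcal E_j}\theta_{\mathcal E_j}$, $(\theta\otimes\theta_{\mathcal E_j})V_j=V_j(\theta\otimes\theta_{\mathcal E_j})$. Fluxes: $\Phi_j=-\frac1T\mathrm{Tr}_{\mathcal H_{\mathcal E_j}}\big((\mathrm{Id}\otimes\rho_{\mathcal E_j})(U_j^*(\mathrm{Id}\otimes H_{\mathcal E_j})U_j-\mathrm{Id}\otimes H_{\mathcal E_j})\big)$, $\Phi_{j,\mathrm{rev}}=\frac1T\mathrm{Tr}_{\mathcal H_{\mathcal E_j}}\big((\mathrm{Id}\otimes\rho_{\mathcal E_j})(U_j(\mathrm{Id}\otimes H_{\mathcal E_j})U_j^*-\mathrm{Id}\otimes H_{\mathcal E_j})\big)$, $\Phi^{cy}_j=\mathcal L_1^*\circ\cdots\circ\mathcal L_{j-1}^*(\Phi_j)$, and for the reversed-order cycle $\Phi^{rcy}_j=\mathcal L_M^*\circ\cdots\circ\mathcal L_{j+1}^*(\Phi_j)$, with $L^{rcy}_{jk}=\partial_{\zeta_k}\mathrm{Tr}(\rho^{rcy}_{+,\boldsymbol\zeta}\Phi^{rcy}_{j,\boldsymbol\zeta})|_{\boldsymbol\zeta=0}$. Dissipation function: $\mathcal D_j(X,Y)=\frac1T\big(\mathcal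 L_j^*(X^*Y)-\mathcal L_j^*(X^* )Y-X^*\mathcal L_j^*(Y)+X^*Y\big)$. $\delta_{j>k}$ is $1$ if $j>k$ and $0$ otherwise. *)

(* Defs.v *)
(* MathComp + MathComp-Analysis, complex numbers R[i] from
   mathcomp-real-closed (complex.v), tensor products of matrices from
   mathcomp-real-closed (mxtens.v). *)
From HB Require Import structures.
From mathcomp Require Import all_boot all_order all_algebra.
From mathcomp Require Import all_classical all_reals all_analysis.
From mathcomp Require Import complex mxtens.

Set Implicit Arguments.
Unset Strict Implicit.
Unset Printing Implicit Defensive.

Import Order.TTheory GRing.Theory Num.Theory.
Import numFieldNormedType.Exports.
Local Open Scope ring_scope.
Local Open Scope classical_set_scope.
Local Open Scope complex_scope.

(* Linear algebra over C = R[i]                                         *)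

Section LinAlg.
Variable R : realType.
Local Notation C := (R[i]).

(* the adjoint (conjugate transpose) of a matrix *)
Definition adjmx m n (A : 'M[C]_(m, n)) : 'M[C]_(n, m) := (map_mx (@conjc R) A)^T.

Definition hermitian n (A : 'M[C]_n) : Prop := adjmx A = A.

(* positive semi-definite: <v, A v> is real and nonnegative for all v *)
Definition psd n (A : 'M[C]_n) : Prop :=
  forall v : 'cV[C]_n, complex.Im ((adjmx v *m A *m v) 0 0) = 0 /\
                        0 <= complex.Re ((adjmx v *m A *m v) 0 0).

(* density matrices (states) *)
Definition state n (rho : 'M[C]_n) : Prop :=
  hermitian rho /\ psd rho /\ \tr rho = 1.

Definition mxpow n (A : 'M[C]_n) (k : nat) : 'M[C]_n := iter k (mulmx A) 1%:M.

(* partial sums of the exponential series *)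
Definition expm_partial n (A : 'M[C]_n) (N : nat) : 'M[C]_n :=
  \sum_(k < N) ((k`!)%:R^-1 : C) *: mxpow A k.

(* matrix exponential: entrywise limit of the (always convergent) series *)
Definition expm n (A : 'M[C]_n) : 'M[C]_n :=
  \matrix_(a, b) (limn (fun N => complex.Re (expm_partial A N a b)) +i*
                  limn (fun N => complex.Im (expm_partial A N a b)))%C.

(* matrix logarithm of a (positive definite) matrix: the hermitian X
   with exp X = rho (unique when rho > 0) *)
Definition mxlog n (rho : 'M[C]_n) : 'M[C]_n :=
  xget 0 [set X : 'M[C]_n | hermitian X /\ expm X = rho].

(* Gibbs state of H at inverse temperature beta *)
Definition gibbs n (H : 'M[C]_n) (beta : R) : 'M[C]_n :=
  (\tr (expm ((- beta)%:C *: H)))^-1 *: expm ((- beta)%:C *: H).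

(* partial trace over the second tensor factor, consistent with tensmx *)
Definition ptr2 m n (X : 'M[C]_(m * n)) : 'M[C]_m :=
  \matrix_(a, b) \sum_(e < n) X (mxtens_index (a, e)) (mxtens_index (b, e)).

(* products of length k of elements of a finite family *)
Fixpoint kprods n (Ks : seq 'M[C]_n) (k : nat) : seq 'M[C]_n :=
  if k is k'.+1 then [seq K *m P | K <- Ks, P <- kprods Ks k'] else [:: 1%:M].

(* primitivity of a completely positive map given in Kraus form *)
Definition primitive n (Phi : 'M[C]_n -> 'M[C]_n) : Prop :=
  exists Ks : seq 'M[C]_n,
    (forall X, Phi X = \sum_(K <- Ks) K *m X *m adjmx K) /\
    exists k : nat, (1%:M <= \sum_(P <- kprods Ks k) <<mxvec P>>)%MS.

(* the unique invariant state of a map *)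
Definition inv_state n (L : 'M[C]_n -> 'M[C]_n) : 'M[C]_n :=
  xget 0 [set rho : 'M[C]_n | state rho /\ L rho = rho /\
            forall sigma, state sigma -> L sigma = sigma -> sigma = rho].

(* inner product on column vectors *)
Definition inner n (x y : 'cV[C]_n) : C := (adjmx x *m y) 0 0.

(* antiunitary operators on C^n *)
Definition antiunitary n (th : 'cV[C]_n -> 'cV[C]_n) : Prop :=
  (forall (a : C) x y, th (a *: x + y) = (a^*)%C *: th x + th y) /\
  (forall x y, inner (th x) (th y) = ((inner x y)^*)%C).

Definition involution n (th : 'cV[C]_n -> 'cV[C]_n) : Prop :=
  forall x, th (th x) = x.

(* th A = A th, as operators *)
Definition commutes n (th : 'cV[C]_n -> 'cV[C]_n) (A : 'M[C]_n) : Prop :=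
  forall x, th (A *m x) = A *m th x.

Definition basis_vec n (a : 'I_n) : 'cV[C]_n := delta_mx a 0.

(* tensor product of two antiunitaries: the antilinear map with
   (th1 (x) th2)(e_a (x) e_e) = th1 e_a (x) th2 e_e *)
Definition tens_anti m n (th1 : 'cV[C]_m -> 'cV[C]_m)
    (th2 : 'cV[C]_n -> 'cV[C]_n) (v : 'cV[C]_(m * n)) : 'cV[C]_(m * n) :=
  \sum_(a < m) \sum_(e < n)
     ((v (mxtens_index (a, e)) 0)^*)%C *:
        (\col_i ((th1 (basis_vec a) *t th2 (basis_vec e)) i 0)).

(* convergence of a complex series to s *)
Definition cseries_to (u : nat -> C) (s : C) : Prop :=
  ((fun N => complex.Re (\sum_(k < N) u k)) @ \oo --> complex.Re s) /\
  ((fun N => complex.Im (\sum_(k < N) u k)) @ \oo --> complex.Im s).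

End LinAlg.

(* Calculus on R^M                                                      *)

Section Calculus.
Variables (R : realType) (M : nat).

Definition ecoord (k : 'I_M) : 'rV[R]_M := delta_mx 0 k.

(* iterated partial derivatives d_{k1} d_{k2} ... f *)
Definition iter_partial (ks : seq 'I_M) (f : 'rV[R]_M -> R) : 'rV[R]_M -> R :=
  foldr (fun k g => fun x => derive g x (ecoord k)) f ks.

(* C^infinity on R^M: partial derivatives of all orders exist and are
   continuous everywhere *)
Definition smoothR (f : 'rV[R]_M -> R) : Prop :=
  forall (ks : seq 'I_M) (x : 'rV[R]_M),
    (forall k, derivable (iter_partial ks f) x (ecoord k)) /\
    (iter_partial ks f @ x --> iter_partial ks f x).

Definition smoothM m n (F : 'rV[R]_M -> 'M[R[i]]_(m, n)) : Prop :=
  forall a b, smoothR (fun z => complex.Re (F z a b)) /\ smoothR (fun z => complex.Im (F z a b)).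

(* partial derivative d/dzeta_k at zeta = 0 of a complex-valued function *)
Definition pderiv0 (f : 'rV[R]_M -> R[i]) (k : 'I_M) : R[i] :=
  (derive (fun z => complex.Re (f z)) 0 (ecoord k) +i*
   derive (fun z => complex.Im (f z)) 0 (ecoord k))%C.

End Calculus.

(* Repeated interaction systems                                         *)

Record RIS (R : realType) (M : nat) := MkRIS {
  dS : nat;                                (* dim H_S *)
  dE : 'I_M -> nat;                        (* dim H_{E_j} *)
  HS : 'M[R[i]]_dS;                        (* H_S *)
  HE : forall j, 'M[R[i]]_(dE j);          (* H_{E_j} *)
  Vint : forall j, 'M[R[i]]_(dS * dE j);   (* V_j *)
  tau : 'I_M -> R;                         (* tau_j *)
  beta_ref : R                             (* beta_ref *)
}.

Unset Implicit Arguments.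
Section RIS.
Context {R : realType} {M : nat} (S : RIS R M).
Local Notation C := (R[i]).
Local Notation dS := (dS S).
Local Notation dE := (dE S).
Local Notation "\1" := (1%:M) (at level 0).

(* standing assumptions of the setting *)
Definition RIS_wf : Prop :=
  (0 < dS)%N /\ (forall j, 0 < dE j)%N /\
  hermitian (HS S) /\ (forall j, hermitian (HE S j)) /\
  (forall j, hermitian (Vint S j)) /\
  (forall j, 0 < tau S j) /\ 0 < beta_ref S.

Definition Ttot : R := \sum_(j < M) tau S j.

(* H_j = H_S (x) Id + Id (x) H_{E_j} + V_j *)
Definition Hj (j : 'I_M) : 'M[C]_(dS * dE j) :=
  HS S *t (\1 : 'M[C]_(dE j)) + (\1 : 'M[C]_dS) *t HE S j + Vint S j.

(* U_j = exp(- i tau_j H_j) *)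
Definition Uj (j : 'I_M) : 'M[C]_(dS * dE j) :=
  expm ((0 +i* (- tau S j))%C *: Hj j).

Definition betaj (z : 'rV[R]_M) (j : 'I_M) : R := beta_ref S - z 0 j.

Definition rhoE (z : 'rV[R]_M) (j : 'I_M) : 'M[C]_(dE j) :=
  gibbs (HE S j) (betaj z j).

(* L_j and its dual L_j^* *)
Definition Lj (z : 'rV[R]_M) (j : 'I_M) (rho : 'M[C]_dS) : 'M[C]_dS :=
  ptr2 (Uj j *m (rho *t rhoE z j) *m adjmx (Uj j)).

Definition Ljd (z : 'rV[R]_M) (j : 'I_M) (X : 'M[C]_dS) : 'M[C]_dS :=
  ptr2 (((\1 : 'M[C]_dS) *t rhoE z j) *m adjmx (Uj j) *m
        (X *t (\1 : 'M[C]_(dE j))) *m Uj j).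

(* L_cy = L_M o ... o L_1 ; L_rcy = L_1 o ... o L_M ; L_ra *)
Definition Lcy (z : 'rV[R]_M) (rho : 'M[C]_dS) : 'M[C]_dS :=
  foldl (fun r (j : 'I_M) => Lj z j r) rho (enum 'I_M).
Definition Lrcy (z : 'rV[R]_M) (rho : 'M[C]_dS) : 'M[C]_dS :=
  foldr (fun (j : 'I_M) r => Lj z j r) rho (enum 'I_M).
Definition Lra (z : 'rV[R]_M) (rho : 'M[C]_dS) : 'M[C]_dS :=
  (M%:R : C)^-1 *: \sum_(j < M) Lj z j rho.

(* Ldcomp z [:: k1; ...; kn] X = L_{k1}^* o ... o L_{kn}^* (X) *)
Definition Ldcomp (z : 'rV[R]_M) (s : seq 'I_M) (X : 'M[C]_dS) : 'M[C]_dS :=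
  foldr (fun (k : 'I_M) Y => Ljd z k Y) X s.

(* L_cy^* = L_1^* o ... o L_M^* ; L_ra^* *)
Definition Lcyd (z : 'rV[R]_M) (X : 'M[C]_dS) : 'M[C]_dS :=
  Ldcomp z (enum 'I_M) X.
Definition Lrad (z : 'rV[R]_M) (X : 'M[C]_dS) : 'M[C]_dS :=
  (M%:R : C)^-1 *: \sum_(j < M) Ljd z j X.

(* fluxes *)
Definition Phi (z : 'rV[R]_M) (j : 'I_M) : 'M[C]_dS :=
  - ((Ttot^-1)%:C *: ptr2 (((\1 : 'M[C]_dS) *t rhoE z j) *m
       (adjmx (Uj j) *m ((\1 : 'M[C]_dS) *t HE S j) *m Uj j
        - (\1 : 'M[C]_dS) *t HE S j))).

Definition Phirev (z : 'rV[R]_M) (j : 'I_M) : 'M[C]_dS :=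
  (Ttot^-1)%:C *: ptr2 (((\1 : 'M[C]_dS) *t rhoE z j) *m
       (Uj j *m ((\1 : 'M[C]_dS) *t HE S j) *m adjmx (Uj j)
        - (\1 : 'M[C]_dS) *t HE S j)).

(* Phi^cy_j = L_1^* o ... o L_{j-1}^* (Phi_j) *)
Definition Phicy (z : 'rV[R]_M) (j : 'I_M) : 'M[C]_dS :=
  Ldcomp z [seq i : 'I_M <- enum 'I_M | (nat_of_ord i < nat_of_ord j)%N] (Phi z j).

(* Phi^rcy_j = L_M^* o ... o L_{j+1}^* (Phi_j) *)
Definition Phircy (z : 'rV[R]_M) (j : 'I_M) : 'M[C]_dS :=
  Ldcomp z (rev [seq i : 'I_M <- enum 'I_M | (nat_of_ord j < nat_of_ord i)%N]) (Phi z j).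

(* invariant states *)
Definition rho_cy (z : 'rV[R]_M) : 'M[C]_dS := inv_state (Lcy z).
Definition rho_ra (z : 'rV[R]_M) : 'M[C]_dS := inv_state (Lra z).
Definition rho_rcy (z : 'rV[R]_M) : 'M[C]_dS := inv_state (Lrcy z).

(* kinetic coefficients *)
Definition Lkin_cy (j k : 'I_M) : C :=
  pderiv0 (fun z => \tr (rho_cy z *m Phicy z j)) k.
Definition Lkin_ra (j k : 'I_M) : C :=
  pderiv0 (fun z => \tr (rho_ra z *m Phi z j)) k.
Definition Lkin_rcy (j k : 'I_M) : C :=
  pderiv0 (fun z => \tr (rho_rcy z *m Phircy z j)) k.

(* dissipation function D_j(X, Y) *)
Definition Dj (z : 'rV[R]_M) (j : 'I_M) (X Y : 'M[C]_dS) : 'M[C]_dS :=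
  (Ttot^-1)%:C *: (Ljd z j (adjmx X *m Y) - Ljd z j (adjmx X) *m Y
                   - adjmx X *m Ljd z j Y + adjmx X *m Y).

(* hypotheses *)
Definition ER_cy : Prop := exists z, primitive (Lcy z).
Definition ER_ra : Prop := exists z, primitive (Lra z).

Definition NE (rhoNE : R -> 'M[C]_dS) : Prop :=
  forall zeta : R, state (rhoNE zeta) /\
    forall j : 'I_M,
      Uj j *m (rhoNE zeta *t rhoE (const_mx zeta) j) *m adjmx (Uj j)
        = rhoNE zeta *t rhoE (const_mx zeta) j.

Definition TRI : Prop :=
  exists (th : 'cV[C]_dS -> 'cV[C]_dS)
         (thE : forall j, 'cV[C]_(dE j) -> 'cV[C]_(dE j)),
    [/\ antiunitary th, involution th, commutes th (HS S) &
        forall j, [/\ antiunitary (thE j), involution (thE j),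
                      commutes (thE j) (HE S j) &
                      commutes (tens_anti th (thE j)) (Vint S j)]].

(* effective Hamiltonian H'_S = - beta_ref^{-1} log rho_{+,0} *)
Definition Heff (rhoNE : R -> 'M[C]_dS) : 'M[C]_dS :=
  (- (beta_ref S)^-1)%:C *: mxlog (rhoNE 0).

End RIS.

(* Main.v *)
(** By (NE) at [zeta = 0] the state [rho0 (x) rhoE_j] commutes with [U_j]. Hence
    [rho0] is fixed by every [L_j], its logarithm is conserved, and the reduced
    dynamics satisfies a detailed balance relation with the dynamics run backwards.

    Primitivity gives a Doeblin bound [tr (B (L^k A)) >= c tr A tr B], whose validity does not
    depend on [zeta] because all Gibbs states are comparable with the identity, and is
    inherited by the reversed cycle under time reversal. It makes [L^n X] tend to [0]
    for traceless [X], so [X |-> X - L X + (tr X) 1] is invertible and the invariant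
    state, the preimage of [1], depends smoothly on [zeta] by Cramer's rule.

    Differentiating [rho = L rho] gives [d rho = L (d rho) + Y] with [Y] an image of
    [T Phirev_k rho0]; the Green-Kubo series of the [L^n Y] then telescopes to [d rho].
    The diagonal term is the derivative of the flux itself: since the total energy
    [H'_S (x) 1 + 1 (x) H_E] is conserved, it is a variance of [U^* H'_S U - H'_S].

    For Onsager reciprocity, detailed balance followed by the time reversal
    anti-automorphism [Theta], which exchanges [Phi] and [- Phirev], reverses the
    order of the dual maps in each summand. *)
Require Import Defs.
From HB Require Import structures.
From mathcomp Require Import all_boot all_order all_algebra.
From mathcomp Require Import all_classical all_reals all_analysis.
From mathcomp Require Import complex mxtens.
From mathcomp Require Import ring.
Import Order.TTheory GRing.Theory Num.Theory.
Import numFieldNormedType.Exports.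
Local Open Scope ring_scope.
Local Open Scope complex_scope.
Set Implicit Arguments.
Unset Strict Implicit.
Unset Printing Implicit Defensive.

(** * Adjoints and positive matrices *)

Section Adjoint.
Variable R : realType.
Local Notation C := (R[i]).

(** (ER) grants primitivity at one unknown [zeta], while part 1 concerns every [zeta] and part 2 the
    point 0. What travels between them is the quantitative bound [minorized]: each [Lj S z j] lies
    between multiples of the [zeta]-free map [Nj], and the shape of [Nj] makes the bound compatible
    with time reversal.

    The same bound, applied to the fixed point [rho0], shows that [rho0] is faithful, which gives
    its logarithm a meaning. It also makes a fixed point unique once its trace is given, whence
    [Theta W rho0 = rho0] under (TRI).

    The formulas are written with words of dual maps acting on observables. The trace pairing moves
    these words onto states, where equilibrium can be used: at [zeta = 0] all maps applied before
    the differentiated one fix [rho0], so a word containing [k] once produces a single new term. The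
    delta term of the cyclic formula has this origin, since the observable of the [j]-th flux
    contains the dual of the [k]-th map when k < j. *)

Lemma adjmxE m n (A : 'M[C]_(m, n)) i j : adjmx A i j = conjc (A j i).
Proof. by rewrite !mxE. Qed.

Lemma adjmxK m n (A : 'M[C]_(m, n)) : adjmx (adjmx A) = A.
Proof. by apply/matrixP => i j; rewrite !adjmxE conjcK. Qed.

Lemma adjmxM m n p (A : 'M[C]_(m, n)) (B : 'M[C]_(n, p)) :
  adjmx (A *m B) = adjmx B *m adjmx A.
Proof. by rewrite /adjmx map_mxM trmx_mul. Qed.

Lemma adjmxD m n (A B : 'M[C]_(m, n)) : adjmx (A + B) = adjmx A + adjmx B.
Proof. by apply/matrixP => i j; rewrite !mxE rmorphD. Qed.

Lemma adjmxN m n (A : 'M[C]_(m, n)) : adjmx (- A) = - adjmx A.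
Proof. by apply/matrixP => i j; rewrite !mxE rmorphN. Qed.

Lemma adjmxB m n (A B : 'M[C]_(m, n)) : adjmx (A - B) = adjmx A - adjmx B.
Proof. by rewrite adjmxD adjmxN. Qed.

Lemma adjmxZ m n a (A : 'M[C]_(m, n)) : adjmx (a *: A) = conjc a *: adjmx A.
Proof. by apply/matrixP => i j; rewrite !mxE rmorphM. Qed.

Lemma adjmx0 m n : adjmx (0 : 'M[C]_(m, n)) = 0.
Proof. by apply/matrixP => i j; rewrite !mxE conjc0. Qed.

Lemma adjmx_scalar n (a : C) : adjmx (a%:M : 'M[C]_n) = (conjc a)%:M.
Proof.
by apply/matrixP => i j; rewrite !mxE eq_sym; case: eqP => _ //; rewrite conjc0.
Qed.

Lemma adjmx1 n : adjmx (1%:M : 'M[C]_n) = 1%:M.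
Proof. by rewrite adjmx_scalar conjc1. Qed.

Lemma adjmx_tens m n p q (A : 'M[C]_(m, n)) (B : 'M[C]_(p, q)) :
  adjmx (A *t B) = adjmx A *t adjmx B.
Proof. by rewrite /adjmx map_mxT trmx_tens. Qed.

Lemma adjmx_diag n (d : 'rV[C]_n) : adjmx (diag_mx d) = diag_mx (map_mx conjc d).
Proof.
apply/matrixP => i j; rewrite !mxE eq_sym.
by case: eqP => [->|]; rewrite ?mulr1n ?mulr0n ?conjc0.
Qed.

Lemma mxtrace_adj n (A : 'M[C]_n) : \tr (adjmx A) = conjc (\tr A).
Proof. by rewrite mxtrace_tr /mxtrace rmorph_sum; apply: eq_bigr => i _; rewrite mxE. Qed.

(** The eigenvalues are delivered as a real row, so that functions of a real variable can later be
    applied to them. *)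
Lemma unitary_spectral n (A : 'M[C]_n) : Defs.hermitian A ->
  exists (P : 'M[C]_n) (d : 'rV[R]_n),
    [/\ adjmx P *m P = 1%:M, P *m adjmx P = 1%:M &
        A = P *m diag_mx (map_mx (real_complex R) d) *m adjmx P].
Proof.
have adjE m p (B : 'M[C]_(m, p)) : adjmx B = map_mx (@Num.conj C) (B^T).
  by apply/matrixP => i j; rewrite !mxE.
move=> hA; have hA' : A \is hermitianmx n false (@Num.conj C).
  by apply/is_hermitianmxP; rewrite expr0 scale1r -adjE.
have := orthomx_spectralP (hermitian_normalmx hA').
set P := spectralmx A; set d := spectral_diag A => Ad.
have /unitarymxP PU : P \is unitarymx by exact: spectral_unitarymx.
rewrite -adjE in PU.
exists (adjmx P), (map_mx (@complex.Re R) d); split.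
- by rewrite adjmxK.
- by rewrite adjmxK; exact: mulmx1C.
- rewrite adjmxK.
  have -> : map_mx (real_complex R) (map_mx (@complex.Re R) d) = d.
    apply/matrixP => i j; rewrite 2!mxE RRe_real //.
    have /mxOverP := hermitian_spectral_diag_real hA'; exact.
  have Pu : P \in unitmx by exact: spectral_unit.
  have <- : invmx P = adjmx P.
    by rewrite -[RHS]mul1mx -(mulVmx Pu) -mulmxA PU mulmx1.
  exact: Ad.
Qed.

(** Hermiticity is carried along with [psd] so that the spectral theorem applies at once. *)
Definition pos n (A : 'M[C]_n) := Defs.hermitian A /\ psd A.

(** In the partial order of [R[i]] a nonnegative number is real, so a single inequality carries both
    halves of [psd]. *)
Lemma ge0C (z : C) : (0 <= z) <-> complex.Im z = 0 /\ 0 <= complex.Re z.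
Proof.
rewrite lecE /=; split => [/andP[/eqP -> ->] //|[-> ->]]; by rewrite eqxx.
Qed.

Lemma conjc_ge0 (z : C) : 0 <= z -> conjc z = z.
Proof. by case: z => x y /ge0C/= [-> _]; rewrite oppr0. Qed.

Lemma psdP n (A : 'M[C]_n) :
  psd A <-> forall v : 'cV[C]_n, 0 <= (adjmx v *m A *m v) 0 0.
Proof. by split => H v; apply/ge0C; exact: H. Qed.

Lemma mxtr_mulmx_adj m n (X : 'M[C]_(m, n)) :
  \tr (X *m adjmx X) = \sum_i \sum_j `|X i j| ^+ 2.
Proof.
apply: eq_bigr => i _; rewrite mxE; apply: eq_bigr => j _.
by rewrite adjmxE sqr_normc.
Qed.

Lemma mxtr_mulmx_adj_ge0 m n (X : 'M[C]_(m, n)) : 0 <= \tr (X *m adjmx X).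
Proof.
rewrite mxtr_mulmx_adj; apply: sumr_ge0 => i _; apply: sumr_ge0 => j _.
by rewrite exprn_ge0 ?normr_ge0.
Qed.

Lemma mxtr_quad n (A : 'M[C]_n) (v : 'cV[C]_n) :
  (adjmx v *m A *m v) 0 0 = \tr (A *m (v *m adjmx v)).
Proof. by rewrite -trace_mx11 -mulmxA mxtrace_mulC -mulmxA. Qed.

Lemma pos_mulmx_adj m n (X : 'M[C]_(m, n)) : pos (X *m adjmx X).
Proof.
split; first by rewrite /Defs.hermitian adjmxM adjmxK.
apply/psdP => v; rewrite mxtr_quad.
have -> : \tr (X *m adjmx X *m (v *m adjmx v)) =
    \tr ((adjmx X *m v) *m adjmx (adjmx X *m v)).
  by rewrite adjmxM adjmxK -!mulmxA mxtrace_mulC !mulmxA.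
exact: mxtr_mulmx_adj_ge0.
Qed.

Lemma diag_mulmx_adj m n (P : 'M[C]_(m, n)) (d : 'rV[C]_n) :
  (forall i, 0 <= d 0 i) ->
  P *m diag_mx d *m adjmx P =
    (P *m diag_mx (map_mx (@sqrtc R) d)) *m adjmx (P *m diag_mx (map_mx (@sqrtc R) d)).
Proof.
move=> d0; rewrite adjmxM adjmx_diag -!mulmxA; congr (_ *m _); rewrite !mulmxA.
congr (_ *m _); rewrite mulmx_diag; congr diag_mx.
apply/matrixP => i j; rewrite !mxE (ord1 i).
have sr : 0 <= sqrtc (d 0 j) by rewrite sqrtc_ge0.
by rewrite -[LHS]sqr_sqrtc expr2 (conjc_ge0 sr).
Qed.

Lemma pos_diag m n (P : 'M[C]_(m, n)) (d : 'rV[C]_n) :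
  (forall i, 0 <= d 0 i) -> pos (P *m diag_mx d *m adjmx P).
Proof. by move=> d0; rewrite diag_mulmx_adj //; exact: pos_mulmx_adj. Qed.

(** Testing on the i-th eigenvector transfers bounds on the quadratic form to the eigenvalues. *)
Lemma quad_diag n (P : 'M[C]_n) (d : 'rV[C]_n) i :
  adjmx P *m P = 1%:M ->
  (adjmx (col i P) *m (P *m diag_mx d *m adjmx P) *m col i P) 0 0 = d 0 i.
Proof.
move=> PP; have -> : col i P = P *m delta_mx i 0 by rewrite colE.
rewrite adjmxM !mulmxA -(mulmxA _ _ P) PP mulmx1.
rewrite -(mulmxA _ _ P) PP mulmx1 -mulmxA -colE.
rewrite mxE (bigD1 i) //= big1 ?addr0; last first.
  by move=> j ji; rewrite adjmxE mxE (negPf ji) conjc_nat mulr0n mul0r.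
by rewrite adjmxE !mxE !eqxx conjc_nat mul1r mulr1n.
Qed.

(** This factorization reduces traces of products, congruences and tensor products of positive
    matrices to sums of squared moduli. *)
Lemma pos_sqrt n (A : 'M[C]_n) : pos A -> exists X : 'M[C]_n, A = X *m adjmx X.
Proof.
case=> /unitary_spectral[P [d [PP PP' ->]]] /psdP pA.
set e := map_mx (real_complex R) d in pA *.
have e0 i : 0 <= e 0 i.
  by rewrite -(quad_diag e i PP); exact: pA.
by exists (P *m diag_mx (map_mx (@sqrtc R) e)); exact: diag_mulmx_adj.
Qed.

Lemma pos_trM n (A B : 'M[C]_n) : pos A -> pos B -> 0 <= \tr (A *m B).
Proof.
move=> /pos_sqrt[X ->] /pos_sqrt[Y ->].
have -> : \tr (X *m adjmx X *m (Y *m adjmx Y)) =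
    \tr ((adjmx Y *m X) *m adjmx (adjmx Y *m X)).
  by rewrite adjmxM adjmxK !mulmxA mxtrace_mulC !mulmxA.
exact: mxtr_mulmx_adj_ge0.
Qed.

(** The positive cone is self-dual: the rank-one tests [v *m adjmx v] already recover the quadratic
    form. *)
Lemma pos_test n (A : 'M[C]_n) :
  Defs.hermitian A -> (forall B, pos B -> 0 <= \tr (A *m B)) -> pos A.
Proof.
move=> hA H; split => //; apply/psdP => v; rewrite mxtr_quad.
by apply: H; exact: pos_mulmx_adj.
Qed.

Lemma posD n (A B : 'M[C]_n) : pos A -> pos B -> pos (A + B).
Proof.
move=> [hA /psdP pA] [hB /psdP pB]; split; first by rewrite /Defs.hermitian adjmxD hA hB.
by apply/psdP => v; rewrite mulmxDr mulmxDl mxE addr_ge0.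
Qed.

Lemma posZ n a (A : 'M[C]_n) : 0 <= a -> pos A -> pos (a *: A).
Proof.
move=> a0 [hA /psdP pA]; split.
  by rewrite /Defs.hermitian adjmxZ hA conjc_ge0.
by apply/psdP => v; rewrite -scalemxAr -scalemxAl mxE mulr_ge0.
Qed.

Lemma pos0 n : pos (0 : 'M[C]_n).
Proof. by split; [exact: adjmx0 | apply/psdP => v; rewrite mulmx0 mul0mx mxE]. Qed.

Lemma pos_sum n I (r : seq I) (F : I -> 'M[C]_n) :
  (forall i, pos (F i)) -> pos (\sum_(i <- r) F i).
Proof. by move=> H; elim/big_rec: _ => [|i A _ ?]; [exact: pos0 | exact: posD]. Qed.

Lemma pos1 n : pos (1%:M : 'M[C]_n).
Proof. by rewrite -(mulmx1 1%:M) -{2}(adjmx1 n); exact: pos_mulmx_adj. Qed.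

Lemma pos_congr m n (P : 'M[C]_(m, n)) (A : 'M[C]_n) :
  pos A -> pos (P *m A *m adjmx P).
Proof.
move=> /pos_sqrt[X ->].
by rewrite mulmxA -mulmxA -adjmxM; exact: pos_mulmx_adj.
Qed.

Lemma pos_tens m n (A : 'M[C]_m) (B : 'M[C]_n) : pos A -> pos B -> pos (A *t B).
Proof.
move=> /pos_sqrt[X ->] /pos_sqrt[Y ->].
by rewrite -tensmx_mul -adjmx_tens; exact: pos_mulmx_adj.
Qed.

Lemma pos_tr_ge0 n (A : 'M[C]_n) : pos A -> 0 <= \tr A.
Proof. by move=> pA; rewrite -[A]mulmx1; apply: pos_trM => //; exact: pos1. Qed.

(** For A = X X^* the entry is an inner product of rows of X, bounded through 2xy <= x^2 + y^2. It
    converts decay of traces into entrywise convergence. *)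
Lemma pos_entry n (A : 'M[C]_n) a b : pos A -> `|A a b| <= \tr A.
Proof.
move=> pA; have [X AX] := pos_sqrt pA.
have diagE i : A i i = \sum_j `|X i j| ^+ 2.
  by rewrite AX mxE; apply: eq_bigr => j _; rewrite adjmxE sqr_normc.
have diag0 i : 0 <= A i i by rewrite diagE sumr_ge0 // => j _; rewrite exprn_ge0 ?normr_ge0.
have trD i : A i i <= \tr A.
  by rewrite /mxtrace (bigD1 i) //= lerDl sumr_ge0.
have H : `|A a b| *+ 2 <= A a a + A b b.
  rewrite !diagE -big_split /= AX mxE -mulr_natr.
  apply: le_trans (_ : (\sum_j `|X a j| * `|X b j|) *+ 2 <= _).
    rewrite mulr_natr lerMn2r /=; apply: le_trans (ler_norm_sum _ _ _) _.
    by apply: ler_sum => j _; rewrite adjmxE normrM normcJ.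
  rewrite -sumrMnl; apply: ler_sum => j _.
  rewrite -subr_ge0 (_ : _ - _ = (`|X a j| - `|X b j|) ^+ 2); last by ring.
  rewrite real_exprn_even_ge0 //; apply: rpredB; exact: normr_real.
have : `|A a b| *+ 2 <= \tr A *+ 2.
  by apply: le_trans H _; rewrite mulr2n lerD.
by rewrite lerMn2r.
Qed.

(** The sum of the moduli of the eigenvalues dominates each of them. Estimates known for positive
    matrices reach hermitian ones by subtracting the shift. *)
Lemma hermitian_shift n (X : 'M[C]_n) : Defs.hermitian X ->
  exists s : R, 0 <= s /\ pos (X + (s%:C)%:M).
Proof.
move=> /unitary_spectral[P [d [PP PP' ->]]].
exists (\sum_i `|d 0 i|); split; first exact: sumr_ge0.
set s := \sum_i _.
have -> : P *m diag_mx (map_mx (real_complex R) d) *m adjmx P + s%:C%:M =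
   P *m diag_mx (map_mx (real_complex R) d + const_mx s%:C) *m adjmx P.
  rewrite linearD /= mulmxDr mulmxDl; congr (_ + _).
  by rewrite diag_const_mx mul_mx_scalar -scalemxAl PP' scalemx1.
apply: pos_diag => i; rewrite !mxE -rmorphD /= ler0c.
rewrite -lerBlDl sub0r; apply: le_trans (_ : `|d 0 i| <= _).
  by rewrite -normrN ler_norm.
by rewrite /s (bigD1 i) //= lerDl sumr_ge0.
Qed.

(** Nondegeneracy of the trace pairing, seen on matrix units. *)
Lemma mx_test m n (A B : 'M[C]_(m, n)) :
  (forall X : 'M[C]_(n, m), \tr (X *m A) = \tr (X *m B)) -> A = B.
Proof.
move=> H; apply/matrixP => i j; have := H (delta_mx j i).
have E (Z : 'M[C]_(m, n)) : \tr (delta_mx j i *m Z) = Z i j.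
  rewrite /mxtrace (bigD1 j) //= big1 ?addr0 => [|k kj].
    rewrite mxE (bigD1 i) //= big1 ?addr0 => [|l li].
      by rewrite !mxE !eqxx mul1r.
    by rewrite !mxE (negPf li) andbF mul0r.
  by rewrite mxE big1 // => l _; rewrite !mxE (negPf kj) mul0r.
by rewrite !E.
Qed.

End Adjoint.

(** * Partial traces *)

Section PartialTrace.
Variable R : realType.
Local Notation C := (R[i]).

Lemma sum_mxtens (V : nmodType) m n (F : 'I_(m * n) -> V) :
  \sum_k F k = \sum_a \sum_e F (mxtens_index (a, e)).
Proof.
rewrite pair_big /=; rewrite (reindex (@mxtens_index m n)) /=; last first.
  by exists (@mxtens_unindex m n) => x _; rewrite ?mxtens_indexK ?mxtens_unindexK.
by apply: eq_bigr => -[].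
Qed.

Lemma tensmx_ext m n p q (A B : 'M[C]_(m * n, p * q)) :
  (forall a e b f, A (mxtens_index (a, e)) (mxtens_index (b, f)) =
                   B (mxtens_index (a, e)) (mxtens_index (b, f))) -> A = B.
Proof.
move=> H; apply/matrixP => i j.
case: (mxtens_indexP i) => a e; case: (mxtens_indexP j) => b f; exact: H.
Qed.

Lemma mxtens_index_eq m n a e b f :
  (@mxtens_index m n (a, e) == mxtens_index (b, f)) = (a == b) && (e == f).
Proof. by rewrite (inj_eq (can_inj (@mxtens_indexK m n))) xpair_eqE. Qed.

Lemma tensmx11 m n : (1%:M : 'M[C]_m) *t (1%:M : 'M[C]_n) = 1%:M.
Proof.
apply: tensmx_ext => a e b f; rewrite tensmxE !mxE mxtens_index_eq.
by case: (a == b); case: (e == f); rewrite ?mulr1 ?mulr0 ?mul0r.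
Qed.

Lemma tensmxDl m n p q (A B : 'M[C]_(m, n)) (D : 'M[C]_(p, q)) :
  (A + B) *t D = A *t D + B *t D.
Proof. by apply/matrixP => i j; rewrite !mxE mulrDl. Qed.

Lemma tensmxZl m n p q c (A : 'M[C]_(m, n)) (D : 'M[C]_(p, q)) :
  (c *: A) *t D = c *: (A *t D).
Proof. by apply/matrixP => i j; rewrite !mxE mulrA. Qed.

Lemma tensmxZr m n p q c (A : 'M[C]_(m, n)) (D : 'M[C]_(p, q)) :
  A *t (c *: D) = c *: (A *t D).
Proof. by apply/matrixP => i j; rewrite !mxE mulrCA. Qed.

Lemma tensmxBr m n p q (D : 'M[C]_(m, n)) (A B : 'M[C]_(p, q)) :
  D *t (A - B) = D *t A - D *t B.
Proof. by apply/matrixP => i j; rewrite !mxE mulrBr. Qed.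

Lemma tensmx_comm m n (A : 'M[C]_m) (B : 'M[C]_n) :
  (A *t 1%:M) *m (1%:M *t B) = (1%:M *t B) *m (A *t 1%:M).
Proof. by rewrite !tensmx_mul !mul1mx !mulmx1. Qed.

Lemma tensmx_diag m n (d : 'rV[C]_m) (e : 'rV[C]_n) :
  diag_mx d *t diag_mx e =
  diag_mx (\row_k (d 0 (mxtens_unindex k).1 * e 0 (mxtens_unindex k).2)).
Proof.
apply: tensmx_ext => a x b y; rewrite tensmxE !mxE mxtens_index_eq mxtens_indexK /=.
by case: eqP => [->|]; case: eqP => [->|] //=;
  rewrite ?mulr1n ?mulr0n ?mulr0 ?mul0r.
Qed.

Lemma mxtrace_tens m n (A : 'M[C]_m) (B : 'M[C]_n) : \tr (A *t B) = \tr A * \tr B.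
Proof.
rewrite /mxtrace sum_mxtens mulr_suml; apply: eq_bigr => a _.
by rewrite mulr_sumr; apply: eq_bigr => e _; rewrite tensmxE.
Qed.

(** The partial trace is adjoint to A |-> A (x) 1 for the trace pairing. With [mx_test], this yields
    the module, cyclicity and product rules below. *)
Lemma mxtr_ptr2 m n (A : 'M[C]_m) (X : 'M[C]_(m * n)) :
  \tr (A *m ptr2 X) = \tr ((A *t 1%:M) *m X).
Proof.
rewrite /mxtrace sum_mxtens; apply: eq_bigr => a _.
rewrite mxE; under eq_bigr => b _ do rewrite mxE mulr_sumr.
rewrite exchange_big /=; apply: eq_bigr => e _.
rewrite mxE sum_mxtens; apply: eq_bigr => b _.
rewrite (bigD1 e) //= big1 ?addr0 => [|f fe].
  by rewrite tensmxE mxE eqxx mulr1.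
by rewrite tensmxE [1%:M _ _]mxE eq_sym (negPf fe) mulr0 mul0r.
Qed.

Lemma mxtrace_ptr2 m n (X : 'M[C]_(m * n)) : \tr (ptr2 X) = \tr X.
Proof. by rewrite -[ptr2 X]mul1mx mxtr_ptr2 tensmx11 mul1mx. Qed.

Lemma ptr2D m n (X Y : 'M[C]_(m * n)) : ptr2 (X + Y) = ptr2 X + ptr2 Y.
Proof.
apply/matrixP => i j; rewrite !mxE -big_split; apply: eq_bigr => e _.
by rewrite mxE.
Qed.

Lemma ptr2Z m n c (X : 'M[C]_(m * n)) : ptr2 (c *: X) = c *: ptr2 X.
Proof.
apply/matrixP => i j; rewrite !mxE mulr_sumr; apply: eq_bigr => e _.
by rewrite mxE.
Qed.

Lemma ptr2N m n (X : 'M[C]_(m * n)) : ptr2 (- X) = - ptr2 X.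
Proof. by rewrite -scaleN1r ptr2Z scaleN1r. Qed.

Lemma ptr2B m n (X Y : 'M[C]_(m * n)) : ptr2 (X - Y) = ptr2 X - ptr2 Y.
Proof. by rewrite ptr2D ptr2N. Qed.

Lemma ptr2_trmx m n (X : 'M[C]_(m * n)) : ptr2 X^T = (ptr2 X)^T.
Proof. by apply/matrixP => i j; rewrite !mxE; apply: eq_bigr => e _; rewrite mxE. Qed.

Lemma ptr2_adj m n (X : 'M[C]_(m * n)) : ptr2 (adjmx X) = adjmx (ptr2 X).
Proof.
apply/matrixP => i j; rewrite adjmxE !mxE rmorph_sum.
by apply: eq_bigr => e _; rewrite adjmxE.
Qed.

Lemma ptr2_mull m n (A : 'M[C]_m) (X : 'M[C]_(m * n)) :
  ptr2 ((A *t 1%:M) *m X) = A *m ptr2 X.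
Proof.
by apply: mx_test => Y; rewrite mulmxA !mxtr_ptr2 mulmxA tensmx_mul mulmx1.
Qed.

Lemma ptr2_mulr m n (A : 'M[C]_m) (X : 'M[C]_(m * n)) :
  ptr2 (X *m (A *t 1%:M)) = ptr2 X *m A.
Proof.
apply: mx_test => Y; rewrite [in RHS]mulmxA [RHS]mxtrace_mulC [in RHS]mulmxA.
rewrite !mxtr_ptr2 [in LHS]mulmxA [LHS]mxtrace_mulC mulmxA tensmx_mul.
by rewrite mulmx1.
Qed.

(** Operators on the traced factor commute with every Y (x) 1, which is why cyclicity survives for
    them under a partial trace. *)
Lemma ptr2_cycle m n (B : 'M[C]_n) (X : 'M[C]_(m * n)) :
  ptr2 ((1%:M *t B) *m X) = ptr2 (X *m (1%:M *t B)).
Proof.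
apply: mx_test => Y; rewrite !mxtr_ptr2 mulmxA tensmx_comm -mulmxA.
by rewrite mxtrace_mulC mulmxA.
Qed.

Lemma ptr2_tens m n (A : 'M[C]_m) (B : 'M[C]_n) : ptr2 (A *t B) = \tr B *: A.
Proof.
apply: mx_test => Y.
by rewrite mxtr_ptr2 tensmx_mul mul1mx mxtrace_tens -scalemxAr mxtraceZ mulrC.
Qed.

Lemma ptr2_congr m n (W : 'M[C]_m) (V : 'M[C]_n) (X : 'M[C]_(m * n)) :
  adjmx V *m V = 1%:M ->
  ptr2 ((W *t V) *m X *m adjmx (W *t V)) = W *m ptr2 X *m adjmx W.
Proof.
move=> VV; rewrite adjmx_tens tensmx_decr (tensmx_decl (adjmx W)) !mulmxA ptr2_mulr.
rewrite -!mulmxA ptr2_mull !mulmxA; congr (_ *m _ *m _).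
by rewrite -mulmxA ptr2_cycle -mulmxA tensmx_mul VV mulmx1 tensmx11 mulmx1.
Qed.

Lemma pos_ptr2 m n (X : 'M[C]_(m * n)) : pos X -> pos (ptr2 X).
Proof.
move=> pX; apply: pos_test; first by rewrite /Defs.hermitian -ptr2_adj (proj1 pX).
move=> B pB; rewrite mxtrace_mulC mxtr_ptr2; apply: pos_trM => //.
by apply: pos_tens => //; exact: pos1.
Qed.

End PartialTrace.

(** * Matrix exponentials and functional calculus *)

Section Exponential.
Variable R : realType.
Local Notation C := (R[i]).
Local Open Scope classical_set_scope.

(** Real and imaginary parts are kept separate to agree with [expm] and [cseries_to] by
    conversion. *)
Definition ccvg (u : nat -> C) (l : C) : Prop :=
  ((fun N => complex.Re (u N)) @ \oo --> complex.Re l) /\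
  ((fun N => complex.Im (u N)) @ \oo --> complex.Im l).

Lemma complex_ReM (x y : C) :
  complex.Re (x * y) = complex.Re x * complex.Re y - complex.Im x * complex.Im y.
Proof. by case: x y => ? ? []. Qed.

Lemma complex_ImM (x y : C) :
  complex.Im (x * y) = complex.Re x * complex.Im y + complex.Im x * complex.Re y.
Proof. by case: x y => ? ? []. Qed.

Lemma complex_ReD (x y : C) : complex.Re (x + y) = complex.Re x + complex.Re y.
Proof. by case: x y => ? ? []. Qed.

Lemma complex_ImD (x y : C) : complex.Im (x + y) = complex.Im x + complex.Im y.
Proof. by case: x y => ? ? []. Qed.

Lemma ccvgD u v l k : ccvg u l -> ccvg v k -> ccvg (fun N => u N + v N) (l + k).
Proof.
move=> [u1 u2] [v1 v2]; split.
  by under eq_fun do rewrite complex_ReD; rewrite complex_ReD; exact: cvgD.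
by under eq_fun do rewrite complex_ImD; rewrite complex_ImD; exact: cvgD.
Qed.

Lemma ccvgMl c u l : ccvg u l -> ccvg (fun N => c * u N) (c * l).
Proof.
move=> [u1 u2]; split.
  under eq_fun do rewrite complex_ReM; rewrite complex_ReM.
  by apply: cvgB; apply: cvgM => //; exact: cvg_cst.
under eq_fun do rewrite complex_ImM; rewrite complex_ImM.
by apply: cvgD; apply: cvgM => //; exact: cvg_cst.
Qed.

Lemma ccvg_cst c : ccvg (fun=> c) c.
Proof. by split; exact: cvg_cst. Qed.

Lemma ccvg_sum I (r : seq I) (u : I -> nat -> C) l :
  (forall i, ccvg (u i) (l i)) ->
  ccvg (fun N => \sum_(i <- r) u i N) (\sum_(i <- r) l i).
Proof.
move=> H; elim: r => [|i r IH].
  by rewrite big_nil; under eq_fun do rewrite big_nil; exact: ccvg_cst.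
by rewrite big_cons; under eq_fun do rewrite big_cons; exact: ccvgD.
Qed.

Lemma ccvg_lim u l : ccvg u l ->
  (limn (fun N => complex.Re (u N)) +i* limn (fun N => complex.Im (u N)))%C = l.
Proof. by move=> [u1 u2]; rewrite (cvg_lim _ u1)// (cvg_lim _ u2)//; case: l {u1 u2}. Qed.

(** A relation between exponent and sum of the exponential series, so that one lemma covers both the
    real exponential and cos + i sin. *)
Definition has_cexp (c l : C) :=
  ccvg (fun N => \sum_(k < N) ((k`!)%:R^-1 : C) * c ^+ k) l.

Lemma mxpow_diag n (P Q : 'M[C]_n) (d : 'rV[C]_n) k : Q *m P = 1%:M -> P *m Q = 1%:M ->
  mxpow (P *m diag_mx d *m Q) k = P *m diag_mx (\row_i (d 0 i ^+ k)) *m Q.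
Proof.
move=> QP PQ; elim: k => [|k IH].
  have -> : (\row_i (d 0 i ^+ 0)) = const_mx 1 :> 'rV[C]_n.
    by apply/matrixP => i j; rewrite !mxE.
  by rewrite diag_const_mx mulmx1.
rewrite /mxpow iterS -/(mxpow _ k) IH !mulmxA; congr (_ *m _).
rewrite -!mulmxA (mulmxA Q) QP mul1mx mulmx_diag; congr (_ *m diag_mx _).
by apply/matrixP => i j; rewrite !mxE exprS.
Qed.

(** Powers act on the diagonal alone, so each entry is a finite linear combination of scalar
    exponential series. *)
Lemma expm_diag n (P Q : 'M[C]_n) (d e : 'rV[C]_n) : Q *m P = 1%:M -> P *m Q = 1%:M ->
  (forall i, has_cexp (d 0 i) (e 0 i)) ->
  expm (P *m diag_mx d *m Q) = P *m diag_mx e *m Q.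
Proof.
move=> QP PQ H; apply/matrixP => a b; rewrite mxE; apply: ccvg_lim.
have -> : (P *m diag_mx e *m Q) a b = \sum_i (P a i * Q i b) * e 0 i.
  rewrite mxE; apply: eq_bigr => i _.
  by rewrite mul_mx_diag mxE mulrAC.
under eq_fun => N.
  have -> : expm_partial (P *m diag_mx d *m Q) N a b =
      \sum_i (P a i * Q i b) * \sum_(k < N) ((k`!)%:R^-1 : C) * d 0 i ^+ k.
    rewrite summxE.
    under eq_bigr => k _.
      rewrite mxE mxpow_diag // mul_mx_diag mxE mulr_sumr.
      over.
    rewrite exchange_big; apply: eq_bigr => i _.
    rewrite mulr_sumr; apply: eq_bigr => k _.
    by rewrite !mxE; ring.
  over.
by apply: ccvg_sum => i; apply: ccvgMl; exact: H.
Qed.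

Lemma has_cexp_real (x : R) : has_cexp x%:C (expR x)%:C.
Proof.
have E N : \sum_(k < N) ((k`!)%:R^-1 : C) * x%:C ^+ k = (series (exp_coeff x) N)%:C.
  rewrite /series /= big_mkord rmorph_sum; apply: eq_bigr => k _.
  rewrite /exp_coeff /= rmorphM rmorphXn /= fmorphV rmorph_nat.
  by rewrite mulrC.
rewrite /has_cexp; under eq_fun do rewrite E; split => /=.
  exact: is_cvg_series_exp_coeff.
exact: cvg_cst.
Qed.

(** The parity factors are those of [cos_coeff] and [sin_coeff], so that the partial sums match term
    by term. *)
Lemma expr_imaginary (y : R) k :
  (0 +i* y)%C ^+ k =
  (((~~ odd k)%:R * (-1) ^+ k./2 * y ^+ k) +i* ((odd k)%:R * (-1) ^+ k.-1./2 * y ^+ k))%C.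
Proof.
elim: k => [|k IH]; first by
  apply/eqP; rewrite eq_complex /=; apply/andP; split; apply/eqP; ring.
rewrite exprS IH /= ; apply/eqP; rewrite eq_complex /=; apply/andP.
rewrite !mul0r uphalf_half; case: (boolP (odd k)) => ok /=; split; apply/eqP.
- have -> : (k.-1./2 = k./2)%N.
    by case: k ok {IH} => //= k ok; rewrite uphalf_half (negPf ok).
  by rewrite add1n !exprS; ring.
- by rewrite exprS; ring.
- by rewrite exprS; ring.
- by rewrite exprS; ring.
Qed.

Lemma has_cexp_imaginary (y : R) : has_cexp (0 +i* y)%C (cos y +i* sin y)%C.
Proof.
have E N : \sum_(k < N) ((k`!)%:R^-1 : C) * (0 +i* y)%C ^+ k =
    ((series (cos_coeff y) N) +i* (series (sin_coeff y) N))%C.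
  rewrite /series /= !big_mkord.
  elim: N => [|N IH]; first by rewrite !big_ord0.
  rewrite !big_ord_recr /= IH expr_imaginary.
  have -> : ((N`!)%:R^-1 : C) = ((N`!)%:R^-1)%:C by rewrite fmorphV rmorph_nat.
  rewrite /cos_coeff /sin_coeff /=; apply/eqP; rewrite eq_complex /=.
  apply/andP; split; apply/eqP; congr (_ + _); rewrite mul0r ?subr0 ?addr0 mulrC //.
rewrite /has_cexp; under eq_fun do rewrite E; split => /=; rewrite ?cos.unlock ?sin.unlock.
  exact: is_cvg_series_cos_coeff.
exact: is_cvg_series_sin_coeff.
Qed.

(** Functional calculus of the hermitian matrix with eigenvectors [P] and eigenvalues [d]. The basis
    is explicit so that several functions can share it. *)
Definition fcalc n (P : 'M[C]_n) (d : 'rV[R]_n) (f : R -> C) : 'M[C]_n :=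
  P *m diag_mx (map_mx f d) *m adjmx P.

Section Calculus.
Variables (n : nat) (P : 'M[C]_n) (d : 'rV[R]_n).
Hypothesis PP : adjmx P *m P = 1%:M.
Hypothesis PP' : P *m adjmx P = 1%:M.

Lemma fcalcM f g : fcalc P d f *m fcalc P d g = fcalc P d (fun x => f x * g x).
Proof.
rewrite /fcalc !mulmxA; congr (_ *m _).
rewrite -(mulmxA _ (adjmx P)) PP mulmx1 -mulmxA mulmx_diag.
by congr (_ *m diag_mx _); apply/matrixP => i j; rewrite !mxE (ord1 i).
Qed.

Lemma fcalcZ c f : c *: fcalc P d f = fcalc P d (fun x => c * f x).
Proof.
rewrite /fcalc scalemxAl scalemxAr; congr (_ *m _ *m _).
apply/matrixP => i j; rewrite !mxE; case: eqP => [->|]; rewrite ?mulr1n //.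
by rewrite !mulr0n mulr0.
Qed.

Lemma fcalc1 : fcalc P d (fun=> 1) = 1%:M.
Proof.
rewrite /fcalc; have -> : map_mx (fun=> 1) d = const_mx 1 :> 'rV[C]_n.
  by apply/matrixP => i j; rewrite !mxE.
by rewrite diag_const_mx mulmx1.
Qed.

Lemma fcalc_adj f : adjmx (fcalc P d f) = fcalc P d (fun x => conjc (f x)).
Proof.
rewrite /fcalc !adjmxM adjmxK adjmx_diag mulmxA; congr (_ *m diag_mx _ *m _).
by apply/matrixP => i j; rewrite !mxE.
Qed.

Lemma fcalc_expm c f : (forall x, has_cexp (c * x%:C) (f x)) ->
  expm (c *: fcalc P d (real_complex R)) = fcalc P d f.
Proof.
move=> H; rewrite fcalcZ; apply: expm_diag => // i; rewrite !mxE; exact: H.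
Qed.

Lemma fcalc_trace f : \tr (fcalc P d f) = \sum_i f (d 0 i).
Proof.
rewrite /fcalc mxtrace_mulC mulmxA PP mul1mx mxtrace_diag.
by apply: eq_bigr => i _; rewrite mxE.
Qed.

Lemma fcalc_pos f : (forall i, 0 <= f (d 0 i)) -> pos (fcalc P d f).
Proof. by move=> f0; apply: pos_diag => i; rewrite mxE. Qed.

(** In the eigenbasis, commutation with f(A) says that the entry (i, j) of B times f(d_j) - f(d_i)
    vanishes. For injective f, B therefore has no entries between distinct eigenvalues and commutes
    with every g(A). This is how commutation passes from an exponential to its logarithm. *)
Lemma fcalc_comm f g (B : 'M[C]_n) : injective f ->
  B *m fcalc P d f = fcalc P d f *m B -> B *m fcalc P d g = fcalc P d g *m B.
Proof.
move=> finj H; pose B' := adjmx P *m B *m P.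
have BE : B = P *m B' *m adjmx P.
  by rewrite /B' !mulmxA PP' mul1mx -mulmxA PP' mulmx1.
have lE h : B *m fcalc P d h = P *m (B' *m diag_mx (map_mx h d)) *m adjmx P.
  by rewrite {1}BE /fcalc !mulmxA -(mulmxA _ (adjmx P) P) PP mulmx1.
have rE h : fcalc P d h *m B = P *m (diag_mx (map_mx h d) *m B') *m adjmx P.
  by rewrite {1}BE /fcalc !mulmxA -(mulmxA _ (adjmx P) P) PP mulmx1.
have cancel (X Y : 'M[C]_n) : P *m X *m adjmx P = P *m Y *m adjmx P -> X = Y.
  move=> /(congr1 (fun Z => adjmx P *m Z *m P)); rewrite !mulmxA PP !mul1mx.
  by rewrite -!(mulmxA _ (adjmx P) P) PP !mulmx1.
move: H; rewrite (lE f) (rE f) (lE g) (rE g) => /cancel/matrixP H.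
suff -> : B' *m diag_mx (map_mx g d) = diag_mx (map_mx g d) *m B' by [].
apply/matrixP => i j; have := H i j; rewrite !mul_mx_diag !mul_diag_mx !mxE.
have [->|/eqP nij] := eqVneq (d 0 i) (d 0 j); first by move=> _; exact: mulrC.
rewrite mulrC => /eqP; rewrite -subr_eq0 -mulrBl mulf_eq0 subr_eq0.
by case/orP => /eqP => [/finj/esym//|->]; rewrite mulr0 mul0r.
Qed.

End Calculus.

Lemma fcalc_hermitian n (A : 'M[C]_n) : Defs.hermitian A ->
  exists (P : 'M[C]_n) (d : 'rV[R]_n),
    [/\ adjmx P *m P = 1%:M, P *m adjmx P = 1%:M & A = fcalc P d (real_complex R)].
Proof. exact: unitary_spectral. Qed.

Lemma expm_trmx n (W A : 'M[C]_n) c f :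
  adjmx W *m W = 1%:M -> W *m adjmx W = 1%:M -> Defs.hermitian A ->
  (forall x, has_cexp (c * x%:C) (f x)) ->
  W *m A^T *m adjmx W = A ->
  W *m (expm (c *: A))^T *m adjmx W = expm (c *: A).
Proof.
move=> WW WW' /fcalc_hermitian[P [d [PP PP' AE]]] fP WA.
pose Q := W *m map_mx (@conjc R) P.
have PcA : adjmx (map_mx (@conjc R) P) = P^T.
  by apply/matrixP => i j; rewrite !mxE conjcK.
have trE h : W *m (fcalc P d h)^T *m adjmx W = fcalc Q d h.
  rewrite /fcalc /Q adjmxM PcA 2!trmx_mul tr_diag_mx trmxK.
  by rewrite !mulmxA.
have PPt : map_mx (@conjc R) P *m P^T = 1%:M.
  rewrite -[LHS]trmxK trmx_mul trmxK.
  by have := PP'; rewrite /adjmx => ->; rewrite trmx1.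
have QQ' : Q *m adjmx Q = 1%:M.
  rewrite /Q adjmxM PcA.
  by rewrite !mulmxA -(mulmxA W) PPt mulmx1.
have QQ := mulmx1C QQ'.
rewrite AE trE in WA.
rewrite AE (fcalc_expm d PP PP' fP) trE -(fcalc_expm d QQ QQ' fP).
by rewrite WA (fcalc_expm d PP PP' fP).
Qed.

End Exponential.

(** * Channels with a Doeblin minorization *)

Section Channel.
Variable R : realType.
Local Notation C := (R[i]).
Local Open Scope classical_set_scope.

Lemma normc_ge_Im (z : C) : `|complex.Im z|%:C <= `|z|.
Proof. by rewrite normc_def lecR -sqrtr_sqr ler_wsqrtr // lerDr sqr_ge0. Qed.

Lemma ccvg_norm0 (u : nat -> C) (b : nat -> R) :
  (forall N, `|u N| <= (b N)%:C) -> b @ \oo --> (0 : R) -> ccvg u 0.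
Proof.
move=> ub b0; have nb0 : (fun N => - b N) @ \oo --> (0 : R).
  by rewrite -oppr0; exact: cvgN.
have H (f : C -> R) : (forall z : C, `|f z|%:C <= `|z|) -> (fun N => f (u N)) @ \oo --> (0 : R).
  move=> Hf; apply: (squeeze_cvgr _ nb0 b0); apply: nearW => N.
  by rewrite -ler_norml -lecR; apply: le_trans (Hf _) (ub N).
by split; apply: H => z; [exact: normc_ge_Re | exact: normc_ge_Im].
Qed.

Lemma ccvg_ge0 (u : nat -> C) l : ccvg u l -> (forall N, 0 <= u N) -> 0 <= l.
Proof.
move=> [u1 u2] u0; apply/ge0C; split.
  apply: (cvg_unique _ u2) => //.
  have -> : (fun N => complex.Im (u N)) = fun=> 0.
    by apply/funext => N; case/ge0C: (u0 N).
  exact: cvg_cst.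
have -> : complex.Re l = lim ((fun N => complex.Re (u N)) @ \oo).
  by apply/esym/cvg_lim.
apply: limr_ge; first by apply/cvg_ex; exists (complex.Re l).
by apply: nearW => N; case/ge0C: (u0 N).
Qed.

Lemma ccvg_unique (u : nat -> C) l k : ccvg u l -> ccvg u k -> l = k.
Proof. by move=> /ccvg_lim <- /ccvg_lim. Qed.

Definition lin_map n (L : 'M[C]_n -> 'M[C]_n) :=
  forall a X Y, L (a *: X + Y) = a *: L X + L Y.

Section LinMap.
Variables (n : nat) (L : 'M[C]_n -> 'M[C]_n).
Hypothesis linL : lin_map L.

Lemma lin_mapD X Y : L (X + Y) = L X + L Y.
Proof. by have := linL 1 X Y; rewrite !scale1r. Qed.

Lemma lin_map0 : L 0 = 0.
Proof. by apply: (addrI (L 0)); rewrite -lin_mapD !addr0. Qed.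

Lemma lin_mapZ a X : L (a *: X) = a *: L X.
Proof. by have := linL a X 0; rewrite lin_map0 !addr0. Qed.

Lemma lin_mapB X Y : L (X - Y) = L X - L Y.
Proof. by rewrite -scaleN1r addrC linL scaleN1r addrC. Qed.

Lemma lin_map_iter k : lin_map (iter k L).
Proof. by elim: k => [|k IH] a X Y //=; rewrite IH linL. Qed.

(** The matrix of a superoperator on [mxvec] rows, so that determinants and Cramer's rule become
    available. *)
Definition lmx : 'M[C]_(n * n) :=
  lin1_mx (fun u : 'rV[C]_(n * n) => mxvec (L (vec_mx u))).

Lemma lmxE X : mxvec X *m lmx = mxvec (L X).
Proof.
pose f (u : 'rV[C]_(n * n)) : 'rV[C]_(n * n) := mxvec (L (vec_mx u)).
have fl : linear f by move=> a u v; rewrite /f linearP linL linearP.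
pose g : {linear 'rV[C]_(n * n) -> 'rV[C]_(n * n)} :=
  HB.pack f (GRing.isLinear.Build _ _ _ _ f fl).
by rewrite /lmx (mul_rV_lin1 g) /= /f mxvecK.
Qed.

End LinMap.

Lemma mxtrace_sub n (A B : 'M[C]_n) : \tr (A - B) = \tr A - \tr B.
Proof. by rewrite linearB. Qed.

Lemma mxtrace_scalarM n (a : C) : \tr (a%:M : 'M[C]_n) = a * n%:R.
Proof. by rewrite mxtrace_scalar mulr_natr. Qed.

Definition channel n (L : 'M[C]_n -> 'M[C]_n) :=
  [/\ lin_map L, forall A, pos A -> pos (L A) & forall X, \tr (L X) = \tr X].

(** By self-duality of the cone this says that the k-th iterate of A is at least c (tr A) 1. The
    form symmetric in A and B is the one that time reversal can act on. *)
Definition minorized n (L : 'M[C]_n -> 'M[C]_n) :=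
  exists (k : nat) (c : R), 0 < c /\ forall A B : 'M[C]_n, pos A -> pos B ->
    c%:C * (\tr A * \tr B) <= \tr (B *m iter k L A).

Lemma hermitian_split n (X : 'M[C]_n) : exists H1 H2 : 'M[C]_n,
  [/\ Defs.hermitian H1, Defs.hermitian H2, X = H1 + 'i%C *: H2 &
      \tr X = 0 -> \tr H1 = 0 /\ \tr H2 = 0].
Proof.
have two : (2^-1 : C) = (2^-1 : R)%:C by rewrite fmorphV rmorph_nat.
have c2 : conjc (2^-1 : C) = 2^-1 by rewrite two conjc_real.
have ii : 'i%C * 'i%C = -1 :> C by rewrite -expr2 sqr_i.
have ci : conjc (- 'i%C : C) = 'i%C.
  by apply/eqP; rewrite eq_complex /= oppr0 opprK !eqxx.
have n2 : (2 : C) != 0 by rewrite pnatr_eq0.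
exists (2^-1 *: (X + adjmx X)), (2^-1 *: (- 'i%C *: (X - adjmx X))); split.
- by rewrite /Defs.hermitian adjmxZ c2 adjmxD adjmxK addrC.
- rewrite /Defs.hermitian adjmxZ adjmxZ c2 ci adjmxB adjmxK.
  by rewrite -[X in _ = _ *: (_ *: X)]opprB scalerN scaleNr opprK.
- rewrite !scalerA; have -> : 'i%C * 2^-1 * - 'i%C = 2^-1 :> C.
    by rewrite mulrN mulrAC ii mulN1r opprK.
  rewrite -scalerDr; have -> : X + adjmx X + (X - adjmx X) = (2 : C) *: X.
    by rewrite addrACA subrr addr0 scaler_nat mulr2n.
  by rewrite scalerA mulVf ?scale1r.
- by move=> tX; rewrite !mxtraceZ mxtraceD mxtrace_sub mxtrace_adj tX conjc0 subr0 addr0 !mulr0.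
Qed.

(** * Convergence and invariant states of minorized channels *)

Section Doeblin.
Variables (n : nat) (L : 'M[C]_n -> 'M[C]_n).
Hypothesis chL : channel L.
Hypothesis minL : minorized L.

Let linL : lin_map L. Proof. by case: chL. Qed.

Lemma channel_iter_pos k A : pos A -> pos (iter k L A).
Proof. by move=> pA; elim: k => [|k IH]; [exact: pA | case: chL => _ H _; exact: H]. Qed.

Lemma channel_iter_tr k A : \tr (iter k L A) = \tr A.
Proof. by elim: k => //= k <-; case: chL. Qed.

(** Subtracting from the iterate the multiple of the identity promised by the minorization leaves a
    positive matrix whose trace has shrunk by r = 1 - c n. The multiple depends on A through its
    trace only, which is what makes it cancel in differences. *)
Lemma channel_doeblin : exists (k : nat) (r : R), [/\ (0 < k)%N, `|r| < 1 &
  forall A, pos A -> exists c A', [/\ pos A', iter k L A = A' + (c * \tr A)%:M &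
     \tr A' = r%:C * \tr A /\ c = ((1 - r) / n%:R)%:C]].
Proof.
case: minL => k [c0 [c00 H0]].
(* Dimension zero is separated because 1/n serves as a positive cap below. *)
have [n0|n0] := posnP n.
  exists 1%N, 0; split => //; first by rewrite normr0.
  move=> A pA; exists ((1 - 0) / n%:R)%:C, 0; split; first exact: pos0.
    by apply/matrixP => i; have := ltn_ord i; rewrite {2}n0.
  by split => //; rewrite mxtrace0 mul0r.
have nR : (0 : R) < n%:R by rewrite ltr0n.
have ncR : n%:R = (n%:R : R)%:C :> C by rewrite rmorph_nat.
(* The cap 1/n keeps r nonnegative, and c > 0 makes r smaller than 1. *)
pose c := Num.min c0 (n%:R^-1).
have c0' : 0 < c by rewrite lt_min c00 invr_gt0.
have cc0 : c <= c0 by rewrite ge_min lexx.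
have cn : c * n%:R <= 1.
  by rewrite -ler_pdivlMr // mul1r ge_min lexx orbT.
(* The minorization may come with exponent 0, for instance in dimension one. One more application
   makes the exponent positive, as the division by it requires. *)
have H (A B : 'M[C]_n) : pos A -> pos B -> c%:C * (\tr A * \tr B) <= \tr (B *m iter k.+1 L A).
  move=> pA pB; have pLA : pos (L A) by case: chL => _ h _; exact: h.
  rewrite iterSr; apply: le_trans (H0 _ _ pLA pB).
  have -> : \tr (L A) = \tr A by case: chL.
  by apply: ler_wpM2r; rewrite ?lecR // mulr_ge0 // pos_tr_ge0.
exists k.+1, (1 - c * n%:R); split => //.
  rewrite ger0_norm ?subr_ge0 // ltrBlDr ltrDl mulr_gt0 //.
move=> A pA; have trA := pos_tr_ge0 pA.
exists c%:C, (iter k.+1 L A - (c%:C * \tr A)%:M); split.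
- have pLA := channel_iter_pos k.+1 pA.
  apply: pos_test.
    rewrite /Defs.hermitian adjmxB (proj1 pLA) adjmx_scalar conjc_ge0 //.
    by rewrite mulr_ge0 // ler0c ltW.
  move=> B pB; rewrite mulmxBl mxtrace_sub mul_scalar_mx mxtraceZ mxtrace_mulC.
  by rewrite subr_ge0 -mulrA; exact: H.
- by rewrite subrK.
- rewrite mxtrace_sub channel_iter_tr mxtrace_scalarM ncR.
  split; first by rewrite rmorphB rmorph1 rmorphM /=; ring.
  by congr (_%:C); rewrite opprB addrCA subrr addr0 mulfK // gt_eqF.
Qed.

(** Positive matrices of equal trace receive the same multiple of the identity in each block of k
    steps. It cancels in the difference, and only remainders of trace t r^m survive after m
    blocks. *)
Lemma channel_contract : exists (k : nat) (r : R), [/\ (0 < k)%N, `|r| < 1 &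
  forall A B (t : R), pos A -> pos B -> \tr A = t%:C -> \tr B = t%:C ->
  forall N a b, `|iter N L (A - B) a b| <= ((t * 2) * r ^+ (N %/ k))%:C].
Proof.
have [k [r [k0 r1 H]]] := channel_doeblin; exists k, r; split => //.
move=> A B t pA pB tA tB N a b.
have step m : exists A' B', [/\ pos A', pos B', \tr A' = (t * r ^+ m)%:C,
    \tr B' = (t * r ^+ m)%:C & iter (m * k) L (A - B) = A' - B'].
  elim: m => [|m [A' [B' [pA' pB' tA' tB' E]]]].
    by exists A, B; rewrite mulr1.
  have [c [A2 [pA2 EA2 [tA2 cE]]]] := H _ pA'.
  have [c' [B2 [pB2 EB2 [tB2 cE']]]] := H _ pB'.
  exists A2, B2; split => //.
  - by rewrite tA2 tA' -rmorphM exprS mulrCA.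
  - by rewrite tB2 tB' -rmorphM exprS mulrCA.
  - rewrite mulSn iterD E (lin_mapB (lin_map_iter linL k)) EA2 EB2 cE cE' tA' tB'.
    by rewrite opprD addrACA subrr addr0.
have [A' [B' [pA' pB' tA' tB' E]]] := step (N %/ k)%N.
(* The N mod k steps outside the full blocks preserve positivity and trace, hence also the bound on
   entries. *)
rewrite {1}(divn_eq N k) addnC iterD E (lin_mapB (lin_map_iter linL _)).
have -> : (iter (N %% k) L A' - iter (N %% k) L B') a b =
  iter (N %% k) L A' a b - iter (N %% k) L B' a b by rewrite !mxE.
apply: le_trans (ler_normB _ _) _.
have -> : (t * 2 * r ^+ (N %/ k))%:C =
    \tr (iter (N %% k) L A') + \tr (iter (N %% k) L B').
  by rewrite !channel_iter_tr tA' tB' -rmorphD; congr (_%:C); ring.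
by apply: lerD; apply: pos_entry; exact: channel_iter_pos.
Qed.

Lemma cvg_divn (k : nat) : (0 < k)%N -> (fun N => (N %/ k)%N) @ \oo --> \oo.
Proof.
move=> k0; apply/cvgnyPge => A; near=> N; rewrite leq_divRL //.
by near: N; exists (A * k)%N.
Unshelve. all: by end_near. Qed.

(** A hermitian traceless Y is the difference of the positive matrices Y + s and s, which have equal
    trace. The general case splits X into hermitian real and imaginary parts. *)
Lemma channel_cvg0 X : \tr X = 0 -> forall a b, ccvg (fun N => iter N L X a b) 0.
Proof.
have hc Y : Defs.hermitian Y -> \tr Y = 0 -> forall a b, ccvg (fun N => iter N L Y a b) 0.
  move=> hY tY a b; have [s [s0 pY]] := hermitian_shift hY.
  have [k [r [k0 r1 H]]] := channel_contract.
  have ps : pos (s%:C%:M : 'M[C]_n).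
    by rewrite -scalemx1; apply: posZ; [rewrite ler0c | exact: pos1].
  have tS : \tr (s%:C%:M : 'M[C]_n) = (s * n%:R)%:C.
    by rewrite mxtrace_scalarM rmorphM rmorph_nat.
  have tYS : \tr (Y + s%:C%:M) = (s * n%:R)%:C.
    by rewrite mxtraceD tY add0r.
  have := H _ _ _ pY ps tYS tS; rewrite addrK => HN.
  apply: (ccvg_norm0 (HN ^~ a ^~ b)).
  rewrite -[X in _ --> X](mulr0 (s * n%:R * 2)); apply: cvgM; first exact: cvg_cst.
  by apply: (cvg_comp (fun N => (N %/ k)%N) (fun m => r ^+ m) (cvg_divn k0)); exact: cvg_expr.
move=> tX a b; have [H1 [H2 [h1 h2 XE tE]]] := hermitian_split X.
have [t1 t2] := tE tX.
have := ccvgD (hc _ h1 t1 a b) (ccvgMl 'i%C (hc _ h2 t2 a b)).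
rewrite mulr0 addr0; congr ccvg; apply/funext => N.
by rewrite XE [H1 + _]addrC (lin_map_iter linL) !mxE addrC.
Qed.

Lemma channel_cvg0_tr Y X : \tr X = 0 -> ccvg (fun N => \tr (Y *m iter N L X)) 0.
Proof.
move=> tX; have -> : (0 : C) = \sum_i \sum_j Y i j * 0.
  by rewrite big1 // => i _; rewrite big1 // => j _; rewrite mulr0.
have -> : (fun N => \tr (Y *m iter N L X)) =
    fun N => \sum_i \sum_j Y i j * iter N L X j i.
  by apply/funext => N; apply: eq_bigr => i _; rewrite mxE.
by do 2!apply: ccvg_sum => ?; apply: ccvgMl; exact: channel_cvg0.
Qed.

Lemma channel_fixed_traceless X : L X = X -> \tr X = 0 -> X = 0.
Proof.
move=> LX tX; apply/matrixP => a b; rewrite mxE.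
apply: ccvg_unique (channel_cvg0 tX a b).
have -> : (fun N => iter N L X a b) = fun=> X a b; last exact: ccvg_cst.
apply/funext => N; suff -> : iter N L X = X by [].
by elim: N => //= N ->.
Qed.

Definition fix_op X := X - L X + \tr X *: (1%:M : 'M[C]_n).

Lemma fix_op_lin : lin_map fix_op.
Proof.
move=> a X Y; rewrite /fix_op linL mxtraceD mxtraceZ scalerDl -scalerA.
rewrite !scalerDr scalerN; apply/matrixP => i j; rewrite !mxE; ring.
Qed.

(** Taking the trace of [fix_op X = 0] gives n tr X = 0; then X is a traceless fixed point and
    vanishes. *)
Lemma fix_op_unit : lmx fix_op \in unitmx.
Proof.
rewrite -row_free_unit; apply: inj_row_free => v.
rewrite -[v]vec_mxK (lmxE fix_op_lin) => /eqP; rewrite mxvec_eq0 => /eqP H.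
set X := vec_mx v in H *.
have trX : \tr X = 0.
  have := congr1 mxtrace H; rewrite /fix_op mxtraceD mxtrace_sub mxtrace0.
  have -> : \tr (L X) = \tr X by case: chL.
  rewrite subrr add0r mxtraceZ mxtrace1 => /eqP; rewrite mulf_eq0 => /orP[/eqP//|].
  rewrite pnatr_eq0 => /eqP n0.
  by rewrite /mxtrace big1 // => i; have := ltn_ord i; rewrite {2}n0.
move: H; rewrite /fix_op trX scale0r addr0 => /subr0_eq/esym/channel_fixed_traceless.
by move=> /(_ trX) ->; rewrite linear0.
Qed.

(** Whereas [inv_state] is a choice, this is a rational expression in the entries of [L], from which
    smoothness can be read off. *)
Definition fix_state : 'M[C]_n := vec_mx (mxvec 1%:M *m invmx (lmx fix_op)).

Lemma fix_stateE : fix_op fix_state = 1%:M.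
Proof.
apply: (can_inj mxvecK); rewrite -(lmxE fix_op_lin) vec_mxK.
by rewrite mulmxKV // fix_op_unit.
Qed.

Hypothesis n0 : (0 < n)%N.

Let nC : (n%:R : C) != 0. Proof. by rewrite pnatr_eq0 -lt0n. Qed.

Lemma fix_state_tr : \tr fix_state = 1.
Proof.
have := congr1 mxtrace fix_stateE; rewrite /fix_op mxtraceD mxtrace_sub.
have -> : \tr (L fix_state) = \tr fix_state by case: chL.
by rewrite subrr add0r mxtraceZ mxtrace1 -{2}[n%:R]mul1r => /(mulIf nC).
Qed.

Lemma fix_state_fixed : L fix_state = fix_state.
Proof.
have := fix_stateE; rewrite /fix_op fix_state_tr scale1r => /eqP.
by rewrite -subr_eq0 addrK subr_eq0 => /eqP.
Qed.

Lemma channel_fixed_unique X Y : L X = X -> L Y = Y -> \tr X = \tr Y -> X = Y.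
Proof.
move=> LX LY tXY; apply/eqP; rewrite -subr_eq0; apply/eqP.
apply: channel_fixed_traceless; first by rewrite (lin_mapB linL) LX LY.
by rewrite mxtrace_sub tXY subrr.
Qed.

(** The quadratic form is a limit of those of the iterates of 1/n, which are positive. Hermiticity
    comes from uniqueness, the adjoint being another fixed point of trace one. *)
Lemma fix_state_pos : pos fix_state.
Proof.
suff H (v : 'cV[C]_n) : 0 <= \tr ((v *m adjmx v) *m fix_state).
  have pv (v : 'cV[C]_n) : 0 <= (adjmx v *m fix_state *m v) 0 0 by rewrite mxtr_quad mxtrace_mulC.
  split; last exact/psdP.
  have [H1 [H2 [h1 h2 XE tE]]] := hermitian_split fix_state.
  have LH (Z : 'M[C]_n) : Defs.hermitian Z -> Defs.hermitian (L Z).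
    move=> hZ; have [s [s0 pZ]] := hermitian_shift hZ.
    have ps : pos (s%:C%:M : 'M[C]_n).
      by rewrite -scalemx1; apply: posZ; [rewrite ler0c | exact: pos1].
    have -> : L Z = L (Z + s%:C%:M) - L s%:C%:M by rewrite (lin_mapD linL) addrK.
    case: chL => _ pL _; rewrite /Defs.hermitian adjmxB.
    by rewrite (proj1 (pL _ pZ)) (proj1 (pL _ ps)).
  have adjL X : L (adjmx X) = adjmx (L X).
    have [K1 [K2 [k1 k2 KE _]]] := hermitian_split X.
    rewrite KE addrC linL !adjmxD !adjmxZ (LH _ k1) (LH _ k2) k1 k2.
    by rewrite linL.
  apply: channel_fixed_unique.
  - by rewrite adjL fix_state_fixed.
  - exact: fix_state_fixed.
  - by rewrite mxtrace_adj fix_state_tr conjc1.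
pose X : 'M[C]_n := n%:R^-1 *: 1%:M - fix_state.
have tX : \tr X = 0.
  by rewrite /X mxtrace_sub mxtraceZ mxtrace1 mulVf // fix_state_tr subrr.
have cv := ccvgD (channel_cvg0_tr (v *m adjmx v) tX) (ccvg_cst (\tr ((v *m adjmx v) *m fix_state))).
rewrite add0r in cv; apply: ccvg_ge0 cv _ => N.
have -> : iter N L X = iter N L (n%:R^-1 *: 1%:M) - fix_state.
  rewrite /X (lin_mapB (lin_map_iter linL N)); congr (_ - _).
  by elim: N => //= N ->; exact: fix_state_fixed.
rewrite -mxtraceD -mulmxDr subrK; apply: pos_trM; first exact: pos_mulmx_adj.
apply: channel_iter_pos; apply: posZ; last exact: pos1.
by rewrite invr_ge0 ler0n.
Qed.

(** A fixed point of trace one is unique among all matrices, so it equals [fix_state] and inherits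
    its positivity. *)
Lemma inv_stateE rho : \tr rho = 1 -> L rho = rho -> inv_state L = rho.
Proof.
move=> tr1 Lr.
have uniq sigma : \tr sigma = 1 -> L sigma = sigma -> sigma = rho.
  by move=> t1 Ls; apply: channel_fixed_unique => //; rewrite t1.
have fE : fix_state = rho by apply: uniq; [exact: fix_state_tr | exact: fix_state_fixed].
rewrite /inv_state; case: xgetP => [s -> [[_ [_ t1]] [Ls _]]|/(_ rho)].
  exact: uniq.
case; split.
  by rewrite -fE; have [h p] := fix_state_pos; split => //; split => //; exact: fix_state_tr.
by split => // sigma [_ [_ t1]]; exact: uniq.
Qed.

Lemma inv_state_fix_state : inv_state L = fix_state.
Proof. by apply: inv_stateE; [exact: fix_state_tr | exact: fix_state_fixed]. Qed.

End Doeblin.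
End Channel.

(** * Primitive maps and comparison of positive maps *)

Section Comparison.
Variable R : realType.
Local Notation C := (R[i]).

(** Cauchy-Schwarz against the constant vector, from the squares of y_l - y_k. *)
Lemma sqr_sum_le m (y : 'I_m -> C) : (forall l, y l \is Num.real) ->
  (\sum_l y l) ^+ 2 <= m%:R * \sum_l y l ^+ 2.
Proof.
move=> yr; rewrite -(ler_pMn2r (isT : (0 < 2)%N)).
have -> : (m%:R * \sum_l y l ^+ 2) *+ 2 = \sum_(l < m) \sum_(k < m) (y l ^+ 2 + y k ^+ 2).
  apply/esym; rewrite (eq_bigr (fun l => m%:R * y l ^+ 2 + \sum_k y k ^+ 2)).
    by rewrite big_split /= -mulr_sumr sumr_const card_ord mulr_natl mulr2n.
  by move=> l _; rewrite big_split /= sumr_const card_ord mulr_natl.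
rewrite expr2 mulr_suml -sumrMnl; apply: ler_sum => l _.
rewrite mulr_sumr -sumrMnl; apply: ler_sum => k _.
rewrite -subr_ge0 (_ : _ - _ = (y l - y k) ^+ 2); last by rewrite sqrrB; ring.
by rewrite real_exprn_even_ge0 // rpredB.
Qed.

Lemma kraus_iter n (L : 'M[C]_n -> 'M[C]_n) (Ks : seq 'M[C]_n) :
  (forall X, L X = \sum_(K <- Ks) K *m X *m adjmx K) ->
  forall k X, iter k L X = \sum_(P <- kprods Ks k) P *m X *m adjmx P.
Proof.
move=> LE; elim=> [|k IH] X.
  by rewrite /= big_seq1 mul1mx adjmx1 mulmx1.
rewrite iterS LE IH /= big_allpairs_dep /=; apply: eq_bigr => K _.
rewrite mulmx_sumr mulmx_suml; apply: eq_bigr => P _.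
by rewrite adjmxM !mulmxA.
Qed.

Lemma kraus_span n (s : seq 'M[C]_n) :
  (1%:M <= \sum_(P <- s) <<mxvec P>>)%MS ->
  forall X : 'M[C]_n, exists al : 'I_(size s) -> C, X = \sum_l al l *: s`_l.
Proof.
rewrite (big_nth 0) big_mkord => sub X.
have /sub_sumsmxP[u uE] : (mxvec X <= \sum_(i < size s) <<mxvec s`_i>>)%MS.
  exact: submx_trans (submx1 _) sub.
have aP l : exists a : C, u l *m <<mxvec s`_l>>%MS = a *: mxvec s`_l.
  apply/sub_rVP; by apply: submx_trans (submxMl _ _) _; rewrite genmxE.
pose al l := projT1 (cid (aP l)); exists al.
apply: (can_inj mxvecK); rewrite uE linear_sum; apply: eq_bigr => l _.
by rewrite linearZ /= -(projT2 (cid (aP l))).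
Qed.

(** For A = X X^* and B = Y Y^*, tr (B L^k A) is the sum of |Y^* P X|^2 over the Kraus products P,
    in Hilbert-Schmidt norm, and tr A tr B is the same sum over the matrix units. Primitivity
    expands each matrix unit in the P, and Cauchy-Schwarz bounds the second sum by [K] times the
    first. *)
Lemma primitive_minorized n (L : 'M[C]_n -> 'M[C]_n) : Defs.primitive L -> minorized L.
Proof.
case=> Ks [LE [k]]; set s := kprods Ks k => /kraus_span sp.
pose al a b := projT1 (cid (sp (delta_mx a b))).
have alE a b : delta_mx a b = \sum_l al a b l *: s`_l by exact: (projT2 (cid (sp _))).
pose m := size s.
pose K : C := \sum_a \sum_b (m%:R * \sum_l `|al a b l| ^+ 2).
have K0 : 0 <= K.
  apply: sumr_ge0 => a _; apply: sumr_ge0 => b _; apply: mulr_ge0 => //.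
  by apply: sumr_ge0 => l _; rewrite exprn_ge0 ?normr_ge0.
have [q [q0 KE]] : exists q : R, 0 <= q /\ K = q%:C.
  exists (complex.Re K); move/ge0C: K0 => [ImK ReK]; split => //.
  by case: K ImK {ReK} => x y /= ->.
(* [K] alone may vanish, in dimension zero, hence the added 1. *)
have c0 : 0 < 1 + q by rewrite ltr_pwDl.
exists k, (1 + q)^-1; split; first by rewrite invr_gt0.
move=> A B /pos_sqrt[X AX] /pos_sqrt[Y BY].
pose f (Z : 'M[C]_n) := adjmx Y *m Z *m X.
pose ns (Z : 'M[C]_n) : C := \sum_i \sum_j `|Z i j| ^+ 2.
have ns0 Z : 0 <= ns Z.
  apply: sumr_ge0 => i _; apply: sumr_ge0 => j _; by rewrite exprn_ge0 ?normr_ge0.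
have SE : \tr (B *m iter k L A) = \sum_(l < m) ns (f s`_l).
  rewrite (kraus_iter LE) -/s (big_nth 0) big_mkord mulmx_sumr linear_sum /=.
  apply: eq_bigr => l _; rewrite /ns -mxtr_mulmx_adj /f !adjmxM adjmxK BY AX.
  by rewrite -(mulmxA Y) mxtrace_mulC !mulmxA.
have tE : \tr A * \tr B = \sum_a \sum_b ns (f (delta_mx a b)).
  rewrite mulrC AX BY !mxtr_mulmx_adj mulr_suml; apply: eq_bigr => a _.
  rewrite mulr_sumr; apply: eq_bigr => b _.
  rewrite mulr_suml; apply: eq_bigr => i _.
  rewrite mulr_sumr; apply: eq_bigr => j _.
  have -> : f (delta_mx a b) i j = conjc (Y a i) * X b j.
    rewrite /f -mulmxA mxE (bigD1 a) //= big1 ?addr0 => [|a' aa'].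
      rewrite adjmxE; congr (_ * _); rewrite mxE (bigD1 b) //= big1 ?addr0 => [|b' bb'].
        by rewrite mxE !eqxx mul1r.
      by rewrite mxE (negPf bb') andbF mul0r.
    rewrite adjmxE mxE big1 ?mulr0 // => b' _.
    by rewrite mxE (negPf aa') mul0r.
  by rewrite normrM normcJ exprMn.
have S0 : 0 <= \sum_(l < m) ns (f s`_l) by apply: sumr_ge0 => l _.
have le1 : \tr A * \tr B <= K * \sum_(l < m) ns (f s`_l).
  rewrite tE /K mulr_suml; apply: ler_sum => a _; rewrite mulr_suml; apply: ler_sum => b _.
  have -> : f (delta_mx a b) = \sum_l al a b l *: f s`_l.
    rewrite /f alE mulmx_sumr mulmx_suml; apply: eq_bigr => l _.
    by rewrite -scalemxAr -scalemxAl.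
  rewrite -mulrA; set F := \sum_l _ *: _.
  have Fle i j : `|F i j| ^+ 2 <= m%:R * \sum_l `|al a b l| ^+ 2 * `|f s`_l i j| ^+ 2.
    rewrite /F summxE; apply: (le_trans (_ : _ <= (\sum_l `|al a b l| * `|f s`_l i j|) ^+ 2)).
      have S1 : 0 <= \sum_l `|al a b l| * `|f s`_l i j|.
        by apply: sumr_ge0 => l _; rewrite mulr_ge0 ?normr_ge0.
      rewrite lerXn2r ?nnegrE ?normr_ge0 //.
      apply: le_trans (ler_norm_sum _ _ _) _; apply: ler_sum => l _.
      by rewrite mxE normrM.
    apply: le_trans (sqr_sum_le _) _ => [l|]; first by rewrite rpredM // normr_real.
    by apply: ler_wpM2l => //; apply: ler_sum => l _; rewrite exprMn.
  apply: (le_trans (_ : _ <= \sum_i \sum_j (m%:R * \sum_l `|al a b l| ^+ 2 * `|f s`_l i j| ^+ 2))).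
    by apply: ler_sum => i _; apply: ler_sum => j _; exact: Fle.
  have -> : \sum_i \sum_j (m%:R * \sum_l `|al a b l| ^+ 2 * `|f s`_l i j| ^+ 2) =
      m%:R * \sum_l `|al a b l| ^+ 2 * ns (f s`_l).
    rewrite mulr_sumr; under eq_bigr => i _ do rewrite -mulr_sumr exchange_big mulr_sumr /=.
    rewrite exchange_big /=; apply: eq_bigr => l _.
    rewrite -mulr_sumr; congr (_ * _); rewrite /ns mulr_sumr; apply: eq_bigr => i _.
    by rewrite mulr_sumr.
  apply: ler_wpM2l => //; rewrite mulr_suml; apply: ler_sum => l _.
  apply: ler_wpM2l; first by rewrite exprn_ge0 ?normr_ge0.
  by rewrite (bigD1 l) //= lerDl sumr_ge0.
have qE : (1 + q)%:C = 1 + K by rewrite KE rmorphD.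
rewrite SE fmorphV ler_pdivrMl ?ltcR // [X in _ <= X * _]qE.
by apply: le_trans le1 _; rewrite mulrDl mul1r lerDr.
Qed.

Definition posmap n (L : 'M[C]_n -> 'M[C]_n) :=
  lin_map L /\ forall A, pos A -> pos (L A).

(** Inequality up to a constant in the order of positive maps. Compositions, sums and iterates
    respect it, and it carries [minorized] from [L1] to [L2]. *)
Definition dominated n (L1 L2 : 'M[C]_n -> 'M[C]_n) :=
  exists c : R, 0 < c /\ forall A, pos A -> pos (c%:C *: L2 A - L1 A).

Lemma posmap_comp n (L1 L2 : 'M[C]_n -> 'M[C]_n) :
  posmap L1 -> posmap L2 -> posmap (L1 \o L2).
Proof.
move=> [l1 p1] [l2 p2]; split => [a X Y|A pA] /=; first by rewrite l2 l1.
by apply: p1; exact: p2.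
Qed.

Lemma posmap_id n : posmap (id : 'M[C]_n -> 'M[C]_n).
Proof. by []. Qed.

Lemma posmap_iter n (L : 'M[C]_n -> 'M[C]_n) k : posmap L -> posmap (iter k L).
Proof. by move=> pL; elim: k => [|k IH]; [exact: posmap_id|exact: (posmap_comp pL IH)]. Qed.

Lemma posmap_sum n I (r : seq I) (F : I -> 'M[C]_n -> 'M[C]_n) :
  (forall i, posmap (F i)) -> posmap (fun X => \sum_(i <- r) F i X).
Proof.
move=> pF; split => [a X Y|A pA].
  rewrite scaler_sumr -big_split; apply: eq_bigr => i _; exact: (proj1 (pF i)).
by apply: pos_sum => i; exact: (proj2 (pF i)).
Qed.

Lemma posmap_scale n (c : C) (L : 'M[C]_n -> 'M[C]_n) :
  0 <= c -> posmap L -> posmap (fun X => c *: L X).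
Proof.
move=> c0 [lL pL]; split => [a X Y|A pA]; last by apply: posZ => //; exact: pL.
by rewrite lL scalerDr !scalerA mulrC.
Qed.

Lemma dominated_id n : dominated (id : 'M[C]_n -> 'M[C]_n) id.
Proof.
exists 1; split; first exact: ltr01.
by move=> A pA; rewrite rmorph1 scale1r subrr; exact: pos0.
Qed.

Lemma dominated_comp n (L1 L2 K1 K2 : 'M[C]_n -> 'M[C]_n) :
  posmap K1 -> posmap L2 -> dominated K1 K2 -> dominated L1 L2 ->
  dominated (K1 \o L1) (K2 \o L2).
Proof.
move=> [lK pK] [lL pL] [c [c0 Hc]] [d [d0 Hd]]; exists (d * c); split.
  exact: mulr_gt0.
move=> A pA /=.
have -> : (d * c)%:C *: K2 (L2 A) - K1 (L1 A) =
    d%:C *: (c%:C *: K2 (L2 A) - K1 (L2 A)) + K1 (d%:C *: L2 A - L1 A).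
  by rewrite (lin_mapB lK) (lin_mapZ lK) scalerBr scalerA -rmorphM addrA subrK.
apply: posD; last exact: pK (Hd _ pA).
by apply: posZ (Hc _ (pL _ pA)); rewrite ler0c ltW.
Qed.

Lemma dominated_iter n (L1 L2 : 'M[C]_n -> 'M[C]_n) k :
  posmap L1 -> posmap L2 -> dominated L1 L2 -> dominated (iter k L1) (iter k L2).
Proof.
move=> p1 p2 d; elim: k => [|k IH]; first exact: dominated_id.
exact: dominated_comp (posmap_iter k p2) d IH.
Qed.

Lemma dominated_sum n (I : finType) (F G : I -> 'M[C]_n -> 'M[C]_n) :
  (forall i, posmap (G i)) -> (forall i, dominated (F i) (G i)) ->
  dominated (fun X => \sum_i F i X) (fun X => \sum_i G i X).
Proof.
move=> pG d; pose c i := projT1 (cid (d i)).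
have [c0 cP] : (forall i, 0 < c i) /\
    (forall i A, pos A -> pos ((c i)%:C *: G i A - F i A)).
  by split => i; rewrite /c; case: cid => x [].
(* The sum is at least each [c i]; the 1 keeps it positive for an empty index type. *)
exists (1 + \sum_i c i); split.
  by rewrite ltr_pwDl // sumr_ge0 // => i _; exact: ltW.
move=> A pA; rewrite scaler_sumr -sumrB; apply: pos_sum => i.
have -> : (1 + \sum_i c i)%:C *: G i A - F i A =
   (1 + \sum_i c i - c i)%:C *: G i A + ((c i)%:C *: G i A - F i A).
  by rewrite addrA -scalerDl -rmorphD subrK.
apply: posD (cP _ _ pA); apply: posZ; last exact: (proj2 (pG i)).
rewrite ler0c -addrA addr_ge0 // (bigD1 i) //= addrAC subrr add0r sumr_ge0 // => j _.
exact: ltW.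
Qed.

Lemma dominated_scale n (a : R) (F G : 'M[C]_n -> 'M[C]_n) : 0 <= a ->
  dominated F G -> dominated (fun X => a%:C *: F X) (fun X => a%:C *: G X).
Proof.
move=> a0 [c [c0 H]]; exists c; split; first exact: c0.
move=> A pA.
rewrite scalerA mulrC -scalerA -scalerBr; apply: posZ; first by rewrite ler0c.
exact: H.
Qed.

Lemma dominated_minorized n (L1 L2 : 'M[C]_n -> 'M[C]_n) :
  posmap L1 -> posmap L2 -> dominated L1 L2 -> minorized L1 -> minorized L2.
Proof.
move=> p1 p2 d [k [c [c0 H]]]; have [e [e0 E]] := dominated_iter k p1 p2 d.
exists k, (e^-1 * c); split; first by rewrite mulr_gt0 // invr_gt0.
move=> A B pA pB; rewrite rmorphM -mulrA fmorphV ler_pdivrMl ?ltcR //.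
apply: le_trans (H _ _ pA pB) _; rewrite -subr_ge0.
have := pos_trM pB (E _ pA).
by rewrite mulmxBr mxtrace_sub -scalemxAr mxtraceZ.
Qed.

End Comparison.

(** * Repeated interaction systems *)

Section Gibbs.
Variable R : realType.
Local Notation C := (R[i]).

(** The basis is chosen before [b], so the temperature enters only through scalar functions of the
    eigenvalues. *)
Lemma gibbs_fcalc n (H : 'M[C]_n) : Defs.hermitian H ->
  exists (P : 'M[C]_n) (d : 'rV[R]_n),
    [/\ adjmx P *m P = 1%:M, P *m adjmx P = 1%:M, H = fcalc P d (real_complex R) &
        forall b, gibbs H b =
          fcalc P d (fun x => ((\sum_i expR (- b * d 0 i))^-1 * expR (- b * x))%:C)].
Proof.
move=> /fcalc_hermitian[P [d [PP PP' HE]]]; exists P, d; split; [exact: PP|exact: PP'|exact: HE|] => b.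
have E : expm ((- b)%:C *: H) = fcalc P d (fun x => (expR (- b * x))%:C).
  rewrite HE; apply: fcalc_expm => // x; rewrite -rmorphM; exact: has_cexp_real.
rewrite /gibbs E (fcalc_trace _ PP) fcalcZ.
have -> : (\sum_i (expR (- b * d 0 i))%:C)^-1 = ((\sum_i expR (- b * d 0 i))^-1)%:C :> C.
  by rewrite fmorphV rmorph_sum.
by congr fcalc; apply/funext => x; rewrite rmorphM.
Qed.

Lemma sum_expR_gt0 n (f : 'I_n -> R) : (0 < n)%N -> 0 < \sum_i expR (f i).
Proof.
case: n f => // n f _; rewrite big_ord_recl; apply: ltr_pwDl; first exact: expR_gt0.
by apply: sumr_ge0 => i _; exact: expR_ge0.
Qed.

Lemma gibbs_tr n (H : 'M[C]_n) b : (0 < n)%N -> Defs.hermitian H -> \tr (gibbs H b) = 1.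
Proof.
move=> n0 /gibbs_fcalc[P [d [PP PP' HE ->]]]; rewrite fcalc_trace //.
by rewrite -rmorph_sum -mulr_sumr mulVf // gt_eqF // sum_expR_gt0.
Qed.

Lemma gibbs_pos n (H : 'M[C]_n) b : (0 < n)%N -> Defs.hermitian H -> pos (gibbs H b).
Proof.
move=> n0 /gibbs_fcalc[P [d [PP PP' HE ->]]]; apply: fcalc_pos => i.
by rewrite ler0c mulr_ge0 ?expR_ge0 // invr_ge0 ltW // sum_expR_gt0.
Qed.

Lemma gibbs_comm n (H : 'M[C]_n) b : Defs.hermitian H ->
  gibbs H b *m H = H *m gibbs H b.
Proof.
move=> /gibbs_fcalc[P [d [PP PP' HE ->]]]; rewrite HE !(fcalcM _ PP).
by congr fcalc; apply/funext => x; rewrite mulrC.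
Qed.

Lemma fcalc_le n (P : 'M[C]_n) (d : 'rV[R]_n) f g : P *m adjmx P = 1%:M ->
  (forall i, g (d 0 i) <= f (d 0 i)) -> pos (fcalc P d f - fcalc P d g).
Proof.
move=> PP' fg; rewrite /fcalc -mulmxBl -mulmxBr -linearB /=; apply: pos_diag => i.
by rewrite !mxE subr_ge0.
Qed.

Lemma finite_lower_bound n (f : 'I_n -> R) : (forall i, 0 < f i) ->
  exists c, 0 < c /\ forall i, c <= f i.
Proof.
elim: n f => [|n IH] f f0; first by exists 1; split; [exact: ltr01 | case].
have [c [c0 H]] := IH (fun i => f (lift ord0 i)) (fun i => f0 _).
exists (Num.min c (f ord0)); split; first by rewrite lt_min c0 f0.
move=> i; case: (unliftP ord0 i) => [j ->|->]; last by rewrite ge_min lexx orbT.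
by rewrite ge_min H.
Qed.

(** At every finite temperature a Gibbs state has full rank. Together with the upper bound this
    makes all of them comparable with the identity. *)
Lemma gibbs_lower n (H : 'M[C]_n) b : (0 < n)%N -> Defs.hermitian H ->
  exists c : R, 0 < c /\ pos (gibbs H b - c%:C%:M).
Proof.
move=> n0 /gibbs_fcalc[P [d [PP PP' HE ->]]].
set Z := (\sum_i _)^-1; have Z0 : 0 < Z by rewrite invr_gt0 sum_expR_gt0.
have [c [c0 H']] := @finite_lower_bound n (fun i => Z * expR (- b * d 0 i))
  (fun i => mulr_gt0 Z0 (expR_gt0 _)).
exists c; split => //.
have -> : c%:C%:M = fcalc P d (fun=> c%:C * 1).
  by rewrite -fcalcZ fcalc1 // scalemx1.
by apply: fcalc_le => // i; rewrite mulr1 lecR.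
Qed.

Lemma gibbs_upper n (H : 'M[C]_n) b : (0 < n)%N -> Defs.hermitian H ->
  exists c : R, 0 < c /\ pos (c%:C%:M - gibbs H b).
Proof.
move=> n0 /gibbs_fcalc[P [d [PP PP' HE ->]]].
set Z := (\sum_i _)^-1; have Z0 : 0 < Z by rewrite invr_gt0 sum_expR_gt0.
pose c := 1 + \sum_i Z * expR (- b * d 0 i).
have t0 i : 0 <= Z * expR (- b * d 0 i) by rewrite mulr_ge0 ?expR_ge0 // ltW.
exists c; split; first by rewrite ltr_pwDl // sumr_ge0.
have -> : c%:C%:M = fcalc P d (fun=> c%:C * 1).
  by rewrite -fcalcZ fcalc1 // scalemx1.
apply: fcalc_le => // i; rewrite mulr1 lecR /c (bigD1 i) //= addrCA lerDl.
by rewrite addr_ge0 // sumr_ge0.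
Qed.

Lemma expm_unitary n (H : 'M[C]_n) (t : R) : Defs.hermitian H ->
  let U := expm ((0 +i* t)%C *: H) in adjmx U *m U = 1%:M /\ U *m adjmx U = 1%:M.
Proof.
move=> /fcalc_hermitian[P [d [PP PP' HE]]] /=.
have -> : expm ((0 +i* t)%C *: H) = fcalc P d (fun x => (cos (t * x) +i* sin (t * x))%C).
  rewrite HE; apply: fcalc_expm => // x.
  have -> : (0 +i* t)%C * x%:C = (0 +i* (t * x))%C.
    by apply/eqP; rewrite eq_complex /= !mul0r !mulr0 subr0 add0r !eqxx.
  exact: has_cexp_imaginary.
rewrite fcalc_adj !(fcalcM _ PP).
have cs x : cos x * cos x + sin x * sin x = 1 :> R by rewrite -!expr2 cos2Dsin2.
split; rewrite -[RHS](fcalc1 d PP'); congr fcalc; apply/funext => x;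
  apply/eqP; rewrite eq_complex /=; apply/andP; split; apply/eqP.
- by rewrite mulNr opprK.
- by rewrite mulNr mulrC subrr.
- by rewrite mulrN opprK.
- by rewrite mulrN mulrC addrC subrr.
Qed.

End Gibbs.

(** * Reduced maps and comparison across temperatures *)

Section RIS.
Variables (R : realType) (M : nat) (S : RIS R M).
Hypothesis wfS : RIS_wf S.
Local Notation C := (R[i]).
Local Notation dS := (dS S).
Local Notation dE := (dE S).
Local Notation U := (Uj S).
Local Notation "\1" := (1%:M) (at level 0).

Lemma dS_gt0 : (0 < dS)%N. Proof. by case: wfS. Qed.
Lemma dE_gt0 j : (0 < dE j)%N. Proof. by case: wfS => _ []. Qed.
Lemma HE_hermitian j : Defs.hermitian (HE S j). Proof. by case: wfS => _ [_ [_ []]]. Qed.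

Lemma Hj_hermitian j : Defs.hermitian (Hj S j).
Proof.
case: wfS => _ [_ [hS [hE [hV _]]]].
by rewrite /Defs.hermitian /Hj !adjmxD !adjmx_tens !adjmx1 hS hE hV.
Qed.

Lemma UadjU j : adjmx (U j) *m U j = 1%:M.
Proof. by case: (expm_unitary (- tau S j) (Hj_hermitian j)). Qed.

Lemma UUadj j : U j *m adjmx (U j) = 1%:M.
Proof. by case: (expm_unitary (- tau S j) (Hj_hermitian j)). Qed.

Lemma rhoE_tr z j : \tr (rhoE S z j) = 1.
Proof. exact: gibbs_tr (dE_gt0 j) (HE_hermitian j). Qed.

Lemma rhoE_pos z j : pos (rhoE S z j).
Proof. exact: gibbs_pos (dE_gt0 j) (HE_hermitian j). Qed.

Lemma rhoE_comm z j : rhoE S z j *m HE S j = HE S j *m rhoE S z j.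
Proof. exact: gibbs_comm (HE_hermitian j). Qed.

(* [Lj] with the Gibbs state replaced by the identity: it does not depend on [zeta]
   and is comparable with every [Lj S z j]. *)
Definition Nj (j : 'I_M) (X : 'M[C]_dS) : 'M[C]_dS :=
  ptr2 (U j *m (X *t (\1 : 'M[C]_(dE j))) *m adjmx (U j)).

Lemma conj_ptr2_posmap j (B : 'M[C]_(dE j)) : pos B ->
  posmap (fun X : 'M[C]_dS => ptr2 (U j *m (X *t B) *m adjmx (U j))).
Proof.
move=> pB; split => [a X Y|A pA]; last by apply/pos_ptr2/pos_congr/pos_tens.
rewrite tensmxDl tensmxZl mulmxDr mulmxDl ptr2D -scalemxAr -scalemxAl.
by rewrite ptr2Z.
Qed.

Lemma Lj_posmap z j : posmap (Lj S z j).
Proof. exact: conj_ptr2_posmap (rhoE_pos z j). Qed.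

Lemma Nj_posmap j : posmap (Nj j).
Proof. by apply: conj_ptr2_posmap; exact: pos1. Qed.

Lemma Lj_tr z j X : \tr (Lj S z j X) = \tr X.
Proof.
rewrite /Lj mxtrace_ptr2 mxtrace_mulC mulmxA UadjU mul1mx mxtrace_tens rhoE_tr.
by rewrite mulr1.
Qed.

Lemma Nj_dominated z j : dominated (Nj j) (Lj S z j).
Proof.
have [c [c0 pc]] := gibbs_lower (betaj S z j) (dE_gt0 j) (HE_hermitian j).
exists c^-1; split; first by rewrite invr_gt0.
move=> A pA; rewrite /Nj /Lj.
have -> : (A *t (\1 : 'M[C]_(dE j))) = (c^-1)%:C *: (A *t c%:C%:M).
  have -> : c%:C%:M = c%:C *: \1 :> 'M[C]_(dE j) by rewrite scalemx1.
  rewrite tensmxZr scalerA -rmorphM mulVf ?rmorph1 ?scale1r //.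
  by rewrite gt_eqF.
rewrite -scalemxAr -scalemxAl ptr2Z -scalerBr; apply: posZ.
  by rewrite ler0c invr_ge0 ltW.
rewrite -ptr2B -mulmxBl -mulmxBr -tensmxBr.
by apply/pos_ptr2/pos_congr/pos_tens.
Qed.

Lemma Lj_dominated z j : dominated (Lj S z j) (Nj j).
Proof.
have [c [c0 pc]] := gibbs_upper (betaj S z j) (dE_gt0 j) (HE_hermitian j).
exists c; split; first exact: c0.
move=> A pA; rewrite /Nj /Lj.
rewrite -ptr2Z scalemxAl scalemxAr -tensmxZr scalemx1.
rewrite -ptr2B -mulmxBl -mulmxBr -tensmxBr.
by apply/pos_ptr2/pos_congr/pos_tens.
Qed.

(** The head of the list acts first, so that [Ldcomp S z s] is the dual of [Lword z s] for the same
    list. *)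
Definition Lword z (s : seq 'I_M) (X : 'M[C]_dS) := foldl (fun r j => Lj S z j r) X s.
Definition Nword (s : seq 'I_M) (X : 'M[C]_dS) := foldl (fun r j => Nj j r) X s.

Lemma Lword_cat z s1 s2 X : Lword z (s1 ++ s2) X = Lword z s2 (Lword z s1 X).
Proof. exact: foldl_cat. Qed.

Lemma LcyE z : Lcy S z = Lword z (enum 'I_M). Proof. by []. Qed.

Lemma LrcyE z : Lrcy S z = Lword z (rev (enum 'I_M)).
Proof. by apply/funext => X; rewrite /Lword foldl_rev. Qed.

Lemma Lword_posmap z s : posmap (Lword z s).
Proof.
elim/last_ind: s => [|s j IH]; first exact: posmap_id.
have -> : Lword z (rcons s j) = Lj S z j \o Lword z s.
  by apply/funext => X; rewrite /Lword foldl_rcons.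
exact: posmap_comp (Lj_posmap z j) IH.
Qed.

Lemma Lword_lin z s : lin_map (Lword z s). Proof. by case: (Lword_posmap z s). Qed.

Lemma Lword_tr z s X : \tr (Lword z s X) = \tr X.
Proof. by elim: s X => //= j s IH X; rewrite IH Lj_tr. Qed.

Lemma Lword_channel z s : channel (Lword z s).
Proof. by have [l p] := Lword_posmap z s; split => // X; exact: Lword_tr. Qed.

Lemma Nword_posmap s : posmap (Nword s).
Proof.
elim/last_ind: s => [|s j IH]; first exact: posmap_id.
have -> : Nword (rcons s j) = Nj j \o Nword s.
  by apply/funext => X; rewrite /Nword foldl_rcons.
exact: posmap_comp (Nj_posmap j) IH.
Qed.

Lemma Lword_dominated z s : dominated (Lword z s) (Nword s).
Proof.
elim/last_ind: s => [|s j IH]; first exact: dominated_id.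
have -> : Nword (rcons s j) = Nj j \o Nword s.
  by apply/funext => X; rewrite /Nword foldl_rcons.
have -> : Lword z (rcons s j) = Lj S z j \o Lword z s.
  by apply/funext => X; rewrite /Lword foldl_rcons.
exact: dominated_comp (Lj_posmap z j) (Nword_posmap s) (Lj_dominated z j) IH.
Qed.

Lemma Nword_dominated z s : dominated (Nword s) (Lword z s).
Proof.
elim/last_ind: s => [|s j IH]; first exact: dominated_id.
have -> : Nword (rcons s j) = Nj j \o Nword s.
  by apply/funext => X; rewrite /Nword foldl_rcons.
have -> : Lword z (rcons s j) = Lj S z j \o Lword z s.
  by apply/funext => X; rewrite /Lword foldl_rcons.
exact: dominated_comp (Nj_posmap j) (Lword_posmap z s) (Nj_dominated z j) IH.
Qed.

(** The right-hand side does not mention [z]: the bound obtained at the point given by (ER) thereby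
    holds everywhere. *)
Lemma Lword_minorized z s : minorized (Lword z s) <-> minorized (Nword s).
Proof.
split.
  exact: dominated_minorized (Lword_posmap z s) (Nword_posmap s) (Lword_dominated z s).
exact: dominated_minorized (Nword_posmap s) (Lword_posmap z s) (Nword_dominated z s).
Qed.

Definition Nra (X : 'M[C]_dS) : 'M[C]_dS := (M%:R : C)^-1 *: \sum_(j < M) Nj j X.

Let MinvE : (M%:R : C)^-1 = (M%:R^-1 : R)%:C.
Proof. by rewrite fmorphV rmorph_nat. Qed.

Let Minv0 : (0 : R) <= M%:R^-1. Proof. by rewrite invr_ge0 ler0n. Qed.

Lemma Lra_posmap z : posmap (Lra S z).
Proof.
rewrite /Lra MinvE; apply: posmap_scale; first by rewrite ler0c.
by apply: posmap_sum => j; exact: Lj_posmap.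
Qed.

Lemma Nra_posmap : posmap Nra.
Proof.
rewrite /Nra MinvE; apply: posmap_scale; first by rewrite ler0c.
by apply: posmap_sum => j; exact: Nj_posmap.
Qed.

Lemma Lra_minorized z : minorized (Lra S z) <-> minorized Nra.
Proof.
have d1 : dominated (Lra S z) Nra.
  rewrite /Lra /Nra MinvE; apply: (dominated_scale Minv0).
  by apply: dominated_sum => j; [exact: Nj_posmap | exact: Lj_dominated].
have d2 : dominated Nra (Lra S z).
  rewrite /Lra /Nra MinvE; apply: (dominated_scale Minv0).
  by apply: dominated_sum => j; [exact: Lj_posmap | exact: Nj_dominated].
split; first exact: dominated_minorized (Lra_posmap z) Nra_posmap d1.
exact: dominated_minorized Nra_posmap (Lra_posmap z) d2.
Qed.

Lemma Lra_channel z : (0 < M)%N -> channel (Lra S z).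
Proof.
move=> M0; have [l p] := Lra_posmap z; split => // X.
rewrite /Lra mxtraceZ raddf_sum /=; under eq_bigr => j _ do rewrite Lj_tr.
rewrite sumr_const card_ord; have -> : \tr X *+ M = M%:R * \tr X by rewrite mulr_natl.
by rewrite mulKf // pnatr_eq0 -lt0n.
Qed.

Lemma Ljd_dual z j X rho : \tr (Ljd S z j X *m rho) = \tr (X *m Lj S z j rho).
Proof.
rewrite mxtrace_mulC /Ljd /Lj !mxtr_ptr2 !mulmxA tensmx_mul mul1mx mulmx1.
by rewrite -[in LHS]mulmxA [LHS]mxtrace_mulC !mulmxA.
Qed.

Lemma Ldcomp_dual z s X rho :
  \tr (Ldcomp S z s X *m rho) = \tr (X *m Lword z s rho).
Proof. by elim: s rho => //= j s IH rho; rewrite Ljd_dual IH. Qed.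

Lemma Ldcomp_cat z s1 s2 X : Ldcomp S z (s1 ++ s2) X = Ldcomp S z s1 (Ldcomp S z s2 X).
Proof. exact: foldr_cat. Qed.

Lemma Lrad_dual z X rho : \tr (Lrad S z X *m rho) = \tr (X *m Lra S z rho).
Proof.
rewrite /Lrad /Lra -scalemxAl -scalemxAr !mxtraceZ mulmx_suml mulmx_sumr !raddf_sum /=.
by congr (_ * _); apply: eq_bigr => j _; rewrite Ljd_dual.
Qed.

End RIS.
Arguments Nj {R M} S j X.
Arguments Lword {R M} S z s X.
Arguments Nword {R M} S s X.
Arguments Nra {R M} S X.

(** * Time reversal *)

Section Reversal.
Variable R : realType.
Local Notation C := (R[i]).

(* [X |-> th X^* th^-1] for the antiunitary [th x = W conj(x)]; unlike [X |-> th X th^-1]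
   it is linear, at the price of reversing products. *)
Definition Theta n (W X : 'M[C]_n) : 'M[C]_n := W *m X^T *m adjmx W.

Lemma mulmx_cV_inj m n (A B : 'M[C]_(m, n)) :
  (forall x : 'cV[C]_n, A *m x = B *m x) -> A = B.
Proof.
move=> H; apply/matrixP => i j.
by have := congr1 (fun Z : 'cV[C]_m => Z i 0) (H (delta_mx j 0)); rewrite -!colE !mxE.
Qed.

(** An antilinear map is a matrix composed with entrywise conjugation; its columns are the images of
    an orthonormal basis, hence orthonormal. *)
Lemma antiunitary_mx n (th : 'cV[C]_n -> 'cV[C]_n) : antiunitary th ->
  let W := \matrix_(i, a) th (basis_vec R a) i 0 in
  [/\ adjmx W *m W = 1%:M, W *m adjmx W = 1%:M & forall x, th x = W *m map_mx conjc x].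
Proof.
move=> [lth ith] W.
have WW : adjmx W *m W = 1%:M.
  apply/matrixP => a b.
  have -> : (adjmx W *m W) a b = inner (th (basis_vec R a)) (th (basis_vec R b)).
    rewrite /inner !mxE; apply: eq_bigr => i _; by rewrite !mxE.
  rewrite ith; have -> : inner (basis_vec R a) (basis_vec R b) = (b == a)%:R.
    by rewrite /inner /basis_vec -colE mxE adjmxE mxE eqxx andbT conjc_nat.
  by rewrite conjc_nat mxE eq_sym.
split => //; first exact: mulmx1C.
have th0 : th 0 = 0.
  by have := lth (- 1) 0 0; rewrite scaler0 addr0 rmorphN1 scaleN1r addNr.
move=> x; have -> : x = \sum_a x a 0 *: basis_vec R a.
  rewrite [LHS]matrix_sum_delta; apply: eq_bigr => i _; by rewrite big_ord1.
have -> : th (\sum_a x a 0 *: basis_vec R a) = \sum_a conjc (x a 0) *: th (basis_vec R a).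
  elim/big_rec2: _ => [|a u v _ <-]; first exact: th0.
  by rewrite lth.
apply/matrixP => i j; rewrite (ord1 j) mxE summxE; apply: eq_bigr => a _.
rewrite !mxE mulrC; congr (_ * conjc _); rewrite summxE (bigD1 a) //= big1 ?addr0.
  by rewrite !mxE !eqxx mulr1.
by move=> b ba; rewrite !mxE eq_sym (negPf ba) mulr0.
Qed.

(** Commutation reads W conj(A) = A W, and conj(A) is the transpose of A for hermitian A. *)
Lemma commutes_Theta n (W A : 'M[C]_n) : W *m adjmx W = 1%:M -> Defs.hermitian A ->
  (forall x : 'cV[C]_n, W *m map_mx conjc (A *m x) = A *m (W *m map_mx conjc x)) ->
  Theta W A = A.
Proof.
move=> WW hA H; have cA : map_mx conjc A = A^T.
  by rewrite -{2}hA /adjmx trmxK.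
have E : W *m A^T = A *m W.
  apply: mulmx_cV_inj => y; have := H (map_mx conjc y).
  have -> : map_mx conjc (map_mx conjc y) = y.
    by apply/matrixP => i j; rewrite !mxE conjcK.
  rewrite map_mxM cA.
  have -> : map_mx conjc (map_mx conjc y) = y.
    by apply/matrixP => i j; rewrite !mxE conjcK.
  by rewrite !mulmxA.
by rewrite /Theta E -mulmxA WW mulmx1.
Qed.

Lemma tens_anti_mx m n (th1 : 'cV[C]_m -> 'cV[C]_m) (th2 : 'cV[C]_n -> 'cV[C]_n) v :
  tens_anti th1 th2 v =
  ((\matrix_(i, a) th1 (basis_vec R a) i 0) *t (\matrix_(i, a) th2 (basis_vec R a) i 0))
    *m map_mx conjc v.
Proof.
apply/matrixP => i j; rewrite (ord1 j) mxE sum_mxtens /tens_anti summxE.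
apply: eq_bigr => a _; rewrite summxE; apply: eq_bigr => e _.
by rewrite !mxE mxtens_indexK /= !ord1 mulrC.
Qed.

Lemma pos_trmx n (A : 'M[C]_n) : pos A -> pos A^T.
Proof.
move=> /pos_sqrt[X ->]; rewrite trmx_mul.
have -> : (adjmx X)^T *m X^T = map_mx conjc X *m adjmx (map_mx conjc X).
  by congr (_ *m _); apply/matrixP => i j; rewrite !mxE ?conjcK.
exact: pos_mulmx_adj.
Qed.

Section Theta.
Variables (n : nat) (W : 'M[C]_n).
Hypothesis WW : adjmx W *m W = 1%:M.
Hypothesis WW' : W *m adjmx W = 1%:M.

Lemma ThetaM X Y : Theta W (X *m Y) = Theta W Y *m Theta W X.
Proof.
rewrite /Theta trmx_mul !mulmxA; congr (_ *m _ *m _).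
by rewrite -(mulmxA _ (adjmx W)) WW mulmx1.
Qed.

Lemma Theta_tr X : \tr (Theta W X) = \tr X.
Proof. by rewrite /Theta mxtrace_mulC mulmxA WW mul1mx mxtrace_tr. Qed.

Lemma ThetaB X Y : Theta W (X - Y) = Theta W X - Theta W Y.
Proof. by rewrite /Theta linearB /= mulmxBr mulmxBl. Qed.

Lemma ThetaD X Y : Theta W (X + Y) = Theta W X + Theta W Y.
Proof. by rewrite /Theta linearD /= mulmxDr mulmxDl. Qed.

Lemma ThetaN X : Theta W (- X) = - Theta W X.
Proof. by rewrite /Theta linearN /= mulmxN mulNmx. Qed.

Lemma ThetaZ a X : Theta W (a *: X) = a *: Theta W X.
Proof. by rewrite /Theta linearZ /= -scalemxAr -scalemxAl. Qed.

Lemma Theta_sum I (r : seq I) F : Theta W (\sum_(i <- r) F i) = \sum_(i <- r) Theta W (F i).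
Proof. by rewrite /Theta raddf_sum /= mulmx_sumr mulmx_suml. Qed.

Lemma Theta1 : Theta W 1%:M = 1%:M.
Proof. by rewrite /Theta trmx1 mulmx1. Qed.

Lemma Theta_adj X : Theta W (adjmx X) = adjmx (Theta W X).
Proof.
rewrite /Theta !adjmxM adjmxK mulmxA; congr (_ *m _ *m _).
by apply/matrixP => i j; rewrite !mxE.
Qed.

Lemma Theta_surj X : exists Y, [/\ Theta W Y = X, \tr Y = \tr X & pos X -> pos Y].
Proof.
exists (adjmx W *m X *m W)^T; split.
- by rewrite /Theta trmxK !mulmxA WW' mul1mx -mulmxA WW' mulmx1.
- by rewrite mxtrace_tr mxtrace_mulC mulmxA WW' mul1mx.
- by move=> pX; apply: pos_trmx; rewrite -{2}(adjmxK W); exact: pos_congr.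
Qed.

End Theta.

Lemma Theta_tens m n (W A : 'M[C]_m) (V B : 'M[C]_n) :
  Theta (W *t V) (A *t B) = Theta W A *t Theta V B.
Proof. by rewrite /Theta trmx_tens adjmx_tens !tensmx_mul. Qed.

Lemma Theta_ptr2 m n (W : 'M[C]_m) (V : 'M[C]_n) X : adjmx V *m V = 1%:M ->
  Theta W (ptr2 X) = ptr2 (Theta (W *t V) X).
Proof. by move=> VV; rewrite /Theta (ptr2_congr _ _ VV) ptr2_trmx. Qed.

Lemma tens_unitary m n (W : 'M[C]_m) (V : 'M[C]_n) :
  adjmx W *m W = 1%:M -> adjmx V *m V = 1%:M -> adjmx (W *t V) *m (W *t V) = 1%:M.
Proof. by move=> WW VV; rewrite adjmx_tens tensmx_mul WW VV tensmx11. Qed.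

Lemma expm_imaginary_Theta n (W H : 'M[C]_n) (t : R) :
  adjmx W *m W = 1%:M -> W *m adjmx W = 1%:M -> Defs.hermitian H -> Theta W H = H ->
  Theta W (expm ((0 +i* t)%C *: H)) = expm ((0 +i* t)%C *: H).
Proof.
move=> WW WW' hH WH; rewrite /Theta.
apply: (@expm_trmx _ _ _ _ _ (fun x => (cos (t * x) +i* sin (t * x))%C)) => // x.
have -> : (0 +i* t)%C * x%:C = (0 +i* (t * x))%C.
  by apply/eqP; rewrite eq_complex /= !mul0r !mulr0 subr0 add0r !eqxx.
exact: has_cexp_imaginary.
Qed.

Lemma gibbs_Theta n (W H : 'M[C]_n) b :
  adjmx W *m W = 1%:M -> W *m adjmx W = 1%:M -> Defs.hermitian H -> Theta W H = H ->
  Theta W (gibbs H b) = gibbs H b.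
Proof.
move=> WW WW' hH WH; rewrite /gibbs ThetaZ; congr (_ *: _).
apply: (@expm_trmx _ _ _ _ _ (fun x => (expR (- b * x))%:C)) => // x.
rewrite -rmorphM; exact: has_cexp_real.
Qed.

End Reversal.

(** * Time reversal and detailed balance for the reduced maps *)

Section ReversibleRIS.
Variables (R : realType) (M : nat) (S : RIS R M).
Hypothesis wfS : RIS_wf S.
Local Notation C := (R[i]).
Local Notation dS := (dS S).
Local Notation dE := (dE S).
Local Notation U := (Uj S).
Local Notation "\1" := (1%:M) (at level 0).

(** Matrix form of what (TRI) implies. [U j] is fixed, although conjugation by an antiunitary
    inverts it, because [Theta] also takes an adjoint. *)
Definition reversal (W : 'M[C]_dS) (V : forall j, 'M[C]_(dE j)) :=
  [/\ adjmx W *m W = 1%:M, W *m adjmx W = 1%:M &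
  forall j, [/\ adjmx (V j) *m V j = 1%:M, Theta (W *t V j) (U j) = U j,
     Theta (V j) (HE S j) = HE S j & forall z, Theta (V j) (rhoE S z j) = rhoE S z j]].

Lemma TRI_reversal : TRI S -> exists W V, reversal W V.
Proof.
move=> [th [thE [uth _ cth HthE]]].
have [WW WW' thW] := antiunitary_mx uth.
set W := \matrix_(i, a) _ in WW WW' thW.
exists W, (fun j => \matrix_(i, a) thE j (basis_vec R a) i 0); split => // j.
have [uE _ cE cV] := HthE j; have [VV VV' thV] := antiunitary_mx uE.
set V := \matrix_(i, a) _ in VV VV' thV *.
have [hS [hE hV]] : [/\ Defs.hermitian (HS S), Defs.hermitian (HE S j) & Defs.hermitian (Vint S j)].
  by case: wfS => _ [_ [? [? [? _]]]].
have TS : Theta W (HS S) = HS S.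
  by apply: commutes_Theta => // x; rewrite -!thW; exact: cth.
have TE : Theta V (HE S j) = HE S j.
  by apply: commutes_Theta => // x; rewrite -!thV; exact: cE.
have WVu := tens_unitary WW VV.
have WVu' := mulmx1C WVu.
have TV : Theta (W *t V) (Vint S j) = Vint S j.
  by apply: commutes_Theta => // x; rewrite -!tens_anti_mx; exact: cV.
split => //; last by move=> z; exact: gibbs_Theta.
apply: expm_imaginary_Theta => //; first exact: Hj_hermitian.
by rewrite /Hj !ThetaD !Theta_tens TS TE TV !Theta1.
Qed.

Section WithReversal.
Variables (W : 'M[C]_dS) (V : forall j, 'M[C]_(dE j)).
Hypothesis WV : reversal W V.

Let WW : adjmx W *m W = 1%:M. Proof. by case: WV. Qed.
Let WW' : W *m adjmx W = 1%:M. Proof. by case: WV. Qed.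
Let VV j : adjmx (V j) *m V j = 1%:M. Proof. by case: WV => _ _ /(_ j) []. Qed.
Let VV' j : V j *m adjmx (V j) = 1%:M. Proof. exact/mulmx1C. Qed.
Let TU j : Theta (W *t V j) (U j) = U j. Proof. by case: WV => _ _ /(_ j) []. Qed.
Let TE j : Theta (V j) (HE S j) = HE S j. Proof. by case: WV => _ _ /(_ j) []. Qed.
Let Trho z j : Theta (V j) (rhoE S z j) = rhoE S z j.
Proof. by case: WV => _ _ /(_ j) []. Qed.
Let WVu j : adjmx (W *t V j) *m (W *t V j) = 1%:M. Proof. exact: tens_unitary. Qed.
Let TUadj j : Theta (W *t V j) (adjmx (U j)) = adjmx (U j).
Proof. by rewrite Theta_adj TU. Qed.

(** [Theta] reverses the product and so swaps [U] with its adjoint. The environment factor being the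
    identity, cyclicity of the trace then moves both onto Y and rebuilds [Nj]. *)
Lemma Nj_dual j A Y : \tr (Theta W (Nj S j A) *m Y) = \tr (Theta W A *m Nj S j Y).
Proof.
rewrite /Nj (Theta_ptr2 _ _ (VV j)) !(ThetaM (WVu j)) TU TUadj Theta_tens (Theta1 (VV' j)).
rewrite mxtrace_mulC !mxtr_ptr2 !mulmxA.
by rewrite -[in LHS]mulmxA [LHS]mxtrace_mulC !mulmxA.
Qed.

Lemma Nword_dual s A B :
  \tr (B *m Nword S s A) = \tr (Theta W A *m Nword S (rev s) (Theta W B)).
Proof.
elim: s A => [|j s IH] A.
  by rewrite -(ThetaM WW) Theta_tr.
by rewrite /= IH Nj_dual rev_cons /Nword foldl_rcons.
Qed.

Lemma Nword_iter s k A : iter k (Nword S s) A = Nword S (flatten (nseq k s)) A.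
Proof. by elim: k A => // k IH A; rewrite iterSr IH /= /Nword foldl_cat. Qed.

Lemma rev_flatten_nseq (T : Type) (s : seq T) k :
  rev (flatten (nseq k s)) = flatten (nseq k (rev s)).
Proof.
elim: k => // k IH; rewrite -addn1 !nseqD !flatten_cat /= !cats0 rev_cat IH.
by elim: k {IH} => [|k IH] /=; rewrite ?cats0 // -catA -IH.
Qed.

(** Time reversal exchanges A and B in the pairing while reversing the word, and the lower bound c
    tr A tr B is symmetric in them. *)
Lemma Nword_rev_minorized s : minorized (Nword S s) -> minorized (Nword S (rev s)).
Proof.
move=> [k [c [c0 H]]]; exists k, c; split; first exact: c0.
move=> A B pA pB.
have [A' [AE tA /(_ pA) pA']] := Theta_surj WW' A.
have [B' [BE tB /(_ pB) pB']] := Theta_surj WW' B.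
have := H _ _ pB' pA'; rewrite !Nword_iter Nword_dual rev_flatten_nseq AE BE tA tB.
by rewrite [\tr B * _]mulrC.
Qed.

(** [Theta] fixes the environment energy and the Gibbs state but exchanges Heisenberg evolution with
    its inverse; the sign comes from the conventions for the two fluxes. *)
Lemma Theta_Phi z j : Theta W (Phi S z j) = - Phirev S z j.
Proof.
rewrite /Phi /Phirev ThetaN ThetaZ; congr (- (_ *: _)).
rewrite (Theta_ptr2 _ _ (VV j)) !(ThetaM (WVu j)) ThetaB !(ThetaM (WVu j)).
by rewrite TU TUadj !Theta_tens (Theta1 WW') TE Trho mulmxA ptr2_cycle.
Qed.

Lemma Theta_Phirev z j : Theta W (Phirev S z j) = - Phi S z j.
Proof.
rewrite /Phi /Phirev opprK ThetaZ; congr (_ *: _).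
rewrite (Theta_ptr2 _ _ (VV j)) !(ThetaM (WVu j)) ThetaB !(ThetaM (WVu j)).
by rewrite TU TUadj !Theta_tens (Theta1 WW') TE Trho mulmxA ptr2_cycle.
Qed.

Section Equilibrium.
Variable rho0 : 'M[C]_dS.
Hypothesis inv0 : forall j,
  U j *m (rho0 *t rhoE S 0 j) *m adjmx (U j) = rho0 *t rhoE S 0 j.

Lemma equilibrium_comm j : U j *m (rho0 *t rhoE S 0 j) = rho0 *t rhoE S 0 j *m U j.
Proof. by rewrite -{2}(inv0 j) -!mulmxA (UadjU wfS) mulmx1. Qed.

(** Applying [Theta] to the commutation of [U j] with the joint equilibrium state gives the
    invariance of the reversed state. Uniqueness of fixed points will then identify it with
    [rho0]. *)
Lemma Theta_equilibrium j : Lj S 0 j (Theta W rho0) = Theta W rho0.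
Proof.
rewrite /Lj -(Trho 0 j) -Theta_tens -(TUadj j) -{1}(TU j).
rewrite -!(ThetaM (WVu j)) -(Theta_ptr2 _ _ (VV j)) -equilibrium_comm.
by rewrite mulmxA (UadjU wfS) mul1mx ptr2_tens (rhoE_tr wfS) scale1r.
Qed.

End Equilibrium.
End WithReversal.

(** The dual map of the dynamics run backwards: [Ljd] with [U j] and its adjoint exchanged. *)
Definition Ljdrev z j (Y : 'M[C]_dS) : 'M[C]_dS :=
  ptr2 (((\1 : 'M[C]_dS) *t rhoE S z j) *m U j *m (Y *t (\1 : 'M[C]_(dE j))) *m adjmx (U j)).

Lemma Theta_Ljdrev W V z j Y : reversal W V ->
  Theta W (Ljdrev z j Y) = Ljd S z j (Theta W Y).
Proof.
move=> [WW _ /(_ j)[VV TU _ TR]]; have WVu := tens_unitary WW VV.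
rewrite /Ljdrev /Ljd (Theta_ptr2 _ _ VV) !(ThetaM WVu) Theta_adj TU !Theta_tens.
rewrite !Theta1 ?TR; [|exact: mulmx1C|exact: mulmx1C].
by rewrite -!mulmxA ptr2_cycle !mulmxA.
Qed.

Section DetailedBalance.
Variable rho0 : 'M[C]_dS.
Hypothesis inv0 : forall j,
  U j *m (rho0 *t rhoE S 0 j) *m adjmx (U j) = rho0 *t rhoE S 0 j.

(** Y rho0 (x) rhoE is Y (x) 1 times the joint equilibrium state. That state commutes with the
    propagator, so [rho0] can be pulled out of the partial trace on the right. Detailed balance is
    this identity paired with X. *)
Lemma Lj_equilibrium j Y : Lj S 0 j (Y *m rho0) = Ljdrev 0 j Y *m rho0.
Proof.
have eqc : (rho0 *t rhoE S 0 j) *m adjmx (U j) = adjmx (U j) *m (rho0 *t rhoE S 0 j).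
  by rewrite -[in RHS](inv0 j) 2!mulmxA (UadjU wfS) mul1mx.
have split1 : (Y *m rho0) *t rhoE S 0 j = (Y *t \1) *m (rho0 *t rhoE S 0 j).
  by rewrite tensmx_mul mul1mx.
have split2 : rho0 *t rhoE S 0 j = (\1 *t rhoE S 0 j) *m (rho0 *t \1).
  by rewrite tensmx_mul mul1mx mulmx1.
rewrite /Lj split1 -(mulmxA (U j)) -(mulmxA (Y *t \1)) eqc 2!mulmxA split2.
rewrite mulmxA ptr2_mulr -ptr2_cycle /Ljdrev.
by rewrite !mulmxA.
Qed.

Lemma detailed_balance j X Y :
  \tr (rho0 *m (Ljd S 0 j X *m Y)) = \tr (rho0 *m (X *m Ljdrev 0 j Y)).
Proof.
rewrite mxtrace_mulC -mulmxA Ljd_dual Lj_equilibrium.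
by rewrite mulmxA mxtrace_mulC.
Qed.

Definition Ldrevcomp s Y := foldr (fun k Y => Ljdrev 0 k Y) Y s.

Lemma detailed_balance_word s X Y :
  \tr (rho0 *m (Ldcomp S 0 s X *m Y)) = \tr (rho0 *m (X *m Ldrevcomp (rev s) Y)).
Proof.
elim: s Y => [|j s IH] Y; first by [].
rewrite [Ldcomp _ _ _ _]/= detailed_balance IH rev_cons.
by rewrite /Ldrevcomp foldr_rcons.
Qed.

Definition Lradrev (Y : 'M[C]_dS) := (M%:R : C)^-1 *: \sum_(j < M) Ljdrev 0 j Y.

Lemma detailed_balance_ra n X Y :
  \tr (rho0 *m (iter n (Lrad S 0) X *m Y)) = \tr (rho0 *m (X *m iter n Lradrev Y)).
Proof.
elim: n Y => [|n IH] Y; first by [].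
rewrite iterS [in RHS]iterSr -IH /Lrad /Lradrev.
rewrite -scalemxAl -!scalemxAr !mxtraceZ; congr (_ * _).
rewrite mulmx_suml !mulmx_sumr !raddf_sum; apply: eq_bigr => j _.
exact: detailed_balance.
Qed.

Variables (W : 'M[C]_dS) (V : forall j, 'M[C]_(dE j)).
Hypothesis WV : reversal W V.
Hypothesis Wrho : Theta W rho0 = rho0.

Let WW : adjmx W *m W = 1%:M. Proof. by case: WV. Qed.

Lemma Theta_Ldrevcomp s Y : Theta W (Ldrevcomp s Y) = Ldcomp S 0 s (Theta W Y).
Proof. by elim: s => //= j s <-; rewrite (Theta_Ljdrev _ _ _ WV). Qed.

Lemma Theta_Lradrev n Y : Theta W (iter n Lradrev Y) = iter n (Lrad S 0) (Theta W Y).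
Proof.
elim: n => [|n IH]; first by [].
rewrite 2!iterS -IH /Lradrev ThetaZ Theta_sum; congr (_ *: _).
by apply: eq_bigr => j _; rewrite (Theta_Ljdrev _ _ _ WV).
Qed.

Lemma Ljd_opp j Y : Ljd S 0 j (- Y) = - Ljd S 0 j Y.
Proof.
by rewrite /Ljd -ptr2N -scaleN1r tensmxZl -scalemxAr -scalemxAl scaleN1r.
Qed.

Lemma Ldcomp_opp s Y : Ldcomp S 0 s (- Y) = - Ldcomp S 0 s Y.
Proof. by elim: s => //= j s ->; rewrite Ljd_opp. Qed.

Lemma Lrad_opp n Y : iter n (Lrad S 0) (- Y) = - iter n (Lrad S 0) Y.
Proof.
elim: n => //= n ->; rewrite /Lrad -scalerN -sumrN; congr (_ *: _).
by apply: eq_bigr => j _; rewrite Ljd_opp.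
Qed.

(** The word is reversed twice in meaning, once by duality and once by [Theta]; the minus signs of
    the two exchanged fluxes cancel. *)
Lemma onsager_word s j k :
  \tr (rho0 *m (Ldcomp S 0 s (Phi S 0 j) *m Phirev S 0 k)) =
  \tr (rho0 *m (Ldcomp S 0 (rev s) (Phi S 0 k) *m Phirev S 0 j)).
Proof.
rewrite detailed_balance_word -(Theta_tr WW) !(ThetaM WW) Wrho.
rewrite Theta_Ldrevcomp (Theta_Phirev WV) (Theta_Phi WV) Ldcomp_opp.
by rewrite mulmxN !mulNmx opprK mxtrace_mulC.
Qed.

Lemma onsager_ra n j k :
  \tr (rho0 *m (iter n (Lrad S 0) (Phi S 0 j) *m Phirev S 0 k)) =
  \tr (rho0 *m (iter n (Lrad S 0) (Phi S 0 k) *m Phirev S 0 j)).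
Proof.
rewrite detailed_balance_ra -(Theta_tr WW) !(ThetaM WW) Wrho.
rewrite Theta_Lradrev (Theta_Phirev WV) (Theta_Phi WV) Lrad_opp.
by rewrite mulmxN !mulNmx opprK mxtrace_mulC.
Qed.

End DetailedBalance.
End ReversibleRIS.

(** * Smooth functions on R^M *)

Section Smooth.
Variables (R : realType) (M : nat).
Local Notation C := (R[i]).
Local Open Scope classical_set_scope.
Implicit Types f g : 'rV[R]_M -> R.

Lemma cont_cst (c : R) : continuous (fun _ : 'rV[R]_M => c).
Proof. exact: cst_continuous. Qed.

Lemma contD f g : continuous f -> continuous g -> continuous (fun x => f x + g x).
Proof. by move=> cf cg x; apply: continuousD; [exact: cf | exact: cg]. Qed.

Lemma contM f g : continuous f -> continuous g -> continuous (fun x => f x * g x).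
Proof. by move=> cf cg x; apply: continuousM; [exact: cf | exact: cg]. Qed.

Lemma contV f : (forall x, f x != 0) -> continuous f -> continuous (fun x => (f x)^-1).
Proof. by move=> f0 cf x; apply: continuousV; [exact: f0 | exact: cf]. Qed.

(** Differentiability is graded by order so that product and inverse rules go by induction;
    [smoothR] follows once all orders hold. *)
Fixpoint Ck (n : nat) f : Prop :=
  continuous f /\
  if n is n'.+1 then forall k, (forall x, derivable f x (ecoord R k)) /\
                               Ck n' (fun x => derive f x (ecoord R k))
  else True.

Lemma CkW n f : Ck n.+1 f -> Ck n f.
Proof.
elim: n f => [|n IH] f [cf H]; first by [].
by split => // k; have [d /IH] := H k.
Qed.

Lemma Ck_cont n f : Ck n f -> continuous f.
Proof. by case: n => [|n] []. Qed.

Lemma Ck_cst n c : Ck n (fun=> c).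
Proof.
elim: n c => [|n IH] c; first by split; [exact: cont_cst|].
split=> [|k]; first exact: cont_cst.
split=> [x|]; first exact: derivable_cst.
have -> : (fun x : 'rV[R]_M => derive (fun=> c) x (ecoord R k)) = fun=> 0.
  by apply/funext => x; exact: derive_cst.
exact: IH.
Qed.

Lemma CkD n f g : Ck n f -> Ck n g -> Ck n (fun x => f x + g x).
Proof.
elim: n f g => [|n IH] f g Hf Hg.
  by split; [apply: contD; [exact: (Ck_cont Hf) | exact: (Ck_cont Hg)]|].
split=> [|k]; first by apply: contD; [exact: (Ck_cont Hf) | exact: (Ck_cont Hg)].
case: Hf Hg => [_ /(_ k)[df Hf]] [_ /(_ k)[dg Hg]].
split=> [x|]; first exact: derivableD.
have -> : (fun x => derive (fun y => f y + g y) x (ecoord R k)) =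
    fun x => derive f x (ecoord R k) + derive g x (ecoord R k).
  by apply/funext => x; exact: deriveD.
exact: IH.
Qed.

Lemma derive_mul f g x v : derivable f x v -> derivable g x v ->
  derive (fun y => f y * g y) x v = f x * derive g x v + g x * derive f x v.
Proof. exact: deriveM. Qed.

Lemma derive_sub f g x v : derivable f x v -> derivable g x v ->
  derive (fun y => f y - g y) x v = derive f x v - derive g x v.
Proof. exact: deriveB. Qed.

Lemma derive_add f g x v : derivable f x v -> derivable g x v ->
  derive (fun y => f y + g y) x v = derive f x v + derive g x v.
Proof. exact: deriveD. Qed.

Lemma derivable_mul f g x v : derivable f x v -> derivable g x v ->
  derivable (fun y => f y * g y) x v.
Proof. exact: derivableM. Qed.

Lemma CkM n f g : Ck n f -> Ck n g -> Ck n (fun x => f x * g x).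
Proof.
elim: n f g => [|n IH] f g Hf Hg.
  by split; [apply: contM; [exact: (Ck_cont Hf) | exact: (Ck_cont Hg)]|].
split=> [|k]; first by apply: contM; [exact: (Ck_cont Hf) | exact: (Ck_cont Hg)].
(* The Leibniz formula contains [f] and [g] themselves, which the induction needs at the lower
   order. *)
have [Wf Wg] := (CkW Hf, CkW Hg).
case: Hf Hg => [_ /(_ k)[df Hf]] [_ /(_ k)[dg Hg]].
split=> [x|]; first exact: derivableM.
have -> : (fun x => derive (fun y => f y * g y) x (ecoord R k)) =
    fun x => f x * derive g x (ecoord R k) + g x * derive f x (ecoord R k).
  by apply/funext => x; exact: derive_mul.
by apply: CkD; exact: IH.
Qed.

Lemma CkV n f : (forall x, f x != 0) -> Ck n f -> Ck n (fun x => (f x)^-1).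
Proof.
move=> f0; elim: n f f0 => [|n IH] f f0 Hf.
  by split; [apply: contV f0 _; exact: (Ck_cont Hf)|].
split=> [|k]; first by apply: contV f0 _; exact: (Ck_cont Hf).
have /(IH _ f0) Wf := CkW Hf.
case: Hf => [_ /(_ k)[df Hf]].
split=> [x|]; first exact: derivableV.
have -> : (fun x => derive (fun y => (f y)^-1) x (ecoord R k)) =
    fun x => (-1 * ((f x)^-1 * (f x)^-1)) * derive f x (ecoord R k).
  apply/funext => x; rewrite deriveV // /GRing.scale /= mulN1r.
  by rewrite expr2 invfM.
apply: CkM => //; apply: CkM; first exact: Ck_cst.
exact: CkM.
Qed.

Lemma is_derive_expR_coord (a b : R) (j : 'I_M) x v :
  is_derive x v (fun y : 'rV[R]_M => expR (a + b * y 0 j))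
    (b * v 0 j * expR (a + b * x 0 j)).
Proof.
pose h0 := a + b * x 0 j; pose c := b * v 0 j.
have H : is_derive (0 : R) 1 (fun t : R => expR (h0 + c * t)) (c * expR (h0 + c * 0)).
  have H1 : is_derive (0 : R) 1 (fun t : R => h0 + c * t) c.
    apply: is_derive_eq; rewrite /GRing.scale /=; ring.
  have := @is_derive1_comp R expR (fun t => h0 + c * t) 0 _ _ (is_derive_expR (h0 + c * 0)) H1.
  by rewrite mulrC.
(* Along the line through [x] in direction [v] the difference quotients are those of a one-variable
   exponential. *)
have E : (fun h : R => h^-1 *: (((fun y : 'rV[R]_M => expR (a + b * y 0 j)) \o shift x) (h *: v)
        - expR (a + b * x 0 j))) =
    (fun h : R => h^-1 *: (((fun t : R => expR (h0 + c * t)) \o shift 0) (h *: 1)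
        - expR (h0 + c * 0))).
  apply/funext => h /=; congr (_ *: (expR _ - expR _)).
    by rewrite !mxE /h0 /c /GRing.scale /=; ring.
  by rewrite mulr0 addr0.
case: H => [d dE]; apply: DeriveDef; rewrite /derivable /derive E; first exact: d.
by move: dE; rewrite /derive => ->; rewrite mulr0 addr0.
Qed.

Lemma Ck_expR n (a b : R) j : Ck n (fun x => expR (a + b * x 0 j)).
Proof.
have cnt : continuous (fun x : 'rV[R]_M => expR (a + b * x 0 j)).
  have ch : continuous (fun x : 'rV[R]_M => a + b * x 0 j).
    by apply: contD; [exact: cont_cst | apply: contM; [exact: cont_cst | exact: coord_continuous]].
  by move=> x; apply: (continuous_comp (ch x)); exact: continuous_expR.
elim: n => [|n IH]; first by split.
split => // k; split => [x|].
  by have [] := is_derive_expR_coord a b j x (ecoord R k).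
have -> : (fun x => derive (fun y : 'rV[R]_M => expR (a + b * y 0 j)) x (ecoord R k)) =
    fun x => (b * ecoord R k 0 j) * expR (a + b * x 0 j).
  by apply/funext => x; have [_ ->] := is_derive_expR_coord a b j x (ecoord R k).
by apply: CkM => //; exact: Ck_cst.
Qed.

Lemma Ck_smooth f : (forall n, Ck n f) -> smoothR f.
Proof.
(* [iter_partial] folds from the right, so the last index is the first derivative taken. *)
move=> Hf ks; move: f Hf; elim/last_ind: ks => [|ks k IH] f Hf x.
  split=> [k|]; last exact: (Ck_cont (Hf 0%N)).
  by have [_ /(_ k)[]] := Hf 1%N.
rewrite /iter_partial foldr_rcons; apply: IH => n.
by have [_ /(_ k)[]] := Hf n.+1.
Qed.

Lemma Re_mul_fun (F G : 'rV[R]_M -> C) : (fun x => complex.Re (F x * G x)) =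
  fun x => complex.Re (F x) * complex.Re (G x) - complex.Im (F x) * complex.Im (G x).
Proof. by apply/funext => x; rewrite complex_ReM. Qed.

Lemma Im_mul_fun (F G : 'rV[R]_M -> C) : (fun x => complex.Im (F x * G x)) =
  fun x => complex.Re (F x) * complex.Im (G x) + complex.Im (F x) * complex.Re (G x).
Proof. by apply/funext => x; rewrite complex_ImM. Qed.

Lemma Re_add_fun (F G : 'rV[R]_M -> C) : (fun x => complex.Re (F x + G x)) =
  fun x => complex.Re (F x) + complex.Re (G x).
Proof. by apply/funext => x; rewrite complex_ReD. Qed.

Lemma Im_add_fun (F G : 'rV[R]_M -> C) : (fun x => complex.Im (F x + G x)) =
  fun x => complex.Im (F x) + complex.Im (G x).
Proof. by apply/funext => x; rewrite complex_ImD. Qed.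

Definition csmooth (F : 'rV[R]_M -> C) :=
  (forall n, Ck n (fun x => complex.Re (F x))) /\
  (forall n, Ck n (fun x => complex.Im (F x))).

(** At the origin this is [pderiv0] by conversion. *)
Definition cpd k (F : 'rV[R]_M -> C) (x : 'rV[R]_M) : C :=
  (derive (fun z => complex.Re (F z)) x (ecoord R k) +i*
   derive (fun z => complex.Im (F z)) x (ecoord R k))%C.

Lemma CkN n f : Ck n f -> Ck n (fun x => - f x).
Proof.
move=> H; have := CkM (Ck_cst n (- 1)) H.
by congr Ck; apply/funext => x; rewrite mulN1r.
Qed.

Lemma csmooth_cst c : csmooth (fun=> c).
Proof. by split => n; exact: Ck_cst. Qed.

Lemma csmooth_real f : (forall n, Ck n f) -> csmooth (fun x => (f x)%:C).
Proof. by move=> H; split => n /=; [exact: H | exact: Ck_cst]. Qed.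

Lemma csmoothD F G : csmooth F -> csmooth G -> csmooth (fun x => F x + G x).
Proof.
move=> [F1 F2] [G1 G2]; split => n.
  by rewrite Re_add_fun; exact: CkD.
by rewrite Im_add_fun; exact: CkD.
Qed.

Lemma csmoothM F G : csmooth F -> csmooth G -> csmooth (fun x => F x * G x).
Proof.
move=> [F1 F2] [G1 G2]; split => n.
  by rewrite Re_mul_fun; apply: CkD; [|apply: CkN]; exact: CkM.
by rewrite Im_mul_fun; apply: CkD; exact: CkM.
Qed.

Lemma csmoothV F : (forall x, F x != 0) -> csmooth F -> csmooth (fun x => (F x)^-1).
Proof.
move=> F0 [F1 F2].
pose q x := complex.Re (F x) * complex.Re (F x) + complex.Im (F x) * complex.Im (F x).
have q0 x : q x != 0.
  apply: contra (F0 x); rewrite /q; case: (F x) => a b /=.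
  rewrite -!expr2 paddr_eq0 ?sqr_ge0 // !sqrf_eq0 => /andP[/eqP -> /eqP ->].
  by [].
have Cq n : Ck n (fun x => (q x)^-1).
  by apply: CkV => //; apply: CkD; exact: CkM.
have E x : (F x)^-1 = ((complex.Re (F x) * (q x)^-1) +i* (- complex.Im (F x) * (q x)^-1))%C.
  by rewrite /q -!expr2 mulNr; case: (F x).
split => n; under eq_fun do rewrite E /=; first exact: CkM.
by apply: CkM => //; exact: CkN.
Qed.

Lemma csmooth_sum I (r : seq I) (F : I -> 'rV[R]_M -> C) :
  (forall i, csmooth (F i)) -> csmooth (fun x => \sum_(i <- r) F i x).
Proof.
move=> H; elim: r => [|i r IH].
  by under eq_fun do rewrite big_nil; exact: csmooth_cst.
by under eq_fun do rewrite big_cons; exact: csmoothD.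
Qed.

Lemma csmooth_prod I (r : seq I) (F : I -> 'rV[R]_M -> C) :
  (forall i, csmooth (F i)) -> csmooth (fun x => \prod_(i <- r) F i x).
Proof.
move=> H; elim: r => [|i r IH].
  by under eq_fun do rewrite big_nil; exact: csmooth_cst.
by under eq_fun do rewrite big_cons; exact: csmoothM.
Qed.

Lemma csmooth_derivable F x k : csmooth F ->
  derivable (fun z => complex.Re (F z)) x (ecoord R k) /\
  derivable (fun z => complex.Im (F z)) x (ecoord R k).
Proof.
by move=> [/(_ 1%N)[_ /(_ k)[d1 _]] /(_ 1%N)[_ /(_ k)[d2 _]]]; split.
Qed.

Lemma cpd_cst k c x : cpd k (fun=> c) x = 0.
Proof. by rewrite /cpd !derive_cst. Qed.

Lemma cpdD k F G x : csmooth F -> csmooth G ->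
  cpd k (fun x => F x + G x) x = cpd k F x + cpd k G x.
Proof.
move=> /(csmooth_derivable x k)[f1 f2] /(csmooth_derivable x k)[g1 g2].
rewrite /cpd; rewrite Re_add_fun.
rewrite Im_add_fun.
by rewrite [X in (X +i* _)%C]deriveD // [X in (_ +i* X)%C]deriveD.
Qed.

Lemma cpdM k F G x : csmooth F -> csmooth G ->
  cpd k (fun x => F x * G x) x = cpd k F x * G x + F x * cpd k G x.
Proof.
move=> /(csmooth_derivable x k)[f1 f2] /(csmooth_derivable x k)[g1 g2].
apply/eqP; rewrite eq_complex /cpd; apply/andP; split; apply/eqP.
  rewrite complex_ReD !complex_ReM /=; rewrite Re_mul_fun.
  rewrite (derive_sub (derivable_mul f1 g1) (derivable_mul f2 g2)).
  by rewrite !derive_mul //; ring.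
rewrite complex_ImD !complex_ImM /=; rewrite Im_mul_fun.
rewrite (derive_add (derivable_mul f1 g2) (derivable_mul f2 g1)).
by rewrite !derive_mul //; ring.
Qed.

Lemma cpd_sum k I (r : seq I) (F : I -> 'rV[R]_M -> C) x : (forall i, csmooth (F i)) ->
  cpd k (fun x => \sum_(i <- r) F i x) x = \sum_(i <- r) cpd k (F i) x.
Proof.
move=> H; elim: r => [|i r IH].
  by under [X in cpd _ X]eq_fun do rewrite big_nil; rewrite cpd_cst big_nil.
under [X in cpd _ X]eq_fun do rewrite big_cons.
by rewrite cpdD // ?IH ?big_cons //; exact: csmooth_sum.
Qed.

Definition msmooth m n (F : 'rV[R]_M -> 'M[C]_(m, n)) := forall a b, csmooth (fun x => F x a b).

Definition mpd k m n (F : 'rV[R]_M -> 'M[C]_(m, n)) x : 'M[C]_(m, n) :=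
  \matrix_(a, b) cpd k (fun x => F x a b) x.

Lemma msmooth_smoothM m n (F : 'rV[R]_M -> 'M[C]_(m, n)) : msmooth F -> smoothM F.
Proof. by move=> H a b; have [h1 h2] := H a b; split; exact: Ck_smooth. Qed.

Lemma msmooth_cst m n (A : 'M[C]_(m, n)) : msmooth (fun=> A).
Proof. by move=> a b; exact: csmooth_cst. Qed.

Lemma msmoothD m n (F G : 'rV[R]_M -> 'M[C]_(m, n)) : msmooth F -> msmooth G ->
  msmooth (fun x => F x + G x).
Proof. by move=> f g a b; under eq_fun do rewrite mxE; exact: csmoothD. Qed.

Lemma msmoothM m n p (F : 'rV[R]_M -> 'M[C]_(m, n)) (G : 'rV[R]_M -> 'M[C]_(n, p)) :
  msmooth F -> msmooth G -> msmooth (fun x => F x *m G x).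
Proof.
move=> f g a b; under eq_fun do rewrite mxE.
by apply: csmooth_sum => i; exact: csmoothM.
Qed.

Lemma msmoothZ m n a (F : 'rV[R]_M -> 'M[C]_(m, n)) : csmooth a -> msmooth F ->
  msmooth (fun x => a x *: F x).
Proof. by move=> f g i j; under eq_fun do rewrite mxE; exact: csmoothM. Qed.

Lemma msmooth_tens m n p q (F : 'rV[R]_M -> 'M[C]_(m, n)) (G : 'rV[R]_M -> 'M[C]_(p, q)) :
  msmooth F -> msmooth G -> msmooth (fun x => F x *t G x).
Proof. by move=> f g a b; under eq_fun do rewrite mxE; exact: csmoothM. Qed.

Lemma msmooth_ptr2 m n (F : 'rV[R]_M -> 'M[C]_(m * n)) :
  msmooth F -> msmooth (fun x => ptr2 (F x)).
Proof. by move=> f a b; under eq_fun do rewrite mxE; exact: csmooth_sum. Qed.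

Lemma msmooth_sum m n I (r : seq I) (F : I -> 'rV[R]_M -> 'M[C]_(m, n)) :
  (forall i, msmooth (F i)) -> msmooth (fun x => \sum_(i <- r) F i x).
Proof.
move=> H a b; under eq_fun do rewrite summxE.
by apply: csmooth_sum => i; exact: H.
Qed.

Lemma csmooth_det n (F : 'rV[R]_M -> 'M[C]_n) : msmooth F -> csmooth (fun x => \det (F x)).
Proof.
move=> f; apply: csmooth_sum => s; apply: csmoothM; first exact: csmooth_cst.
exact: csmooth_prod.
Qed.

Lemma msmooth_invmx n (F : 'rV[R]_M -> 'M[C]_n) : msmooth F ->
  (forall x, F x \in unitmx) -> msmooth (fun x => invmx (F x)).
Proof.
move=> f u.
have -> : (fun x => invmx (F x)) = fun x => (\det (F x))^-1 *: \adj (F x).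
  by apply/funext => x; rewrite /invmx u.
apply: msmoothZ.
  by apply: csmoothV; [move=> x; rewrite -unitfE -unitmxE | exact: csmooth_det].
move=> a b; under eq_fun do rewrite mxE.
apply: csmoothM; first exact: csmooth_cst.
apply: csmooth_det => i j; under eq_fun do rewrite !mxE; exact: f.
Qed.

Lemma msmooth_fcalc n (P : 'M[C]_n) (d : 'rV[R]_n) (f : 'rV[R]_M -> R -> C) :
  (forall i, csmooth (f^~ (d 0 i))) -> msmooth (fun x => fcalc P d (f x)).
Proof.
move=> H; apply: msmoothM; last exact: msmooth_cst.
apply: msmoothM; first exact: msmooth_cst.
move=> a b; under eq_fun do rewrite !mxE.
by case: (a == b); [exact: H | exact: csmooth_cst].
Qed.

Lemma mpd_cst k m n (A : 'M[C]_(m, n)) x : mpd k (fun=> A) x = 0.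
Proof. by apply/matrixP => a b; rewrite !mxE cpd_cst. Qed.

Lemma mpdM k m n p (F : 'rV[R]_M -> 'M[C]_(m, n)) (G : 'rV[R]_M -> 'M[C]_(n, p)) x :
  msmooth F -> msmooth G ->
  mpd k (fun x => F x *m G x) x = mpd k F x *m G x + F x *m mpd k G x.
Proof.
move=> f g; apply/matrixP => a b; rewrite !mxE.
under [X in cpd _ X]eq_fun do rewrite mxE.
rewrite cpd_sum => [|i]; last exact: csmoothM.
rewrite -big_split; apply: eq_bigr => i _; rewrite !mxE.
exact: cpdM.
Qed.

Lemma mpd_tens k m n p q (F : 'rV[R]_M -> 'M[C]_(m, n)) (G : 'rV[R]_M -> 'M[C]_(p, q)) x :
  msmooth F -> msmooth G ->
  mpd k (fun x => F x *t G x) x = mpd k F x *t G x + F x *t mpd k G x.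
Proof.
move=> f g; apply/matrixP => a b; rewrite !mxE.
under [X in cpd _ X]eq_fun do rewrite mxE.
exact: cpdM.
Qed.

Lemma mpd_ptr2 k m n (F : 'rV[R]_M -> 'M[C]_(m * n)) x : msmooth F ->
  mpd k (fun x => ptr2 (F x)) x = ptr2 (mpd k F x).
Proof.
move=> f; apply/matrixP => a b; rewrite !mxE.
under [X in cpd _ X]eq_fun do rewrite mxE.
rewrite cpd_sum // => *; apply: eq_bigr => e _; by rewrite mxE.
Qed.

Lemma mpdZ k m n a (F : 'rV[R]_M -> 'M[C]_(m, n)) x : msmooth F ->
  mpd k (fun x => a *: F x) x = a *: mpd k F x.
Proof.
move=> f; apply/matrixP => i j; rewrite !mxE.
under [X in cpd _ X]eq_fun do rewrite mxE.
by rewrite (cpdM _ _ (csmooth_cst a) (f i j)) cpd_cst mul0r add0r.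
Qed.

Lemma mpd_sum k m n I (r : seq I) (F : I -> 'rV[R]_M -> 'M[C]_(m, n)) x :
  (forall i, msmooth (F i)) ->
  mpd k (fun x => \sum_(i <- r) F i x) x = \sum_(i <- r) mpd k (F i) x.
Proof.
move=> f; apply/matrixP => a b; rewrite mxE summxE.
under [X in cpd _ X]eq_fun do rewrite summxE.
rewrite cpd_sum => [|i]; last exact: f.
by apply: eq_bigr => i _; rewrite mxE.
Qed.

Lemma cpd_tr k n (F : 'rV[R]_M -> 'M[C]_n) x : msmooth F ->
  cpd k (fun x => \tr (F x)) x = \tr (mpd k F x).
Proof.
move=> f; rewrite cpd_sum //; by apply: eq_bigr => i _; rewrite mxE.
Qed.

End Smooth.

(** * Derivatives of the reduced dynamics *)

Section SmoothExtra.
Variables (R : realType) (M : nat).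
Local Notation C := (R[i]).

Lemma Ck_sum I (r : seq I) n (f : I -> 'rV[R]_M -> R) :
  (forall i, Ck n (f i)) -> Ck n (fun x => \sum_(i <- r) f i x).
Proof.
move=> H; elim: r => [|i r IH].
  by under eq_fun do rewrite big_nil; exact: Ck_cst.
by under eq_fun do rewrite big_cons; exact: CkD.
Qed.

Lemma mpdZf k m n a (F : 'rV[R]_M -> 'M[C]_(m, n)) x : csmooth a -> msmooth F ->
  mpd k (fun x => a x *: F x) x = cpd k a x *: F x + a x *: mpd k F x.
Proof.
move=> sa f; apply/matrixP => i j; rewrite !mxE.
under [X in cpd _ X]eq_fun do rewrite mxE.
exact: cpdM.
Qed.

Lemma mpd_fcalc k n (P : 'M[C]_n) (d : 'rV[R]_n) (f : 'rV[R]_M -> R -> C) x :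
  (forall t, csmooth (f^~ t)) ->
  mpd k (fun x => fcalc P d (f x)) x = fcalc P d (fun t => cpd k (f^~ t) x).
Proof.
move=> H; have sd : msmooth (fun x => diag_mx (map_mx (f x) d)).
  move=> a b; under eq_fun do rewrite !mxE.
  by case: (a == b); [exact: H | exact: csmooth_cst].
rewrite /fcalc mpdM; [|apply: msmoothM => //; exact: msmooth_cst|exact: msmooth_cst].
rewrite mpd_cst mulmx0 addr0 mpdM; [|exact: msmooth_cst|by []].
rewrite mpd_cst mul0mx add0r; congr (_ *m _ *m _).
apply/matrixP => a b; rewrite !mxE.
under [X in cpd _ X]eq_fun do rewrite !mxE.
by case: (a == b); rewrite ?mulr1n ?mulr0n // cpd_cst.
Qed.

Lemma msmooth_mxvec n (F : 'rV[R]_M -> 'M[C]_n) : msmooth F -> msmooth (fun x => mxvec (F x)).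
Proof.
move=> f a b; rewrite (ord1 a); case/mxvec_indexP: b => i j.
by under eq_fun do rewrite mxvecE; exact: f.
Qed.

Lemma msmooth_vec_mx n (F : 'rV[R]_M -> 'rV[C]_(n * n)) :
  msmooth F -> msmooth (fun x => vec_mx (F x)).
Proof. by move=> f a b; under eq_fun do rewrite mxE; exact: f. Qed.

(** The entries of the matrix of [fix_op] are affine in the values of [L x] on matrix units, and
    inversion preserves smoothness. *)
Lemma msmooth_fix_state n (L : 'rV[R]_M -> 'M[C]_n -> 'M[C]_n) :
  (forall x, channel (L x)) -> (forall x, minorized (L x)) ->
  (forall A, msmooth (fun x => L x A)) -> msmooth (fun x => fix_state (L x)).
Proof.
move=> chL minL sL; apply: msmooth_vec_mx; apply: msmoothM; first exact: msmooth_cst.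
apply: msmooth_invmx => [i j|x]; last exact: fix_op_unit.
rewrite /lmx /lin1_mx; under eq_fun do rewrite mxE.
apply: msmooth_mxvec; rewrite /fix_op; apply: msmoothD; last exact: msmooth_cst.
apply: msmoothD; first exact: msmooth_cst.
have -> : (fun x => - L x (vec_mx (delta_mx 0 i))) =
    fun x => (-1) *: L x (vec_mx (delta_mx 0 i)).
  by apply/funext => x; rewrite scaleN1r.
by apply: msmoothZ; [exact: csmooth_cst | exact: sL].
Qed.

End SmoothExtra.

(** * Derivatives of Gibbs states, words of reduced maps and fluxes *)

Section DynamicsCalculus.
Variables (R : realType) (M : nat) (S : RIS R M).
Hypothesis wfS : RIS_wf S.
Local Notation C := (R[i]).
Local Notation dS := (dS S).
Local Notation dE := (dE S).
Local Notation U := (Uj S).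
Local Notation "\1" := (1%:M) (at level 0).
Implicit Types (z : 'rV[R]_M) (j k : 'I_M) (s : seq 'I_M).

Let expE z j (t : R) : expR (- betaj S z j * t) = expR (- beta_ref S * t + t * z 0 j).
Proof. by congr expR; rewrite /betaj; ring. Qed.

Lemma rhoE_msmooth j : msmooth (fun z => rhoE S z j).
Proof.
have [P [d [PP PP' _ gE]]] := gibbs_fcalc (HE_hermitian wfS j).
rewrite /rhoE; under eq_fun do rewrite gE.
apply: msmooth_fcalc => i; apply: csmooth_real => n; apply: CkM.
  apply: CkV => [z|]; first by rewrite gt_eqF // sum_expR_gt0 // (dE_gt0 wfS).
  by apply: Ck_sum => l; under eq_fun do rewrite expE; exact: Ck_expR.
by under eq_fun do rewrite expE; exact: Ck_expR.
Qed.

(** Differentiating Z rho = E, with E the unnormalised exponential, avoids dividing; the trace of E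
    supplies the derivative of Z. The sign is positive because the inverse temperature decreases
    with [zeta]. *)
Lemma mpd_rhoE k j z : mpd k (fun z => rhoE S z j) z =
  if k == j then rhoE S z j *m HE S j - \tr (rhoE S z j *m HE S j) *: rhoE S z j else 0.
Proof.
have [P [d [PP PP' HEE gE]]] := gibbs_fcalc (HE_hermitian wfS j).
pose Z z := \sum_i expR (- betaj S z j * d 0 i).
have Z0 y : Z y != 0 by rewrite gt_eqF // sum_expR_gt0 // (dE_gt0 wfS).
pose f y t : C := (expR (- betaj S y j * t))%:C.
pose E y := fcalc P d (f y).
have Zrho y : (Z y)%:C *: rhoE S y j = E y.
  rewrite /rhoE gE fcalcZ; congr fcalc; apply/funext => t.
  by rewrite -rmorphM mulrA mulfV // mul1r.
have sf t : csmooth (f^~ t).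
  by apply: csmooth_real => n; under eq_fun do rewrite expE; exact: Ck_expR.
have sE : msmooth E by apply: msmooth_fcalc.
have sZ : csmooth (fun y => (Z y)%:C).
  apply: csmooth_real => n; apply: Ck_sum => l.
  by under eq_fun do rewrite expE; exact: Ck_expR.
have trE y : \tr (E y) = (Z y)%:C by rewrite -Zrho mxtraceZ rhoE_tr // mulr1.
have mE : mpd k E z = ((k == j)%:R : C) *: (E z *m HE S j).
  rewrite mpd_fcalc // HEE fcalcM // fcalcZ; congr fcalc; apply/funext => t.
  rewrite /cpd /= derive_cst.
  have -> : (fun y => expR (- betaj S y j * t)) = fun y => expR (- beta_ref S * t + t * y 0 j).
    by apply/funext => y; rewrite expE.
  have [_ ->] := is_derive_expR_coord (- beta_ref S * t) t j z (ecoord R k).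
  rewrite /f expE mxE eqxx -rmorphM /= [j == k]eq_sym; case: (k == j) => /=.
    by rewrite mulr1 [t * _]mulrC mul1r.
  by rewrite mulr0 !mul0r.
have /(congr1 (fun F => mpd k F z)) : (fun y => (Z y)%:C *: rhoE S y j) = E.
  by apply/funext => y; exact: Zrho.
rewrite mpdZf //; last exact: rhoE_msmooth.
have -> : cpd k (fun y => (Z y)%:C) z = \tr (mpd k E z).
  by rewrite -cpd_tr //; congr cpd; apply/funext => y; rewrite trE.
have Zc : (Z z)%:C != 0 by rewrite fmorph_eq0.
rewrite mE; case: (k == j); rewrite ?scale1r ?scale0r.
  rewrite -Zrho -scalemxAl mxtraceZ => H.
  apply: (scalerI Zc); apply: (addrI (((Z z)%:C * \tr (rhoE S z j *m HE S j)) *: rhoE S z j)).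
  by rewrite H scalerBr -(scalerA (Z z)%:C) [RHS]addrC subrK.
by rewrite mxtrace0 scale0r add0r => /eqP; rewrite scaler_eq0 (negPf Zc) => /eqP.
Qed.

Lemma Lj_msmooth j F : msmooth F -> msmooth (fun z => Lj S z j (F z)).
Proof.
move=> f; apply: msmooth_ptr2; apply: msmoothM; last exact: msmooth_cst.
apply: msmoothM; first exact: msmooth_cst.
by apply: msmooth_tens => //; exact: rhoE_msmooth.
Qed.

Lemma Lword_msmooth s F : msmooth F -> msmooth (fun z => Lword S z s (F z)).
Proof. by elim: s F => //= j s IH F f; apply: IH; exact: Lj_msmooth. Qed.

Lemma mpd_Lj k j F z : msmooth F ->
  mpd k (fun z => Lj S z j (F z)) z = Lj S z j (mpd k F z) +
    ptr2 (U j *m (F z *t mpd k (fun z => rhoE S z j) z) *m adjmx (U j)).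
Proof.
move=> f; have sr : msmooth (fun z => rhoE S z j) by exact: rhoE_msmooth.
have st : msmooth (fun z => F z *t rhoE S z j) by exact: msmooth_tens.
have s1 : msmooth (fun z => U j *m (F z *t rhoE S z j)).
  by apply: msmoothM st; exact: msmooth_cst.
rewrite /Lj mpd_ptr2; last by apply: msmoothM; [exact: s1 | exact: msmooth_cst].
rewrite (mpdM _ _ s1 (@msmooth_cst R M _ _ _)) mpd_cst mulmx0 addr0.
rewrite (mpdM _ _ (@msmooth_cst R M _ _ _) st) mpd_cst mul0mx add0r.
by rewrite mpd_tens // mulmxDr mulmxDl ptr2D.
Qed.

Lemma Ttot_neq0 : (0 < M)%N -> (Ttot S)%:C != 0.
Proof.
move=> M0; rewrite fmorph_eq0 gt_eqF // /Ttot.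
have t0 : forall j, 0 < tau S j by case: wfS => _ [_ [_ [_ [_ []]]]].
by rewrite (bigD1 (Ordinal M0)) //= ltr_pwDl // sumr_ge0 // => i _; exact: ltW.
Qed.

Lemma Ljd_msmooth j F : msmooth F -> msmooth (fun z => Ljd S z j (F z)).
Proof.
move=> f; apply: msmooth_ptr2; apply: msmoothM; last exact: msmooth_cst.
apply: msmoothM; last by apply: msmooth_tens => //; exact: msmooth_cst.
apply: msmoothM; last exact: msmooth_cst.
by apply: msmooth_tens; [exact: msmooth_cst | exact: rhoE_msmooth].
Qed.

Lemma Ldcomp_msmooth s F : msmooth F -> msmooth (fun z => Ldcomp S z s (F z)).
Proof. by move=> f; elim: s => //= j s IH; exact: Ljd_msmooth. Qed.

Lemma PhiE z j : Phi S z j = (- (Ttot S)^-1%:C) *: ptr2 ((\1 *t rhoE S z j) *m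
  (adjmx (U j) *m (\1 *t HE S j) *m U j - \1 *t HE S j)).
Proof. by rewrite scaleNr. Qed.

Lemma Phi_msmooth j : msmooth (fun z => Phi S z j).
Proof.
under eq_fun do rewrite PhiE; apply: msmoothZ; first exact: csmooth_cst.
apply: msmooth_ptr2; apply: msmoothM; last exact: msmooth_cst.
by apply: msmooth_tens; [exact: msmooth_cst | exact: rhoE_msmooth].
Qed.

Lemma Phicy_msmooth j : msmooth (fun z => Phicy S z j).
Proof. by apply: Ldcomp_msmooth; exact: Phi_msmooth. Qed.

Lemma mpd_Phi k j z : mpd k (fun z => Phi S z j) z =
  (- (Ttot S)^-1%:C) *: ptr2 ((\1 *t mpd k (fun z => rhoE S z j) z) *m
    (adjmx (U j) *m (\1 *t HE S j) *m U j - \1 *t HE S j)).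
Proof.
have sr : msmooth (fun z => rhoE S z j) by exact: rhoE_msmooth.
have st : msmooth (fun z => (\1 : 'M[C]_dS) *t rhoE S z j).
  by apply: msmooth_tens => //; exact: msmooth_cst.
have -> : (fun z => Phi S z j) = fun z => (- (Ttot S)^-1%:C) *: ptr2 ((\1 *t rhoE S z j) *m
  (adjmx (U j) *m (\1 *t HE S j) *m U j - \1 *t HE S j)).
  by apply/funext => y; exact: PhiE.
have sp := msmoothM st (@msmooth_cst R M _ _ (adjmx (U j) *m (\1 *t HE S j) *m U j - \1 *t HE S j)).
rewrite mpdZ; last exact: msmooth_ptr2.
rewrite (mpd_ptr2 _ _ sp) (mpdM _ _ st (@msmooth_cst R M _ _ _)) mpd_cst mulmx0 addr0.
by rewrite (mpd_tens _ _ (@msmooth_cst R M _ _ _) sr) mpd_cst tens0mx add0r.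
Qed.

Section Equilibrium.
Variable rho0 : 'M[C]_dS.
Hypothesis inv0 : forall j,
  U j *m (rho0 *t rhoE S 0 j) *m adjmx (U j) = rho0 *t rhoE S 0 j.

Lemma Lj_fixed j : Lj S 0 j rho0 = rho0.
Proof. by rewrite /Lj inv0 ptr2_tens (rhoE_tr wfS) scale1r. Qed.

Lemma Lword_fixed s : Lword S 0 s rho0 = rho0.
Proof. by elim: s => //= j s IH; rewrite Lj_fixed. Qed.

Hypothesis M0 : (0 < M)%N.
Local Notation T := ((Ttot S)%:C).

(** The derivative of the Gibbs state inserts the environment energy, minus its mean, next to the
    joint equilibrium state. That state commutes with [U j] and can be moved out, leaving U H_E U^*
    minus the mean energy, which is T [Phirev] times [rho0]. *)
Lemma mpd_Lj_equilibrium k j F : msmooth F -> F 0 = rho0 ->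
  mpd k (fun z => Lj S z j (F z)) 0 =
    Lj S 0 j (mpd k F 0) + (if k == j then T *: (Phirev S 0 k *m rho0) else 0).
Proof.
move=> f F0; rewrite mpd_Lj // F0 mpd_rhoE; congr (_ + _).
case: eqP => [->|_]; last first.
  rewrite tensmx0 mulmx0 mul0mx; apply/matrixP => a b.
  by rewrite !mxE big1 // => e _; rewrite mxE.
have T0 := Ttot_neq0 M0.
have tr1 := rhoE_tr wfS 0 j; have cm := rhoE_comm wfS 0 j; have iv := inv0 j.
rewrite /Phirev; move: (rhoE S 0 j) tr1 cm iv => r tr1 cm iv.
have eqc : (rho0 *t r) *m adjmx (U j) = adjmx (U j) *m (rho0 *t r).
  by rewrite -[in RHS]iv 2!mulmxA (UadjU wfS) mul1mx.
have split2 : rho0 *t r = (\1 *t r) *m (rho0 *t \1).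
  by rewrite tensmx_mul mul1mx mulmx1.
set rhs := (X in _ = X).
rewrite tensmxBr mulmxBr mulmxBl ptr2B tensmxZr -scalemxAr -scalemxAl ptr2Z iv.
rewrite ptr2_tens tr1 scale1r cm.
have -> : rho0 *t (HE S j *m r) = (\1 *t HE S j) *m (rho0 *t r).
  by rewrite tensmx_mul mul1mx.
rewrite -(mulmxA (U j)) -(mulmxA (\1 *t HE S j)) eqc 2!mulmxA split2.
rewrite mulmxA ptr2_mulr -ptr2_cycle /rhs -scalemxAl scalerA.
rewrite fmorphV mulfV // scale1r mulmxBr ptr2B mulmxBl; congr (_ - _).
by rewrite tensmx_mul mul1mx ptr2_tens -scalemxAl mul1mx cm.
Qed.

Lemma mpd_Lword_notin k s F : msmooth F -> F 0 = rho0 -> k \notin s ->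
  mpd k (fun z => Lword S z s (F z)) 0 = Lword S 0 s (mpd k F 0).
Proof.
elim: s F => //= j s IH F f F0; rewrite inE negb_or => /andP[kj ks].
have f' := Lj_msmooth j f.
rewrite (IH _ f') //; last by rewrite F0 Lj_fixed.
by rewrite mpd_Lj_equilibrium // (negPf kj) addr0.
Qed.

(** Only one factor depends on the k-th force. The factors before it fix [rho0] at the origin, and
    those after it transport the new term. *)
Lemma mpd_Lword k s1 s2 F : msmooth F -> F 0 = rho0 -> k \notin s1 -> k \notin s2 ->
  mpd k (fun z => Lword S z (s1 ++ k :: s2) (F z)) 0 =
    Lword S 0 (s1 ++ k :: s2) (mpd k F 0) + Lword S 0 s2 (T *: (Phirev S 0 k *m rho0)).
Proof.
move=> f F0 ks1 ks2.
have f1 : msmooth (fun z => Lword S z s1 (F z)) by exact: Lword_msmooth.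
have E1 : Lword S 0 s1 (F 0) = rho0 by rewrite F0 Lword_fixed.
have f2 := Lj_msmooth k f1.
have -> : (fun z => Lword S z (s1 ++ k :: s2) (F z)) =
    fun z => Lword S z s2 (Lj S z k (Lword S z s1 (F z))).
  by apply/funext => z; rewrite Lword_cat.
rewrite (mpd_Lword_notin f2) //; last by rewrite E1 Lj_fixed.
rewrite mpd_Lj_equilibrium // eqxx (lin_mapD (Lword_lin wfS 0 s2)).
by rewrite (mpd_Lword_notin f F0 ks1) Lword_cat.
Qed.

End Equilibrium.
End DynamicsCalculus.

(** * Kinetic coefficients *)

Section Kinetic.
Variables (R : realType) (M : nat) (S : RIS R M).
Hypothesis wfS : RIS_wf S.
Hypothesis M0 : (0 < M)%N.
Local Notation C := (R[i]).
Local Notation dS := (dS S).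
Local Notation dE := (dE S).
Local Notation U := (Uj S).
Local Notation "\1" := (1%:M) (at level 0).
Local Notation T := ((Ttot S)%:C).
Implicit Types (z : 'rV[R]_M) (j k : 'I_M) (s : seq 'I_M).

(* The series telescopes because its seed [Z - L Z] is a coboundary. *)
Lemma channel_series n (L : 'M[C]_n -> 'M[C]_n) (W Y Z : 'M[C]_n) :
  channel L -> minorized L -> \tr Z = 0 -> Z = L Z + Y ->
  ccvg (fun N => \sum_(m < N) \tr (W *m iter m L Y)) (\tr (W *m Z)).
Proof.
move=> chL minL tZ ZE; have linL : lin_map L by case: chL.
have YE : Y = Z - L Z by rewrite {1}ZE addrC addKr.
have E N : \sum_(m < N) \tr (W *m iter m L Y) = \tr (W *m Z) + -1 * \tr (W *m iter N L Z).
  elim: N => [|N IH]; first by rewrite big_ord0 mulN1r subrr.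
  rewrite big_ord_recr /= IH YE (lin_mapB (lin_map_iter linL N)) mulmxBr mxtrace_sub.
  by rewrite -iterSr iterS !mulN1r addrA subrK.
under eq_fun do rewrite E.
have := ccvgD (ccvg_cst (\tr (W *m Z))) (ccvgMl (-1) (channel_cvg0_tr chL minL W tZ)).
by rewrite mulr0 addr0.
Qed.

Section Equilibrium.
Variable rho0 : 'M[C]_dS.
Hypothesis inv0 : forall j,
  U j *m (rho0 *t rhoE S 0 j) *m adjmx (U j) = rho0 *t rhoE S 0 j.
Hypothesis tr0 : \tr rho0 = 1.

Section FixedPoint.
Variable L : 'rV[R]_M -> 'M[C]_dS -> 'M[C]_dS.
Hypothesis chL : forall z, channel (L z).
Hypothesis minL : forall z, minorized (L z).
Hypothesis sL : forall A, msmooth (fun z => L z A).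
Hypothesis L0 : L 0 rho0 = rho0.

Lemma inv_state_msmooth : msmooth (fun z => inv_state (L z)).
Proof.
have -> : (fun z => inv_state (L z)) = fun z => fix_state (L z).
  by apply/funext => z; exact: (inv_state_fix_state (chL z) (minL z) (dS_gt0 wfS)).
exact: msmooth_fix_state.
Qed.

Lemma inv_state_fixed z : L z (inv_state (L z)) = inv_state (L z).
Proof.
rewrite (inv_state_fix_state (chL z) (minL z) (dS_gt0 wfS)).
exact: (fix_state_fixed (chL z) (minL z) (dS_gt0 wfS)).
Qed.

Lemma inv_state_tr z : \tr (inv_state (L z)) = 1.
Proof.
rewrite (inv_state_fix_state (chL z) (minL z) (dS_gt0 wfS)).
exact: (fix_state_tr (chL z) (minL z) (dS_gt0 wfS)).
Qed.

Lemma inv_state0 : inv_state (L 0) = rho0.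
Proof. exact: (inv_stateE (chL 0) (minL 0) (dS_gt0 wfS)). Qed.

Lemma mpd_inv_state_tr k : \tr (mpd k (fun z => inv_state (L z)) 0) = 0.
Proof.
rewrite -cpd_tr; last exact: inv_state_msmooth.
have -> : (fun z => \tr (inv_state (L z))) = fun=> 1.
  by apply/funext => z; exact: inv_state_tr.
exact: cpd_cst.
Qed.

(* First order perturbation theory: [Y] is the derivative of [L z rho0]. *)
Lemma inv_state_series k Y W :
  mpd k (fun z => L z (inv_state (L z))) 0 =
    L 0 (mpd k (fun z => inv_state (L z)) 0) + T *: Y ->
  ccvg (fun N => \sum_(m < N) \tr (W *m iter m (L 0) Y))
       (T^-1 * \tr (W *m mpd k (fun z => inv_state (L z)) 0)).
Proof.
move=> HY; have T0 := Ttot_neq0 wfS M0.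
have fE : (fun z => L z (inv_state (L z))) = fun z => inv_state (L z).
  by apply/funext => z; exact: inv_state_fixed.
rewrite fE in HY.
have := ccvgMl T^-1 (channel_series W (chL 0) (minL 0) (mpd_inv_state_tr k) HY).
congr ccvg; apply/funext => N; rewrite mulr_sumr; apply: eq_bigr => m _.
have linL : lin_map (L 0) by case: (chL 0).
by rewrite (lin_mapZ (lin_map_iter linL m)) -scalemxAr mxtraceZ mulKf.
Qed.

End FixedPoint.

Lemma iter_dual n (L Ld : 'M[C]_n -> 'M[C]_n) m X Y :
  (forall X Y, \tr (Ld X *m Y) = \tr (X *m L Y)) ->
  \tr (iter m Ld X *m Y) = \tr (X *m iter m L Y).
Proof. by move=> H; elim: m Y => [|m IH] Y //; rewrite iterS H IH -iterSr. Qed.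

(** Stated for an arbitrary word so as to serve the cycle and the reversed cycle alike. [p] is the
    part of the word run before [j]; when it contains [k], the observable depends on the k-th force
    as well, and [b] lists the letters between [k] and [j]. *)
Lemma kinetic_word (s pk qk p p' b : seq 'I_M) j k :
  minorized (Lword S 0 s) ->
  s = pk ++ k :: qk -> k \notin pk -> k \notin qk ->
  (k \in p -> [/\ p = p' ++ k :: b, k \notin p' & k \notin b]) ->
  exists sm,
    ccvg (fun N => \sum_(m < N) \tr (rho0 *m (Ldcomp S 0 qk
       (iter m (Ldcomp S 0 s) (Ldcomp S 0 p (Phi S 0 j))) *m Phirev S 0 k))) sm /\
    cpd k (fun z => \tr (inv_state (Lword S z s) *m Ldcomp S z p (Phi S z j))) 0 =
      T * sm +
      (if k \in p then T * \tr (rho0 *m (Ldcomp S 0 b (Phi S 0 j) *m Phirev S 0 k)) else 0) +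
      \tr (rho0 *m mpd k (fun z => Phi S z j) 0).
Proof.
move=> min0 sE kpk kqk kp; have T0 := Ttot_neq0 wfS M0.
have chL z := Lword_channel wfS z s.
have minL z : minorized (Lword S z s).
  by apply/(Lword_minorized wfS); move/(Lword_minorized wfS): min0.
have sL A : msmooth (fun z => Lword S z s A).
  by apply: (Lword_msmooth wfS s); exact: msmooth_cst.
have L0 : Lword S 0 s rho0 = rho0 by exact: (Lword_fixed wfS inv0).
pose rho z := inv_state (Lword S z s).
have srho : msmooth rho by exact: inv_state_msmooth.
have rho_0 : rho 0 = rho0 by exact: (inv_state0 chL minL L0).
set W := Ldcomp S 0 p (Phi S 0 j).
pose Y := Lword S 0 qk (Phirev S 0 k *m rho0).
have HY : mpd k (fun z => Lword S z s (rho z)) 0 = Lword S 0 s (mpd k rho 0) + T *: Y.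
  rewrite sE (mpd_Lword wfS inv0 M0 srho rho_0 kpk kqk).
  by rewrite (lin_mapZ (Lword_lin wfS 0 qk)).
exists (T^-1 * \tr (W *m mpd k rho 0)); split.
  have := inv_state_series chL minL sL W HY.
  congr ccvg; apply/funext => N; apply: eq_bigr => m _.
  rewrite [RHS]mxtrace_mulC -[in RHS]mulmxA [RHS]Ldcomp_dual.
  by rewrite [RHS](iter_dual _ _ _ (@Ldcomp_dual R M S 0 s)).
(* With the dual word moved onto the state, the only observable left to differentiate is [Phi]. *)
have -> : (fun z => \tr (inv_state (Lword S z s) *m Ldcomp S z p (Phi S z j))) =
    fun z => \tr (Phi S z j *m Lword S z p (rho z)).
  by apply/funext => z; rewrite mxtrace_mulC Ldcomp_dual.
have sPhi : msmooth (fun z => Phi S z j) by exact: Phi_msmooth.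
have sp : msmooth (fun z => Lword S z p (rho z)) by exact: (Lword_msmooth wfS p).
rewrite cpd_tr; last exact: msmoothM.
rewrite (mpdM _ _ sPhi sp) mxtraceD rho_0 (Lword_fixed wfS inv0).
rewrite [X in X + _]mxtrace_mulC addrC; congr (_ + _).
rewrite mulrA mulfV // mul1r /W Ldcomp_dual.
case: ifP => [/kp[pE kp' kb]|/negbT kp'].
  have := mpd_Lword wfS inv0 M0 srho rho_0 kp' kb; rewrite -pE => ->.
  rewrite mulmxDr mxtraceD (lin_mapZ (Lword_lin wfS 0 b)) -scalemxAr mxtraceZ.
  congr (_ + _ * _).
  by rewrite [RHS]mxtrace_mulC -[in RHS]mulmxA [RHS](@Ldcomp_dual R M S 0 b).
by rewrite (mpd_Lword_notin wfS inv0 M0 srho rho_0 kp') addr0.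
Qed.

Lemma mpd_Lra k F : msmooth F -> F 0 = rho0 ->
  mpd k (fun z => Lra S z (F z)) 0 =
    Lra S 0 (mpd k F 0) + T *: ((M%:R : C)^-1 *: (Phirev S 0 k *m rho0)).
Proof.
move=> f F0; have sj j : msmooth (fun z => Lj S z j (F z)) by exact: (Lj_msmooth wfS).
rewrite /Lra mpdZ; last exact: msmooth_sum.
rewrite mpd_sum // scalerA mulrC -scalerA -scalerDr; congr (_ *: _).
under eq_bigr => j _ do rewrite (mpd_Lj_equilibrium wfS inv0 M0 k j f F0).
rewrite big_split /=; congr (_ + _).
rewrite (bigD1 k) //= eqxx big1 ?addr0 // => j jk.
by rewrite eq_sym (negPf jk).
Qed.

Lemma kinetic_ra j k : minorized (Lra S 0) ->
  exists sm,
    ccvg (fun N => \sum_(m < N) \tr (rho0 *m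
       (iter m (Lrad S 0) (Phi S 0 j) *m Phirev S 0 k))) sm /\
    cpd k (fun z => \tr (inv_state (Lra S z) *m Phi S z j)) 0 =
      T / M%:R * sm + \tr (rho0 *m mpd k (fun z => Phi S z j) 0).
Proof.
move=> min0; have T0 := Ttot_neq0 wfS M0.
have chL z := Lra_channel wfS z M0.
have minL z : minorized (Lra S z).
  by apply/(Lra_minorized wfS); move/(Lra_minorized wfS): min0.
have sL F : msmooth F -> msmooth (fun z => Lra S z (F z)).
  move=> f; rewrite /Lra; apply: msmoothZ; first exact: csmooth_cst.
  by apply: msmooth_sum => i; exact: (Lj_msmooth wfS).
have sLc A : msmooth (fun z => Lra S z A) by apply: sL; exact: msmooth_cst.
have Mc : (M%:R : C) != 0 by rewrite pnatr_eq0 -lt0n.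
have L0 : Lra S 0 rho0 = rho0.
  rewrite /Lra; under eq_bigr => i _ do rewrite (Lj_fixed wfS inv0).
  rewrite sumr_const card_ord; have -> : rho0 *+ M = (M%:R : C) *: rho0 by rewrite scaler_nat.
  by rewrite scalerA mulVf ?scale1r.
pose rho z := inv_state (Lra S z).
have srho : msmooth rho by exact: inv_state_msmooth.
have rho_0 : rho 0 = rho0 by exact: (inv_state0 chL minL L0).
have HY := mpd_Lra k srho rho_0.
(* The seed given by [mpd_Lra] carries a factor 1/M which the series of the statement lacks, hence
   the factor M. *)
exists (M%:R * (T^-1 * \tr (Phi S 0 j *m mpd k rho 0))); split.
  have := ccvgMl M%:R (inv_state_series chL minL sLc (Phi S 0 j) HY).
  congr ccvg; apply/funext => N; rewrite mulr_sumr; apply: eq_bigr => m _.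
  rewrite [RHS]mxtrace_mulC -[in RHS]mulmxA [RHS](iter_dual _ _ _ (@Lrad_dual R M S 0)).
  have linL : lin_map (Lra S 0) by case: (chL 0).
  by rewrite (lin_mapZ (lin_map_iter linL m)) -scalemxAr mxtraceZ mulVKf.
have sPhi : msmooth (fun z => Phi S z j) by exact: Phi_msmooth.
rewrite cpd_tr; last exact: msmoothM.
rewrite (mpdM _ _ srho sPhi) mxtraceD -/(rho 0) rho_0; congr (_ + _).
by rewrite mxtrace_mulC -mulrA mulKf // mulrA mulfV // mul1r.
Qed.

End Equilibrium.
End Kinetic.

(** * The equilibrium dissipation *)

Section Dissipation.
Variables (R : realType) (M : nat) (S : RIS R M).
Hypothesis wfS : RIS_wf S.
Hypothesis M0 : (0 < M)%N.
Local Notation C := (R[i]).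
Local Notation dS := (dS S).
Local Notation dE := (dE S).
Local Notation U := (Uj S).
Local Notation "\1" := (1%:M) (at level 0).
Local Notation T := ((Ttot S)%:C).

(* [w] plays the role of [rho0 (x) rhoE], [h] of the energy of the environment. *)
Lemma variance_flux n (w V h : 'M[C]_n) :
  adjmx V *m V = 1%:M -> V *m w = w *m V -> w *m adjmx V = adjmx V *m w ->
  w *m h = h *m w ->
  let A := adjmx V *m h *m V - h in
  \tr (w *m (A *m A)) = - (2 * \tr (w *m h *m A)).
Proof.
move=> VV Vw wV wh A; set q := \tr (w *m h *m adjmx V *m h *m V).
have VV' := mulmx1C VV.
have E1 : \tr (w *m (adjmx V *m h *m V *m (adjmx V *m h *m V))) = \tr (w *m h *m h).
  rewrite -(mulmxA _ V) !mulmxA -[in LHS](mulmxA _ V) VV' mulmx1 wV.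
  by rewrite -!mulmxA mxtrace_mulC -!mulmxA VV' mulmx1.
have E2 : \tr (w *m (adjmx V *m h *m V *m h)) = q.
  by rewrite /q !mulmxA [LHS]mxtrace_mulC !mulmxA -wh.
have E3 : \tr (w *m (h *m (adjmx V *m h *m V))) = q by rewrite /q !mulmxA.
have E4 : \tr (w *m h *m (adjmx V *m h *m V)) = q by rewrite /q !mulmxA.
have E5 : \tr (w *m (h *m h)) = \tr (w *m h *m h) by rewrite mulmxA.
rewrite /A; move: (adjmx V *m h *m V) E1 E2 E3 E4 => B E1 E2 E3 E4.
have -> : (B - h) *m (B - h) = (B *m B - B *m h) - (h *m B - h *m h).
  by rewrite mulmxBl !mulmxBr.
rewrite 3!(mulmxBr w) (mulmxBr (w *m h)) 4!mxtrace_sub E1 E2 E3 E4 E5.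
by rewrite opprB mulrDr mulrN opprB !mulrDl !mul1r; ring.
Qed.

Section Equilibrium.
Variable rhoNE : R -> 'M[C]_dS.
Local Notation rho0 := (rhoNE 0).
Hypothesis inv0 : forall j,
  U j *m (rho0 *t rhoE S 0 j) *m adjmx (U j) = rho0 *t rhoE S 0 j.
Hypothesis h0 : Defs.hermitian rho0.
Hypothesis faithful : exists c : R, 0 < c /\
  forall B, pos B -> c%:C * \tr B <= \tr (B *m rho0).
Local Notation Hp := (Heff S rhoNE).

(** [mxlog] is a choice, so it is the chosen logarithm that gets diagonalised, and [rho0] is
    recovered as its exponential in the same basis. Faithfulness ensures that there is a logarithm
    to choose. *)
Lemma mxlog_equilibrium : exists (P : 'M[C]_dS) (x : 'rV[R]_dS),
  [/\ adjmx P *m P = 1%:M, P *m adjmx P = 1%:M,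
      mxlog rho0 = fcalc P x (real_complex R) &
      rho0 = fcalc P x (fun t => (expR t)%:C)].
Proof.
have expE P x : adjmx P *m P = 1%:M -> P *m adjmx P = 1%:M ->
    expm (fcalc P x (real_complex R)) = fcalc P x (fun t => (expR t)%:C) :> 'M[C]_dS.
  move=> PP PP'; rewrite -[in LHS](scale1r (fcalc _ _ _)); apply: fcalc_expm => // t.
  by rewrite mul1r; exact: has_cexp_real.
have [Q [d [QQ QQ' rhoQ]]] := fcalc_hermitian h0.
(* Faithfulness tested on the unit eigenvector [col i Q]. *)
have d0 i : 0 < d 0 i.
  have [c [c0 H]] := faithful; apply: lt_le_trans c0 _; rewrite -lecR.
  have := H _ (pos_mulmx_adj (col i Q)).
  rewrite [\tr (_ *m rho0)]mxtrace_mulC -mxtr_quad rhoQ quad_diag // mxE.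
  have -> : \tr (col i Q *m adjmx (col i Q)) = 1; last by rewrite mulr1.
  rewrite mxtrace_mulC trace_mx11 colE adjmxM -mulmxA (mulmxA (adjmx Q)) QQ mul1mx.
  by rewrite -colE mxE adjmxE mxE !eqxx conjc_nat.
pose x : 'rV[R]_dS := map_mx (@ln R) d.
have rhox : rho0 = fcalc Q x (fun t => (expR t)%:C).
  rewrite rhoQ /fcalc; congr (_ *m diag_mx _ *m _).
  by apply/matrixP => i j; rewrite !mxE (ord1 i) lnK ?posrE.
rewrite /mxlog; case: xgetP => [X -> [hX eX]|/(_ (fcalc Q x (real_complex R)))]; last first.
  case; split; last by rewrite expE.
  by rewrite /Defs.hermitian fcalc_adj; congr fcalc; apply/funext => t; rewrite conjc_real.
have [P [y [PP PP' XE]]] := fcalc_hermitian hX.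
by exists P, y; split; [exact: PP|exact: PP'|exact: XE|rewrite -eX XE expE].
Qed.

Lemma mxlogE : mxlog rho0 = (- beta_ref S)%:C *: Hp.
Proof.
have b0 : 0 < beta_ref S by case: wfS => _ [_ [_ [_ [_ []]]]].
by rewrite /Heff scalerA -rmorphM mulrNN mulfV ?rmorph1 ?scale1r // gt_eqF.
Qed.

Lemma Heff_hermitian : Defs.hermitian Hp.
Proof.
have [P [x [_ _ logE _]]] := mxlog_equilibrium.
rewrite /Defs.hermitian /Heff adjmxZ conjc_real logE; congr (_ *: _).
by rewrite fcalc_adj; congr fcalc; apply/funext => t; rewrite conjc_real.
Qed.

Lemma Heff_comm : rho0 *m Hp = Hp *m rho0.
Proof.
have [P [x [PP PP' logE rhoE]]] := mxlog_equilibrium.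
rewrite /Heff -scalemxAl -scalemxAr logE rhoE !(fcalcM _ PP); congr (_ *: fcalc _ _ _).
by apply/funext => t; rewrite mulrC.
Qed.

(* The logarithm of the invariant state is conserved: the interaction preserves
   the total energy [Hp (x) 1 + 1 (x) HE j]. *)
Lemma total_energy_comm j :
  U j *m (Hp *t \1 + \1 *t HE S j) = (Hp *t \1 + \1 *t HE S j) *m U j.
Proof.
have [P [x [PP PP' logE rho0E]]] := mxlog_equilibrium.
have [Q [d [QQ QQ' HEE gE]]] := gibbs_fcalc (HE_hermitian wfS j).
have b0 : 0 < beta_ref S by case: wfS => _ [_ [_ [_ [_ []]]]].
have bE : betaj S 0 j = beta_ref S by rewrite /betaj mxE subr0.
pose Z := \sum_i expR (- beta_ref S * d 0 i).
have Z0 : Z != 0 by rewrite gt_eqF // sum_expR_gt0 // (dE_gt0 wfS).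
have PQ : adjmx (P *t Q) *m (P *t Q) = 1%:M by exact: tens_unitary.
have PQ' := mulmx1C PQ.
have tE f g : fcalc P x f *t fcalc Q d g = (P *t Q) *m diag_mx
    (\row_k (f (x 0 (mxtens_unindex k).1) * g (d 0 (mxtens_unindex k).2))) *m adjmx (P *t Q).
  rewrite /fcalc -!tensmx_mul tensmx_diag adjmx_tens; congr (_ *m diag_mx _ *m _).
  by apply/matrixP => a b; rewrite !mxE.
(* These are the eigenvalues of the logarithm of the joint state up to the constant log Z, which
   stays as the factor [Z^-1] in front of the exponential. *)
pose kap : 'rV[R]_(dS * dE j) := \row_k (x 0 (mxtens_unindex k).1 +
   - beta_ref S * d 0 (mxtens_unindex k).2).
have wE : rho0 *t rhoE S 0 j = fcalc (P *t Q) kap (fun t => (Z^-1 * expR t)%:C).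
  rewrite rho0E /rhoE gE bE tE /fcalc; congr (_ *m diag_mx _ *m _).
  apply/matrixP => a b; rewrite !mxE -rmorphM; congr (_%:C).
  by rewrite expRD mulrCA.
have KE : fcalc (P *t Q) kap (real_complex R) =
    (- beta_ref S)%:C *: (Hp *t \1 + \1 *t HE S j).
  rewrite scalerDr -tensmxZl -mxlogE logE -tensmxZr HEE fcalcZ.
  rewrite -{1}(fcalc1 d QQ') -(fcalc1 x PP') !tE -mulmxDl -mulmxDr -linearD /=.
  rewrite /fcalc; congr (_ *m diag_mx _ *m _).
  by apply/matrixP => a b; rewrite !mxE mulr1 mul1r -rmorphM -rmorphD.
(* Injectivity of this function is what lets commutation with the state descend to its exponent, the
   total energy. *)
have finj : injective (fun t : R => (Z^-1 * expR t)%:C : C).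
  move=> s t /complexI /(mulfI _) H; apply: expR_inj; apply: H.
  by rewrite invr_eq0.
have wU : U j *m fcalc (P *t Q) kap (fun t => (Z^-1 * expR t)%:C) =
    fcalc (P *t Q) kap (fun t => (Z^-1 * expR t)%:C) *m U j.
  by rewrite -wE; exact: (equilibrium_comm wfS inv0).
have := fcalc_comm PQ PQ' (real_complex R) finj wU.
rewrite KE -scalemxAl -scalemxAr; apply: scalerI.
by rewrite fmorph_eq0 oppr_eq0 gt_eqF.
Qed.

(** The derivative is - tr (w h A) / T, with w the joint equilibrium state, h the environment energy
    and A its increment. [variance_flux] gives tr (w A A) = - 2 tr (w h A), hence the factor 1/2.
    The same lemma applied to the effective system energy identifies tr (w A A) with T times the
    dissipation. *)
Lemma dissipation j k :
  \tr (rho0 *m mpd k (fun z => Phi S z j) 0) =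
  if j == k then 2^-1 * \tr (rho0 *m Dj S 0 j Hp Hp) else 0.
Proof.
rewrite mpd_Phi // mpd_rhoE // eq_sym; case: eqP => [->{j}|_]; last first.
  rewrite tensmx0 mul0mx.
  have -> : ptr2 (0 : 'M[C]_(dS * dE j)) = 0.
    by apply/matrixP => a b; rewrite !mxE big1 // => e _; rewrite mxE.
  by rewrite scaler0 mulmx0 mxtrace0.
have tr1 := rhoE_tr wfS 0 k; have cm := rhoE_comm wfS 0 k; have iv := inv0 k.
have UwU := equilibrium_comm wfS inv0 k.
have en := total_energy_comm k.
have HpH := Heff_hermitian; have Hpc := Heff_comm.
set A := adjmx (U k) *m (\1 *t HE S k) *m U k - \1 *t HE S k.
set w := rho0 *t rhoE S 0 k in iv UwU.
have UU := UadjU wfS k; have UU' := UUadj wfS k.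
have wU : w *m adjmx (U k) = adjmx (U k) *m w.
  by rewrite -[in RHS]iv 2!mulmxA UU mul1mx.
have wh : w *m (\1 *t HE S k) = (\1 *t HE S k) *m w.
  by rewrite /w !tensmx_mul mul1mx mulmx1 cm.
have wH : w *m (Hp *t \1) = (Hp *t \1) *m w.
  by rewrite /w !tensmx_mul mul1mx mulmx1 Hpc.
pose B := adjmx (U k) *m (Hp *t \1) *m U k - Hp *t \1.
have AB : A = - B.
  apply/eqP; rewrite -subr_eq0 opprK /A /B addrACA -opprD; apply/eqP.
  rewrite -mulmxDl -mulmxDr addrC [\1 *t _ + _]addrC.
  by rewrite -mulmxA -en mulmxA UU mul1mx addNr.
pose x : 'M[C]_(dS * dE k) := Hp *t \1.
have wx : w *m x = x *m w by exact: wH.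
have LdE X Y : \tr (Ljd S 0 k X *m (Y *m rho0)) =
    \tr ((X *t \1) *m (U k *m ((Y *t \1) *m w) *m adjmx (U k))).
  by rewrite Ljd_dual /Lj mxtr_ptr2 /w tensmx_mul mul1mx.
have F1 : \tr (rho0 *m Ljd S 0 k (Hp *m Hp)) = \tr (w *m x *m x).
  rewrite mxtrace_mulC -[rho0]mul1mx LdE tensmx11 mul1mx iv.
  have -> : (Hp *m Hp) *t \1 = x *m x :> 'M[C]_(dS * dE k) by rewrite tensmx_mul mulmx1.
  by rewrite mxtrace_mulC mulmxA.
have F2 : \tr (Ljd S 0 k Hp *m (Hp *m rho0)) =
    \tr (w *m x *m (adjmx (U k) *m x *m U k)).
  rewrite LdE -/x.
  have -> : x *m (U k *m (x *m w) *m adjmx (U k)) = (x *m U k) *m (w *m x *m adjmx (U k)).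
    by rewrite -wx !mulmxA.
  by rewrite mxtrace_mulC !mulmxA.
have F3 : \tr (rho0 *m (Hp *m Hp)) = \tr (w *m x *m x).
  rewrite /w /x !tensmx_mul !mulmx1 mxtrace_tens tr1 mulr1.
  by rewrite mulmxA.
have DE : \tr (rho0 *m (Ljd S 0 k (Hp *m Hp) - Ljd S 0 k Hp *m Hp - Hp *m Ljd S 0 k Hp + Hp *m Hp))
    = \tr (w *m (A *m A)).
  have -> : A *m A = B *m B by rewrite AB mulmxN mulNmx opprK.
  rewrite (variance_flux UU UwU wU wH) -/x mulmxBr mxtrace_sub.
  rewrite mulmxDr !mulmxBr mxtraceD !mxtrace_sub F1 F3.
  have -> : \tr (rho0 *m (Ljd S 0 k Hp *m Hp)) = \tr (Ljd S 0 k Hp *m (Hp *m rho0)).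
    by rewrite mxtrace_mulC mulmxA.
  have -> : \tr (rho0 *m (Hp *m Ljd S 0 k Hp)) = \tr (Ljd S 0 k Hp *m (Hp *m rho0)).
    by rewrite mulmxA mxtrace_mulC Hpc.
  by rewrite F2; ring.
have -> : \tr (rho0 *m Dj S 0 k Hp Hp) = (Ttot S)^-1%:C * - (2 * \tr (w *m (\1 *t HE S k) *m A)).
  by rewrite -(variance_flux UU UwU wU wh) -DE /Dj HpH -scalemxAr mxtraceZ.
rewrite -scalemxAr mxtraceZ mxtr_ptr2 mulmxA tensmx_mul mulmx1 mul1mx.
set e := \tr (rhoE S 0 k *m HE S k).
rewrite tensmxBr (tensmxZr e rho0 (rhoE S 0 k)) -/w mulmxBl mxtrace_sub -(scalemxAl e w A) (mxtraceZ e).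
(* Stationarity of w removes the mean-energy term in the derivative of the Gibbs state. *)
have -> : \tr (w *m A) = 0.
  rewrite /A mulmxBr mxtrace_sub.
  have -> : w *m (adjmx (U k) *m (\1 *t HE S k) *m U k) =
      adjmx (U k) *m (w *m (\1 *t HE S k) *m U k) by rewrite !mulmxA wU.
  by rewrite mxtrace_mulC -(mulmxA _ (U k)) UU' mulmx1 subrr.
have -> : rho0 *t (rhoE S 0 k *m HE S k) = w *m (\1 *t HE S k).
  by rewrite /w tensmx_mul mulmx1.
have n2 : (2 : C) != 0 by rewrite pnatr_eq0.
rewrite mulr0 subr0 !mulrN mulNr; congr (- _).
by rewrite [X in 2^-1 * X]mulrCA mulKf.
Qed.

End Equilibrium.
End Dissipation.

(** * Cyclic and random dynamics *)

Section Lists.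
Variable M : nat.
Implicit Types (j k : 'I_M) (s : seq 'I_M).

Lemma sorted_enum_ord : sorted (fun i j : 'I_M => (i < j)%N) (enum 'I_M).
Proof.
have := iota_ltn_sorted 0 M; rewrite -val_enum_ord.
by rewrite sorted_map.
Qed.

(** In an increasing list the filters of the statement are contiguous factors, as the
    differentiation of words requires. *)
Lemma sorted_split s k : sorted (fun i j : 'I_M => (i < j)%N) s -> k \in s ->
  s = [seq i : 'I_M <- s | (i < k)%N] ++ k :: [seq i : 'I_M <- s | (k < i)%N].
Proof.
have tr : transitive (fun i j : 'I_M => (i < j)%N) by move=> y x z; exact: ltn_trans.
move=> ss ks; case/splitPr: ks ss => p1 p2.
rewrite (sorted_pairwise tr) pairwise_cat /= => /and3P[a1 _ /andP[a2 _]].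
have lt1 : all (fun i : 'I_M => (i < k)%N) p1.
  by apply/allP => i i1; move/allrelP: a1 => /(_ i k i1 (mem_head _ _)).
rewrite !filter_cat /= ltnn.
have -> : [seq i : 'I_M <- p1 | (i < k)%N] = p1 by exact/all_filterP.
have -> : [seq i : 'I_M <- p2 | (k < i)%N] = p2 by exact/all_filterP.
have -> : [seq i : 'I_M <- p1 | (k < i)%N] = [::].
  apply/eqP; rewrite -(negbK (_ == _)) -has_filter; apply/hasPn => i /(allP lt1) ik.
  by rewrite -leqNgt ltnW.
have -> : [seq i : 'I_M <- p2 | (i < k)%N] = [::].
  apply/eqP; rewrite -(negbK (_ == _)) -has_filter; apply/hasPn => i /(allP a2) ik.
  by rewrite -leqNgt ltnW.
by rewrite cats0.
Qed.

Lemma enum_split k :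
  enum 'I_M = [seq i : 'I_M <- enum 'I_M | (i < k)%N] ++
              k :: [seq i : 'I_M <- enum 'I_M | (k < i)%N].
Proof. by apply: sorted_split; [exact: sorted_enum_ord | rewrite mem_enum]. Qed.

(** The first half cuts the prefix before [j] at [k], for the cycle. The second cuts the suffix
    after [k] at [j], for the reversed cycle. *)
Lemma between_split j k : (k < j)%N ->
  [seq i : 'I_M <- enum 'I_M | (i < j)%N] = [seq i : 'I_M <- enum 'I_M | (i < k)%N] ++
     k :: [seq i : 'I_M <- enum 'I_M | (k < i)%N && (i < j)%N] /\
  [seq i : 'I_M <- enum 'I_M | (k < i)%N] =
    [seq i : 'I_M <- enum 'I_M | (k < i)%N && (i < j)%N] ++
     j :: [seq i : 'I_M <- enum 'I_M | (j < i)%N].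
Proof.
have me (i : 'I_M) : i \in enum 'I_M by rewrite mem_enum.
have se := sorted_enum_ord; move: (enum 'I_M) se me => s se me kj.
have tr : transitive (fun i j : 'I_M => (i < j)%N) by move=> y x z; exact: ltn_trans.
split.
  rewrite {1}(@sorted_split [seq i : 'I_M <- s | (i < j)%N] k).
  - rewrite -!filter_predI; congr (_ ++ _).
    apply: eq_filter => i /=; apply: andb_idr => ik; exact: ltn_trans kj.
  - exact: (sorted_filter tr).
  - by rewrite mem_filter kj me.
rewrite {1}(@sorted_split [seq i : 'I_M <- s | (k < i)%N] j).
- rewrite -!filter_predI; congr (_ ++ _ :: _); apply: eq_filter => i /=.
    by rewrite andbC.
  by apply: andb_idr => ji; exact: ltn_trans ji.
- exact: (sorted_filter tr).
- by rewrite mem_filter kj me.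
Qed.

Lemma notin_filter_lt k s : k \notin [seq i : 'I_M <- s | (i < k)%N].
Proof. by rewrite mem_filter ltnn. Qed.

Lemma notin_filter_gt k s : k \notin [seq i : 'I_M <- s | (k < i)%N].
Proof. by rewrite mem_filter ltnn. Qed.

Lemma enum_two : M = 2%N -> exists a b : 'I_M, (a < b)%N /\ enum 'I_M = [:: a; b].
Proof.
move=> M2; subst M; exists ord0, ord_max; split => //.
by apply: (inj_map val_inj); rewrite val_enum_ord.
Qed.

End Lists.

Lemma cseries_unique (R : realType) (u v : nat -> R[i]) l k :
  cseries_to u l -> cseries_to v k -> (forall n, u n = v n) -> l = k.
Proof. by move=> ul vk uv; apply: (ccvg_unique ul); have -> : u = v by apply/funext. Qed.

Section Main.
Variables (R : realType) (M : nat) (S : RIS R M).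
Hypothesis wfS : RIS_wf S.
Hypothesis M0 : (0 < M)%N.
Local Notation C := (R[i]).
Local Notation dS := (dS S).
Local Notation T := ((Ttot S)%:C).
Variable rhoNE : R -> 'M[C]_dS.
Hypothesis HNE : NE S rhoNE.
Local Notation rho0 := (rhoNE 0).
Local Notation Hp := (Heff S rhoNE).
Implicit Types (z : 'rV[R]_M) (j k : 'I_M) (s : seq 'I_M).

Lemma NE_equilibrium j :
  Uj S j *m (rho0 *t rhoE S 0 j) *m adjmx (Uj S j) = rho0 *t rhoE S 0 j.
Proof.
have [_ /(_ j)] := HNE 0.
by have -> : const_mx 0 = 0 :> 'rV[R]_M by apply/matrixP => a b; rewrite !mxE.
Qed.

Lemma NE_state : state rho0. Proof. by case: (HNE 0). Qed.

Lemma NE_tr : \tr rho0 = 1. Proof. by case: NE_state => _ []. Qed.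

Lemma NE_pos : pos rho0. Proof. by case: NE_state => h [p _]. Qed.

(** Take A = [rho0] in the minorization: the iterates leave it unchanged. *)
Lemma minorized_faithful (L : 'M[C]_dS -> 'M[C]_dS) : minorized L -> L rho0 = rho0 ->
  exists c : R, 0 < c /\ forall B, pos B -> c%:C * \tr B <= \tr (B *m rho0).
Proof.
move=> [k [c [c0 H]]] L0; exists c; split; first exact: c0.
move=> B pB; have := H _ _ NE_pos pB; rewrite NE_tr mul1r.
suff -> : iter k L rho0 = rho0 by [].
by elim: k {H} => [//|k IH]; rewrite iterS IH.
Qed.

Lemma Ldcomp_iter z s n X : iter n (Ldcomp S z s) X = Ldcomp S z (flatten (nseq n s)) X.
Proof. by elim: n => [//|n IH]; rewrite iterS IH /= Ldcomp_cat. Qed.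

Section Cyclic.
Hypothesis min_cy : minorized (Nword S (enum 'I_M)).

Let min_word z : minorized (Lword S z (enum 'I_M)).
Proof. exact/(Lword_minorized wfS). Qed.

Let faithful : exists c : R, 0 < c /\ forall B, pos B -> c%:C * \tr B <= \tr (B *m rho0).
Proof. exact: minorized_faithful (min_word 0) (Lword_fixed wfS NE_equilibrium _). Qed.

Let dissipation0 j k : \tr (rho0 *m mpd k (fun z => Phi S z j) 0) =
  if j == k then 2^-1 * \tr (rho0 *m Dj S 0 j Hp Hp) else 0.
Proof. exact: (dissipation wfS NE_equilibrium (proj1 NE_pos) faithful). Qed.

Lemma rho_cy_smooth : smoothM (rho_cy S).
Proof.
apply: msmooth_smoothM; rewrite /rho_cy.
apply: (inv_state_msmooth wfS) => [z|z|A]; [exact: Lword_channel|exact: min_word|].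
by apply: (Lword_msmooth wfS (enum 'I_M)); exact: msmooth_cst.
Qed.

Lemma kinetic_cy j k :
  exists sm,
    cseries_to (fun n => \tr (rho0 *m
      (Ldcomp S 0 [seq i : 'I_M <- enum 'I_M | (k < i)%N]
        (iter n (Ldcomp S 0 (enum 'I_M)) (Phicy S 0 j)) *m Phirev S 0 k))) sm /\
    Lkin_cy S j k = T * sm
      + (if (k < j)%N then T * \tr (rho0 *m
           (Ldcomp S 0 [seq i : 'I_M <- enum 'I_M | (k < i)%N && (i < j)%N] (Phi S 0 j)
              *m Phirev S 0 k)) else 0)
      + (if j == k then 2^-1 * \tr (rho0 *m Dj S 0 j Hp Hp) else 0).
Proof.
pose p := [seq i : 'I_M <- enum 'I_M | (i < j)%N].
pose p' := [seq i : 'I_M <- enum 'I_M | (i < k)%N].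
pose b := [seq i : 'I_M <- enum 'I_M | (k < i)%N && (i < j)%N].
have kpE : (k \in p) = (k < j)%N by rewrite mem_filter mem_enum andbT.
have kp : k \in p -> [/\ p = p' ++ k :: b, k \notin p' & k \notin b].
  rewrite kpE => kj; split; first exact: (between_split kj).1.
    exact: notin_filter_lt.
  by rewrite mem_filter ltnn.
have := kinetic_word wfS M0 NE_equilibrium NE_tr j (min_word 0) (enum_split k)
  (notin_filter_lt _ _) (notin_filter_gt _ _) kp.
move=> [sm [cv E]]; exists sm; split; first exact: cv.
by rewrite dissipation0 kpE in E.
Qed.

Section TimeReversal.
Variables (W : 'M[C]_dS) (V : forall j, 'M[C]_(dE S j)).
Hypothesis WV : reversal W V.

Let min_rword z : minorized (Lword S z (rev (enum 'I_M))).
Proof. exact/(Lword_minorized wfS)/(Nword_rev_minorized WV). Qed.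

(** Both sides are fixed points of the same minorized channel and have the same trace. *)
Let Wrho : Theta W rho0 = rho0.
Proof.
have [WW _ _] := WV.
apply: (channel_fixed_unique (Lword_channel wfS 0 (enum 'I_M)) (min_word 0)).
- by elim: (enum 'I_M) => //= j s IH; rewrite (Theta_equilibrium wfS WV NE_equilibrium).
- exact: (Lword_fixed wfS NE_equilibrium).
- by rewrite Theta_tr.
Qed.

(** The roles of [j] and [k] are swapped relative to [kinetic_cy], so that the two expressions can
    be matched term by term. *)
Lemma kinetic_rcy j k :
  exists sm,
    cseries_to (fun n => \tr (rho0 *m
      (Ldcomp S 0 (rev [seq i : 'I_M <- enum 'I_M | (i < j)%N])
        (iter n (Ldcomp S 0 (rev (enum 'I_M))) (Phircy S 0 k)) *m Phirev S 0 j))) sm /\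
    Lkin_rcy S k j = T * sm
      + (if (k < j)%N then T * \tr (rho0 *m
           (Ldcomp S 0 (rev [seq i : 'I_M <- enum 'I_M | (k < i)%N && (i < j)%N]) (Phi S 0 k)
              *m Phirev S 0 j)) else 0)
      + (if k == j then 2^-1 * \tr (rho0 *m Dj S 0 k Hp Hp) else 0).
Proof.
pose p := rev [seq i : 'I_M <- enum 'I_M | (k < i)%N].
pose p' := rev [seq i : 'I_M <- enum 'I_M | (j < i)%N].
pose b := rev [seq i : 'I_M <- enum 'I_M | (k < i)%N && (i < j)%N].
have jpE : (j \in p) = (k < j)%N by rewrite mem_rev mem_filter mem_enum andbT.
have jp : j \in p -> [/\ p = p' ++ j :: b, j \notin p' & j \notin b].
  rewrite jpE => kj; split.
  - by rewrite /p (between_split kj).2 rev_cat rev_cons cat_rcons.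
  - by rewrite mem_rev notin_filter_gt.
  - by rewrite mem_rev mem_filter ltnn andbF.
have sE : rev (enum 'I_M) = rev [seq i : 'I_M <- enum 'I_M | (j < i)%N] ++
    j :: rev [seq i : 'I_M <- enum 'I_M | (i < j)%N].
  by rewrite {1}(enum_split j) rev_cat rev_cons cat_rcons.
have n1 : j \notin rev [seq i : 'I_M <- enum 'I_M | (j < i)%N].
  by rewrite mem_rev notin_filter_gt.
have n2 : j \notin rev [seq i : 'I_M <- enum 'I_M | (i < j)%N].
  by rewrite mem_rev notin_filter_lt.
have := kinetic_word wfS M0 NE_equilibrium NE_tr k (min_rword 0) sE n1 n2 jp.
move=> [sm [cv E]]; exists sm; split; first exact: cv.
rewrite dissipation0 jpE in E; rewrite -[RHS]E /Lkin_rcy.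
have -> // : (fun z => \tr (rho_rcy S z *m Phircy S z k)) =
  fun z => \tr (inv_state (Lword S z (rev (enum 'I_M))) *m Ldcomp S z p (Phi S z k)).
by apply/funext => z; rewrite /rho_rcy LrcyE.
Qed.

Lemma onsager_cy j k : Lkin_cy S j k = Lkin_rcy S k j.
Proof.
have [s1 [c1 ->]] := kinetic_cy j k; have [s2 [c2 ->]] := kinetic_rcy j k.
have on := onsager_word wfS NE_equilibrium WV Wrho.
have <- : s1 = s2.
  apply: (cseries_unique c1 c2) => n.
  (* Each summand is a single word: the letters after [k], n full cycles, the letters before [j].
     Its reversal is the corresponding word of the reversed cycle. *)
  rewrite !Ldcomp_iter /Phicy /Phircy -!Ldcomp_cat [LHS]on.
  by rewrite !rev_cat rev_flatten_nseq !catA.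
rewrite on eq_sym; case: eqP => [->|_] //.
Qed.

(** With two reservoirs the reversed cycle is a cyclic rotation of the cycle: the first map sends
    the invariant state of one to that of the other. The mean fluxes then coincide for every [zeta],
    before any differentiation. *)
Lemma kinetic_rcy_two j k : M = 2%N -> Lkin_rcy S k j = Lkin_cy S k j.
Proof.
move=> /enum_two[a [b [ab eE]]]; rewrite /Lkin_rcy /Lkin_cy.
suff -> : (fun z => \tr (rho_rcy S z *m Phircy S z k)) =
    fun z => \tr (rho_cy S z *m Phicy S z k) by [].
apply/funext => z.
have chc := Lword_channel wfS z (enum 'I_M).
have chr := Lword_channel wfS z (rev (enum 'I_M)).
have fixc : Lj S z b (Lj S z a (rho_cy S z)) = rho_cy S z.
  rewrite /rho_cy LcyE (inv_state_fix_state chc (min_word z) (dS_gt0 wfS)).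
  by rewrite -{2}(fix_state_fixed chc (min_word z) (dS_gt0 wfS)) /Lword eE.
have trc : \tr (rho_cy S z) = 1.
  rewrite /rho_cy LcyE (inv_state_fix_state chc (min_word z) (dS_gt0 wfS)).
  exact: fix_state_tr (min_word z) (dS_gt0 wfS).
have -> : rho_rcy S z = Lj S z a (rho_cy S z).
  rewrite {1}/rho_rcy LrcyE; apply: (inv_stateE chr (min_rword z) (dS_gt0 wfS)).
    by rewrite Lj_tr.
  by rewrite /Lword eE /= fixc.
rewrite [LHS]mxtrace_mulC [RHS]mxtrace_mulC /Phircy /Phicy eE.
have : k \in enum 'I_M by rewrite mem_enum.
rewrite eE !inE => /orP[] /eqP -> /=; rewrite !ltnn ?ab ltnNge ltnW //=.
  by rewrite Ljd_dual fixc.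
by rewrite Ljd_dual.
Qed.

End TimeReversal.
End Cyclic.

Section Random.
Hypothesis min_ra : minorized (Nra S).

Let min_ra' z : minorized (Lra S z).
Proof. exact/(Lra_minorized wfS). Qed.

Let Lra_fixed X : (forall j, Lj S 0 j X = X) -> Lra S 0 X = X.
Proof.
have Mc : (M%:R : C) != 0 by rewrite pnatr_eq0 -lt0n.
move=> H; rewrite /Lra; under eq_bigr => i _ do rewrite H.
rewrite sumr_const card_ord; have -> : X *+ M = (M%:R : C) *: X by rewrite scaler_nat.
by rewrite scalerA mulVf ?scale1r.
Qed.

Let Lra_rho0 : Lra S 0 rho0 = rho0.
Proof. by apply: Lra_fixed => j; exact: (Lj_fixed wfS NE_equilibrium). Qed.

Let dissipation0 j k : \tr (rho0 *m mpd k (fun z => Phi S z j) 0) =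
  if j == k then 2^-1 * \tr (rho0 *m Dj S 0 j Hp Hp) else 0.
Proof.
exact: (dissipation wfS NE_equilibrium (proj1 NE_pos) (minorized_faithful (min_ra' 0) Lra_rho0)).
Qed.

Lemma rho_ra_smooth : smoothM (rho_ra S).
Proof.
apply: msmooth_smoothM; rewrite /rho_ra.
apply: (inv_state_msmooth wfS) => [z|z|A]; [exact: Lra_channel|exact: min_ra'|].
rewrite /Lra; apply: msmoothZ; first exact: csmooth_cst.
by apply: msmooth_sum => i; apply: (Lj_msmooth wfS); exact: msmooth_cst.
Qed.

Lemma kinetic_ra_formula j k :
  exists sm,
    cseries_to (fun n => \tr (rho0 *m
      (iter n (Lrad S 0) (Phi S 0 j) *m Phirev S 0 k))) sm /\
    Lkin_ra S j k = T / M%:R * sm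
      + (if j == k then 2^-1 * \tr (rho0 *m Dj S 0 j Hp Hp) else 0).
Proof.
have [sm [cv E]] := kinetic_ra wfS M0 NE_equilibrium NE_tr j k (min_ra' 0).
exists sm; split; first exact: cv.
by rewrite dissipation0 in E.
Qed.

Lemma onsager_ra_kinetic j k : TRI S -> Lkin_ra S j k = Lkin_ra S k j.
Proof.
move=> /(TRI_reversal wfS)[W [V WV]]; have [WW _ _] := WV.
have Wrho : Theta W rho0 = rho0.
  apply: (channel_fixed_unique (Lra_channel wfS 0 M0) (min_ra' 0)).
  - by apply: Lra_fixed => i; exact: (Theta_equilibrium wfS WV NE_equilibrium).
  - exact: Lra_rho0.
  - by rewrite Theta_tr.
have [s1 [c1 ->]] := kinetic_ra_formula j k; have [s2 [c2 ->]] := kinetic_ra_formula k j.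
have <- : s1 = s2.
  apply: (cseries_unique c1 c2) => n.
  exact: (onsager_ra wfS NE_equilibrium WV Wrho).
by rewrite eq_sym; case: eqP => [->|_].
Qed.

End Random.
End Main.

Unset Implicit Arguments.

Theorem mainTheorem1 (R : realType) (M : nat) (S : RIS R M)
  (rhoNE : R -> 'M[R[i]]_(dS S)) :
  (2 <= M)%N -> RIS_wf S ->
  let T := (Ttot S)%:C in
  let rho0 := rhoNE 0 in
  let Hp := Heff S rhoNE in
  (* case sharp = cy *)
  (ER_cy S -> NE S rhoNE ->
     [/\ (* part 1 *)
         smoothM (rho_cy S) /\
         (forall j, smoothM (fun z => Phi S z j)) /\
         (forall j, smoothM (fun z => Phicy S z j)),
         (* part 2 *)
         (forall j k : 'I_M,
            exists s : R[i],
              cseries_to (fun n =>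
                \tr (rho0 *m
                  (Ldcomp S 0 [seq i : 'I_M <- enum 'I_M | (nat_of_ord k < nat_of_ord i)%N]
                     (iter n (Lcyd S 0) (Phicy S 0 j))
                   *m Phirev S 0 k))) s /\
              Lkin_cy S j k =
                T * s
                + (if (nat_of_ord k < nat_of_ord j)%N then
                     T * \tr (rho0 *m
                       (Ldcomp S 0 [seq i : 'I_M <- enum 'I_M |
                                     (nat_of_ord k < nat_of_ord i)%N &&
                                     (nat_of_ord i < nat_of_ord j)%N]
                              (Phi S 0 j)
                        *m Phirev S 0 k))
                   else 0)
                + (if j == k then 2^-1 * \tr (rho0 *m Dj S 0 j Hp Hp) else 0)),
         (* part 3 *)
         (TRI S -> forall j k : 'I_M, Lkin_cy S j k = Lkin_rcy S k j) &
         (M = 2%N -> TRI S -> forall j k : 'I_M, Lkin_cy S j k = Lkin_cy S k j)])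
  /\
  (* case sharp = ra *)
  (ER_ra S -> NE S rhoNE ->
     [/\ (* part 1 *)
         smoothM (rho_ra S) /\
         (forall j, smoothM (fun z => Phi S z j)) /\
         (forall j, smoothM (fun z => Phicy S z j)),
         (* part 2 *)
         (forall j k : 'I_M,
            exists s : R[i],
              cseries_to (fun n =>
                \tr (rho0 *m (iter n (Lrad S 0) (Phi S 0 j) *m Phirev S 0 k))) s /\
              Lkin_ra S j k =
                T / (M%:R) * s
                + (if j == k then 2^-1 * \tr (rho0 *m Dj S 0 j Hp Hp) else 0)) &
         (* part 3 *)
         (TRI S -> forall j k : 'I_M, Lkin_ra S j k = Lkin_ra S k j)]).
Proof.
move=> M2 wfS T rho0 Hp; have M0 : (0 < M)%N by exact: ltnW.
have smPhi : (forall j, smoothM (fun z => Phi S z j)) /\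
             (forall j, smoothM (fun z => Phicy S z j)).
  split=> j; apply: msmooth_smoothM; [exact: Phi_msmooth | exact: Phicy_msmooth].
split=> [[z0 prim] HNE|[z0 prim] HNE].
  have := primitive_minorized prim; rewrite LcyE => min_L.
  have min_cy : minorized (Nword S (enum 'I_M)).
    exact: (proj1 (Lword_minorized wfS z0 (enum 'I_M)) min_L).
  split.
  - by split; [exact: (rho_cy_smooth wfS min_cy) | exact: smPhi].
  - by move=> j k; exact: (kinetic_cy wfS M0 HNE min_cy).
  - move=> /(TRI_reversal wfS)[W [V WV]] j k.
    exact: (onsager_cy wfS M0 HNE min_cy WV).
  - move=> M2' /(TRI_reversal wfS)[W [V WV]] j k.
    rewrite (onsager_cy wfS M0 HNE min_cy WV).
    exact: (kinetic_rcy_two wfS min_cy WV j k M2').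
have min_L := primitive_minorized prim.
have min_ra : minorized (Nra S) by exact: (proj1 (Lra_minorized wfS z0) min_L).
split.
- by split; [exact: (rho_ra_smooth wfS M0 min_ra) | exact: smPhi].
- by move=> j k; exact: (kinetic_ra_formula wfS M0 HNE min_ra).
- by move=> tri j k; exact: (onsager_ra_kinetic wfS M0 HNE min_ra j k tri).
Qed.
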